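(* Let $(X,\{w_j\}_{j=1}^m,\{p_j\}_{j=1}^m)$ be a nonexpansive system in which at least one $w_j$ is weakly contractive, let $K$ be its invariant set, let $T:C(K)\to C(K)$ be its Ruelle operator, and let $\varrho$ be the spectral radius of $T$. If there exists an integer $k\ge1$ such that $$\sup_{x\in K}\ \sum_{|J|=k}p_{w_J}(x)\cdot\gamma_J(x)<\varrho^k,$$ then the Ruelle operator theorem holds for this system.
   Context: Let $X\subseteq\mathbb{R}^d$ be a nonempty compact set. A map $w:X\to X$ is nonexpansive if $|w(x)-w(y)|\le|x-y|$ for all $x,y\in X$, and weakly contractive if $\sup_{x,y\in X,\,|x-y|\le t}|w(x)-w(y)|<t$ for all $t>0$. A function $p$ on $X$ is Dini continuous if $\int_0^1\frac{\alpha_p(t)}{t}\,dt<\infty$, where $\alpha_p(t)=\sup_{x,y\in X,\,|x-y|\le t}|p(x)-p(y)|$. A nonexpansive system $(X,\{w_j\}_{j=1}^m,\{p_j\}_{j=1}^m)$ consists of nonexpansive maps $w_j:X\to X$ and positive Dini continuous functions $p_j:X\to(0,\infty)$, $1\le j\le m$. If at least one $w_j$ is weakly contractive, there is a unique smallest nonempty compact set $K\subseteq X$ with $K=\bigcup_{j=1}^m w_j(K)$; this is the invariant set of the system. The Ruelle operator is $T:C(K)\to C(K)$, $Tf(x)=\sum_{j=1}^m p_j(x)f(w_j(x))$, where $C(K)$ is the space of continuous functions on $K$ with the supremum norm. $T^*$ denotes the dual operator on the space $M(K)$ of finite Borel measures on $K$, and $\langle\mu,f\rangle=\int f\,d\mu$.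 For a multi-index $J=(j_1j_2\cdots j_n)$ with $1\le j_i\le m$, write $|J|=n$, $w_J=w_{j_1}\circ w_{j_2}\circ\cdots\circ w_{j_n}$, and $$p_{w_J}(x)=p_{j_1}(w_{j_2}\circ\cdots\circ w_{j_n}(x))\cdots p_{j_{n-1}}(w_{j_n}(x))\,p_{j_n}(x).$$ For $x\in K$, $\gamma_J(x)=\sup_{y\in K,\,y\neq x}\frac{|w_J(x)-w_J(y)|}{|x-y|}$ (a supremum over the empty set is $0$; relevant only if $K$ is a single point). The Ruelle operator theorem holds for the system if there exist a unique positive function $h\in C(K)$ and a unique probability measure $\mu\in M(K)$ such that $Th=\varrho h$, $T^*\mu=\varrho\mu$, $\langle\mu,h\rangle=1$, and for every $f\in C(K)$, $\varrho^{-n}T^nf$ converges to $\langle\mu,f\rangle h$ in the supremum norm. *)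

(* Defs.v *)
From HB Require Import structures.
From mathcomp Require Import all_boot all_order all_algebra.
From mathcomp Require Import all_classical all_reals all_analysis.
From mathcomp Require Import complex.
Set Implicit Arguments.
Unset Strict Implicit.
Unset Printing Implicit Defensive.
Import Order.TTheory GRing.Theory Num.Theory.
Import numFieldNormedType.Exports.
Local Open Scope classical_set_scope.
Local Open Scope ring_scope.

(* The library norm on 'rV[R]_d is the sup norm; nonexpansiveness depends on
   the norm, so the Euclidean distance is introduced explicitly. The topology
   and the compact sets of 'rV[R]_d are the usual ones of R^d. *)
Definition edist (R : realType) (d : nat) (x y : 'rV[R]_d) : R :=
  Num.sqrt (\sum_(i < d) (x ord0 i - y ord0 i) ^+ 2).

(* Maps on X, functions on X and elements of C(K) are represented by total
   functions on R^d of which only the values on X (resp. K) matter. *)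

Definition modulus (R : realType) (d : nat) (X : set 'rV[R]_d)
    (D : 'rV[R]_d -> 'rV[R]_d -> R) (t : R) : \bar R :=
  ereal_sup [set (D z.1 z.2)%:E | z in
    [set z : 'rV[R]_d * 'rV[R]_d | [/\ X z.1, X z.2 & edist z.1 z.2 <= t]]].

Definition nonexpansive (R : realType) (d : nat) (X : set 'rV[R]_d)
    (w : 'rV[R]_d -> 'rV[R]_d) : Prop :=
  forall x y, X x -> X y -> edist (w x) (w y) <= edist x y.

Definition weakly_contractive (R : realType) (d : nat) (X : set 'rV[R]_d)
    (w : 'rV[R]_d -> 'rV[R]_d) : Prop :=
  forall t : R, 0 < t ->
    (modulus X (fun x y => edist (w x) (w y)) t < t%:E)%E.

Definition dini_continuous (R : realType) (d : nat) (X : set 'rV[R]_d)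
    (p : 'rV[R]_d -> R) : Prop :=
  (\int[lebesgue_measure]_(t in `]0%R, 1%R])
     (modulus X (fun x y => `|p x - p y|%R) t * (t^-1)%:E) < +oo)%E.

Definition nonexpansive_system (R : realType) (d m : nat) (X : set 'rV[R]_d)
    (w : 'I_m -> 'rV[R]_d -> 'rV[R]_d) (p : 'I_m -> 'rV[R]_d -> R) : Prop :=
  forall j : 'I_m,
    [/\ forall x, X x -> X (w j x),
        nonexpansive X (w j),
        forall x, X x -> 0 < p j x
      & dini_continuous X (p j)].

Definition compact_invariant (R : realType) (d m : nat) (X : set 'rV[R]_d)
    (w : 'I_m -> 'rV[R]_d -> 'rV[R]_d) (K : set 'rV[R]_d) : Prop :=
  [/\ K `<=` X, K !=set0, compact K
    & K = \bigcup_(j in [set: 'I_m]) (w j @` K)].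

Definition invariant_set (R : realType) (d m : nat) (X : set 'rV[R]_d)
    (w : 'I_m -> 'rV[R]_d -> 'rV[R]_d) (K : set 'rV[R]_d) : Prop :=
  compact_invariant X w K /\
  forall K', compact_invariant X w K' -> K `<=` K'.

Definition inC (R : realType) (d : nat) (K : set 'rV[R]_d)
    (f : 'rV[R]_d -> R) : Prop :=
  {within K, continuous f}.

Definition supnorm (R : realType) (d : nat) (K : set 'rV[R]_d)
    (f : 'rV[R]_d -> R) : R :=
  sup [set `|f x| | x in K].

Definition ruelle (R : realType) (d m : nat)
    (w : 'I_m -> 'rV[R]_d -> 'rV[R]_d) (p : 'I_m -> 'rV[R]_d -> R)
    (f : 'rV[R]_d -> R) : 'rV[R]_d -> R :=
  fun x => \sum_(j < m) p j x * f (w j x).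

(* The spectral radius of an operator on the real space C(K) is that of its
   complexification, which acts on the complex-valued continuous functions. *)

Definition inCC (R : realType) (d : nat) (K : set 'rV[R]_d)
    (f : 'rV[R]_d -> R[i]) : Prop :=
  inC K (fun x => complex.Re (f x)) /\ inC K (fun x => complex.Im (f x)).

Definition cmod (R : realType) (z : R[i]) : R :=
  Num.sqrt (complex.Re z ^+ 2 + complex.Im z ^+ 2).

Definition complexification (R : realType) (d : nat)
    (T : ('rV[R]_d -> R) -> 'rV[R]_d -> R)
    (f : 'rV[R]_d -> R[i]) : 'rV[R]_d -> R[i] :=
  fun x => Complex (T (fun y => complex.Re (f y)) x)
                   (T (fun y => complex.Im (f y)) x).

Definition bounded_operator (R : realType) (d : nat) (K : set 'rV[R]_d)
    (S : ('rV[R]_d -> R[i]) -> 'rV[R]_d -> R[i]) : Prop :=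
  [/\ forall f, inCC K f -> inCC K (S f),
      forall (a : R[i]) f g, inCC K f -> inCC K g -> forall x, K x ->
        S (fun y => a * f y + g y) x = a * S f x + S g x
    & exists M : R, forall f, inCC K f ->
        supnorm K (fun x => cmod (S f x)) <=
          M * supnorm K (fun x => cmod (f x))].

(* lam - A has a two-sided inverse among the bounded operators on C(K). *)
Definition resolvent_set (R : realType) (d : nat) (K : set 'rV[R]_d)
    (A : ('rV[R]_d -> R[i]) -> 'rV[R]_d -> R[i]) : set R[i] :=
  [set lam | exists S, bounded_operator K S /\
    forall f, inCC K f -> forall x, K x ->
      S (fun y => lam * f y - A f y) x = f x /\
      lam * S f x - A (S f) x = f x].

Definition spectrum (R : realType) (d : nat) (K : set 'rV[R]_d)
    (A : ('rV[R]_d -> R[i]) -> 'rV[R]_d -> R[i]) : set R[i] :=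
  ~` resolvent_set K A.

Definition spectral_radius (R : realType) (d : nat) (K : set 'rV[R]_d)
    (T : ('rV[R]_d -> R) -> 'rV[R]_d -> R) : R :=
  sup [set cmod lam | lam in spectrum K (complexification T)].

Fixpoint wJ (R : realType) (d m : nat) (w : 'I_m -> 'rV[R]_d -> 'rV[R]_d)
    (J : seq 'I_m) (x : 'rV[R]_d) : 'rV[R]_d :=
  if J is j :: J' then w j (wJ w J' x) else x.

Fixpoint pwJ (R : realType) (d m : nat) (w : 'I_m -> 'rV[R]_d -> 'rV[R]_d)
    (p : 'I_m -> 'rV[R]_d -> R) (J : seq 'I_m) (x : 'rV[R]_d) : R :=
  if J is j :: J' then p j (wJ w J' x) * pwJ w p J' x else 1.

(* The real supremum of the empty set is 0. *)
Definition gammaJ (R : realType) (d m : nat) (K : set 'rV[R]_d)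
    (w : 'I_m -> 'rV[R]_d -> 'rV[R]_d) (J : seq 'I_m) (x : 'rV[R]_d) : R :=
  sup [set edist (wJ w J x) (wJ w J y) / edist x y |
        y in [set y | K y /\ y <> x]].

Definition borel (R : realType) (d : nat) :=
  g_sigma_algebraType (@open 'rV[R]_d).

(* Borel probability measures on K are represented by the Borel probability
   measures on R^d that are concentrated on K. *)
Definition concentrated (R : realType) (d : nat) (K : set 'rV[R]_d)
    (mu : probability (borel R d) R) : Prop :=
  mu (~` K) = 0%E.

Definition pairing (R : realType) (d : nat) (K : set 'rV[R]_d)
    (mu : probability (borel R d) R) (f : 'rV[R]_d -> R) : R :=
  \int[mu]_(x in K) f x.

(* T^* mu = rho mu is the equality of the functionals f |-> <mu, T f> and
   f |-> rho <mu, f> on C(K). *)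
Definition ruelle_data (R : realType) (d : nat) (K : set 'rV[R]_d)
    (T : ('rV[R]_d -> R) -> 'rV[R]_d -> R) (rho : R)
    (h : 'rV[R]_d -> R) (mu : probability (borel R d) R) : Prop :=
  [/\ inC K h /\ (forall x, K x -> 0 < h x),
      concentrated K mu,
      forall x, K x -> T h x = rho * h x,
      (forall f, inC K f -> pairing K mu (T f) = rho * pairing K mu f) /\
      pairing K mu h = 1
    & forall f, inC K f ->
        (fun n : nat => supnorm K
           (fun x => rho ^- n * iter n T f x - pairing K mu f * h x))
          @ \oo --> (0 : R)].

Definition ruelle_operator_theorem (R : realType) (d m : nat)
    (K : set 'rV[R]_d) (w : 'I_m -> 'rV[R]_d -> 'rV[R]_d)
    (p : 'I_m -> 'rV[R]_d -> R) : Prop :=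
  let T := ruelle w p in
  let rho := spectral_radius K T in
  exists h mu, ruelle_data K T rho h mu /\
    forall h' mu', ruelle_data K T rho h' mu' ->
      (forall x, K x -> h' x = h x) /\
      (forall A : set (borel R d), measurable A -> mu' A = mu A).

(* Main.v *)
(** The growth rate r of T^n 1 bounds the spectrum of T (Neumann series), so
    the average contraction hypothesis holds with r^k in place of rho^k. Coupling
    two orbits by the same maps and weights then shows, thanks to Dini continuity,
    that the functions r^-n T^n f are equicontinuous. The maps move every point
    close to any given point of K after a bounded number of steps, since K is the
    orbit closure of the fixed point of a weakly contractive map; hence T^n 1 is
    comparable to r^n, and the oscillation of T^n f / T^n 1 is contracted to 0.
    Its limit nu f is a positive functional with nu (T f) = r nu f, and r^-n T^n 1
    converges to an eigenfunction h of eigenvalue r, which shows that r is the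
    spectral radius. The measure is obtained from nu by Caratheodory's extension
    of an outer measure. *)
From HB Require Import structures.
From mathcomp Require Import all_boot all_order all_algebra.
From mathcomp Require Import all_classical all_reals all_analysis.
From mathcomp Require Import measurable_realfun complex ring lra.
Require Import Defs.
Set Implicit Arguments.
Unset Strict Implicit.
Unset Printing Implicit Defensive.
Import Order.TTheory GRing.Theory Num.Theory.
Import numFieldNormedType.Exports.
Local Open Scope classical_set_scope.
Local Open Scope ring_scope.

(** The maps are only nonexpansive, so two orbits need not approach each other and the Dini sums
    cannot be bounded branch by branch. Only the mean distance of the coupled orbits decays, like
    [sigma ^+ n] with [sigma < r]. Each step is therefore cut at a scale that depends on its index
    alone: below the scale the modulus of the weights counts, above it the mean distance. A second
    obstacle is circular. Equicontinuity of r^-n T^n f needs T^n 1 to be bounded by a multiple of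
    r^n, while the definition of r yields only bounds by s^n with s > r. The estimate is therefore
    stated relative to any bound [B] of the earlier iterates, and is applied first at those n where
    the sup of r^-n T^n 1 is at least all its earlier values. Until an eigenfunction is found, only
    the inequality rho <= r is known for the spectral radius; it is the direction that transfers the
    hypothesis to r. The dynamical part is written over a bare type with a function [D], so that it
    applies to pairs of points as well; topology and measures enter afterwards. *)

Lemma divr2_gt0 (R : realType) (x : R) : 0 < x -> 0 < x / 2.
Proof. by move=> x0; rewrite divr_gt0. Qed.

Lemma geometric_unbounded (R : realType) (q C : R) : 1 < q -> exists n, C < q ^+ n.
Proof.
move=> q1; have [n Cn] : exists n : nat, C < n%:R * (q - 1).
  exists (Num.truncn (`|C| / (q - 1))).+1.
  rewrite -ltr_pdivrMr ?subr_gt0//; apply: le_lt_trans (truncnS_gt _).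
  by rewrite ler_wpM2r ?invr_ge0 ?subr_ge0 ?ler_norm ?(ltW q1).
exists n; apply: lt_le_trans Cn _; elim: n => [|n IH].
  by rewrite mul0r expr0.
rewrite exprS -addn1 natrD mulrDl mul1r.
have : 1 <= q ^+ n by rewrite exprn_ege1 ?ltW.
nra.
Qed.

Lemma geometric_small (R : realType) (q e : R) :
  0 <= q -> q < 1 -> 0 < e -> exists n, q ^+ n <= e.
Proof.
move=> q0 q1 e0; have [->|qN0] := eqVneq q 0.
  by exists 1%N; rewrite expr1 ltW.
have [|n] := @geometric_unbounded R q^-1 e^-1.
  by rewrite invf_gt1// lt_neqAle eq_sym qN0.
rewrite exprVn => /ltW en; exists n; move: en.
by rewrite lef_pV2 // posrE exprn_gt0 // lt_neqAle eq_sym qN0.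
Qed.

Lemma exists_root (R : realType) (n : nat) (x : R) :
  (0 < n)%N -> 0 <= x -> exists2 y, 0 <= y & y ^+ n = x.
Proof.
move=> n0 x0; exists (x `^ n%:R^-1); first exact: powR_ge0.
by rewrite -powR_mulrn ?powR_ge0// -powRrM mulVf ?powRr1// pnatr_eq0 -lt0n.
Qed.

(** The formula of [ruelle] over an arbitrary type [V], since it is also used on [V * V] for coupled
    orbits. *)
Definition transfer (R : realType) (V : Type) (m : nat)
    (w : 'I_m -> V -> V) (p : 'I_m -> V -> R) (f : V -> R) : V -> R :=
  fun x => \sum_(j < m) p j x * f (w j x).

(** * Positive transfer operators on functions over a set *)

Section PositiveTransfer.
Context (R : realType) (V : Type) (m : nat) (K : set V).
Context (w : 'I_m -> V -> V) (p : 'I_m -> V -> R).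
Hypothesis K_stable : forall j x, K x -> K (w j x).
Hypothesis p_ge0 : forall j x, K x -> 0 <= p j x.
Local Notation T := (transfer w p).
Implicit Types f g : V -> R.

Lemma transfer_le f g : (forall x, K x -> f x <= g x) ->
  forall x, K x -> T f x <= T g x.
Proof.
by move=> fg x Kx; apply: ler_sum => j _; rewrite ler_wpM2l ?p_ge0 ?fg//; exact: K_stable.
Qed.

Lemma iter_transfer_le n f g : (forall x, K x -> f x <= g x) ->
  forall x, K x -> iter n T f x <= iter n T g x.
Proof. by elim: n f g => //= n IH f g fg; apply/transfer_le/IH. Qed.

Lemma iter_transfer_lin n a b f g :
  iter n T (fun x => a * f x + b * g x) =
  fun x => a * iter n T f x + b * iter n T g x.
Proof.
elim: n => //= n ->; apply/funext => x; rewrite /transfer !big_distrr -big_split.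
by apply: eq_bigr => j _ /=; ring.
Qed.

Lemma iter_transferZ n a f :
  iter n T (fun x => a * f x) = fun x => a * iter n T f x.
Proof.
have := iter_transfer_lin n a 0 f f.
under eq_fun do rewrite mul0r addr0.
by move=> ->; apply/funext => x; rewrite mul0r addr0.
Qed.

Lemma iter_transfer_ge0 n f : (forall x, K x -> 0 <= f x) ->
  forall x, K x -> 0 <= iter n T f x.
Proof.
move=> f0; elim: n => //= n IH x Kx; apply: sumr_ge0 => j _.
by rewrite mulr_ge0 ?p_ge0 ?IH//; exact: K_stable.
Qed.

Lemma iter_transfer_norm n f B : (forall x, K x -> `|f x| <= B) ->
  forall x, K x -> `|iter n T f x| <= B * iter n T (fun=> 1) x.
Proof.
move=> fB x Kx; have := iter_transferZ n B (fun=> 1) => /(congr1 (@^~ x)) /= <-.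
have := iter_transferZ n (-1) (fun=> B * 1) => /(congr1 (@^~ x)) /= h.
rewrite ler_norml -mulN1r -h; apply/andP; split; apply: iter_transfer_le => // y Ky.
  by rewrite mulN1r mulr1; have := fB y Ky; rewrite ler_norml => /andP[].
by rewrite mulr1; have := fB y Ky; rewrite ler_norml => /andP[].
Qed.

(** Divide [n] by [k]: every full block of [k] steps costs at most [sigma ^+ k], and the fewer than
    [k] remaining steps cost powers of [M]. It serves twice: with [f = 1] for the growth rate, and
    with the distance on pairs of points. *)
Lemma iter_transfer_geometric k s sigma M f : (0 < k)%N -> 0 <= M ->
  0 < sigma -> s <= sigma ^+ k -> (forall x, K x -> 0 <= f x) ->
  (forall x, K x -> T f x <= M * f x) ->
  (forall x, K x -> iter k T f x <= s * f x) ->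
  exists2 C, 0 <= C & forall n x, K x -> iter n T f x <= C * sigma ^+ n * f x.
Proof.
move=> k0 M0 s0 sk f0 TM Tk.
have TMn n x : K x -> iter n T f x <= M ^+ n * f x.
  elim: n x => [|n IH] x Kx; first by rewrite expr0 mul1r.
  rewrite /= exprSr -mulrA; apply: (@le_trans _ _ (T (fun y => M ^+ n * f y) x)).
    exact: transfer_le.
  have := iter_transferZ 1 (M ^+ n) f => /(congr1 (@^~ x)) /= ->.
  by rewrite ler_wpM2l ?exprn_ge0// TM.
(* The sum dominates each remainder factor [(M / sigma) ^+ i] with [i < k]. *)
exists (\sum_(i < k) (M / sigma) ^+ i).
  by apply: sumr_ge0 => i _; rewrite exprn_ge0// divr_ge0// ltW.
elim/ltn_ind => n IH x Kx; have [nk|kn] := ltnP n k.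
  apply: le_trans (TMn _ _ Kx) _; rewrite ler_wpM2r ?f0//.
  rewrite (bigD1 (Ordinal nk)) //= mulrDl expr_div_n divfK; last first.
    by rewrite expf_eq0 gt_eqF ?andbF.
  rewrite lerDl mulr_ge0 ?exprn_ge0 ?(ltW s0)//.
  by apply: sumr_ge0 => i _; rewrite exprn_ge0// divr_ge0// ltW.
rewrite -{1}(subnK kn) iterD.
apply: (@le_trans _ _ (iter (n - k) T (fun y => s * f y) x)).
  exact: iter_transfer_le.
rewrite iter_transferZ; apply: (@le_trans _ _ (sigma ^+ k * iter (n - k) T f x)).
  by rewrite ler_wpM2r// iter_transfer_ge0.
rewrite -{2}(subnK kn) exprD [leRHS](_ : _ =
  sigma ^+ k * ((\sum_(i < k) (M / sigma) ^+ i) * sigma ^+ (n - k) * f x)); last by ring.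
rewrite ler_wpM2l ?exprn_ge0 ?(ltW s0)//; apply: IH => //.
by rewrite ltn_subrL k0 (leq_trans k0 kn).
Qed.

End PositiveTransfer.

(** * The exponential growth rate of the iterates of 1 *)

Section GrowthRate.
Context (R : realType) (V : Type) (m : nat) (K : set V).
Context (w : 'I_m -> V -> V) (p : 'I_m -> V -> R).
Hypothesis m_gt0 : (0 < m)%N.
Hypothesis K0 : K !=set0.
Hypothesis K_stable : forall j x, K x -> K (w j x).
Context (pmin pmax : R).
Hypothesis pmin_gt0 : 0 < pmin.
Hypothesis p_ge : forall j x, K x -> pmin <= p j x.
Hypothesis p_le : forall j x, K x -> p j x <= pmax.
Local Notation T := (transfer w p).
Local Notation u n := (iter n T (fun=> 1)).

(* By Fekete's lemma this is the limit of the n-th roots of the sup norms of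
   the functions T^n 1, that is, the spectral radius of T on C(K). *)
Definition growth_rate : R :=
  inf [set s | 0 < s /\ exists2 n, (0 < n)%N & forall x, K x -> u n x <= s ^+ n].

Let p_ge0 j x : K x -> 0 <= p j x.
Proof. by move=> /(p_ge j); apply: le_trans; rewrite ltW. Qed.

Let pmax_gt0 : 0 < pmax.
Proof.
have [x Kx] := K0; apply: lt_le_trans pmin_gt0 _.
exact: le_trans (p_ge (Ordinal m_gt0) Kx) (p_le _ Kx).
Qed.

Lemma transfer1_le x : K x -> T (fun=> 1) x <= m%:R * pmax.
Proof.
move=> Kx; rewrite /transfer; apply: (@le_trans _ _ (\sum_(j < m) pmax)).
  by apply: ler_sum => j _; rewrite mulr1 p_le.
by rewrite sumr_const card_ord mulr_natl.
Qed.

Lemma transfer1_ge x : K x -> pmin <= T (fun=> 1) x.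
Proof.
move=> Kx; rewrite /transfer (bigD1 (Ordinal m_gt0))//= mulr1.
rewrite -[pmin]addr0 lerD ?p_ge// sumr_ge0// => j _.
by rewrite mulr1 p_ge0.
Qed.

Lemma iter_transfer1_gt0 n x : K x -> 0 < u n x.
Proof.
elim: n x => //= n IH x Kx.
rewrite /transfer (bigD1 (Ordinal m_gt0))//= ltr_wpDr//.
  by apply: sumr_ge0 => j _; rewrite mulr_ge0 ?p_ge0 // ltW// IH//; exact: K_stable.
by rewrite mulr_gt0//; [exact: lt_le_trans pmin_gt0 (p_ge _ Kx)|exact/IH/K_stable].
Qed.

Let growth_set := [set s : R | 0 < s /\
  exists2 n, (0 < n)%N & forall x, K x -> u n x <= s ^+ n].

Let growth_set_has_inf : has_inf growth_set.
Proof.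
split; last by exists 0 => s [s0 _]; exact: ltW.
exists (m%:R * pmax); split; first by rewrite mulr_gt0 ?ltr0n.
by exists 1%N => // x Kx; rewrite expr1 transfer1_le.
Qed.

(** Submultiplicativity: one exponent [n] at which [u n] is below [s ^+ n] controls all exponents up
    to a constant. *)
Lemma growth_rate_geometric t : growth_rate < t -> exists s C : R,
  [/\ 0 < s, s < t, 0 <= C & forall n x, K x -> u n x <= C * s ^+ n].
Proof.
move=> rt; have [s [s0 [k k0 us]] st] : exists2 s, growth_set s & s < t.
  by case: (inf_lt growth_set_has_inf.1 rt) => s; exists s.
have [|||x Kx|x Kx|x Kx|C C0 uC] := @iter_transfer_geometric R V m K w p K_stable p_ge0
  k (s ^+ k) s (m%:R * pmax) (fun=> 1) k0.
- by rewrite mulr_ge0 ?ler0n// ltW.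
- exact: s0.
- exact: lexx.
- by [].
- by rewrite mulr1 transfer1_le.
- by rewrite mulr1 us.
by exists s, C; split=> // n x Kx; have := uC n x Kx; rewrite mulr1.
Qed.

Lemma growth_rate_ge0 : 0 <= growth_rate.
Proof.
apply: lb_le_inf; first by case: growth_set_has_inf.
by move=> s [s0 _]; exact: ltW.
Qed.

(** The [n]-th root of [b] belongs to the set whose infimum is [growth_rate]. *)
Lemma growth_rate_lower n b : (forall x, K x -> u n x <= b) -> growth_rate ^+ n <= b.
Proof.
have [x Kx] := K0; case: n => [|n] ub; first exact: (ub x Kx).
have b0 : 0 < b by apply: lt_le_trans (iter_transfer1_gt0 n.+1 Kx) (ub x Kx).
have [t t0 tb] := @exists_root R n.+1 b isT (ltW b0).
rewrite -tb lerXn2r ?nnegrE ?growth_rate_ge0//.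
apply: ge_inf; first by case: growth_set_has_inf.
split; last by exists n.+1 => // y Ky; rewrite tb ub.
by rewrite lt_neqAle t0 andbT; apply: contraTneq b0 => t0'; rewrite -tb -t0' expr0n ltxx.
Qed.

(** Iterating the lower bound gives [b ^+ k <= u (k * n)]. Were [growth_rate] below the [n]-th root
    [t] of [b], then [u (k * n)] would be at most [C * s ^+ (k * n)] with [s < t], which is too
    small for large [k]. *)
Lemma growth_rate_upper n b : (forall x, K x -> b <= u n x) -> b <= growth_rate ^+ n.
Proof.
have [x Kx] := K0; case: n => [|n] lb; first exact: (lb x Kx).
have [b0|b0] := leP b 0; first by rewrite (le_trans b0)// exprn_ge0// growth_rate_ge0.
rewrite leNgt; apply/negP => rb.
have [t t0 tb] := @exists_root R n.+1 b isT (ltW b0).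
have rt : growth_rate < t.
  rewrite ltNge; apply: contraTN rb => tr.
  by rewrite -leNgt -tb lerXn2r ?nnegrE// growth_rate_ge0.
have [s [C [s0 st C0 uC]]] := growth_rate_geometric rt.
have ubk k : b ^+ k <= u (k * n.+1)%N x.
  elim: k x Kx => [|k IH] y Ky; first by rewrite mul0n.
  rewrite mulSn addnC iterD exprS.
  apply: (@le_trans _ _ (iter (k * n.+1) T (fun z => b * 1) y)).
    have /(congr1 (@^~ y)) /= -> := iter_transferZ w p (k * n.+1) b (fun=> 1).
    by rewrite ler_pM2l// IH.
  by apply: (iter_transfer_le K_stable p_ge0) => // z Kz; rewrite mulr1 lb.
have q1 : 1 < (t / s) ^+ n.+1 by rewrite exprn_egt1// ltr_pdivlMr// mul1r.
have [k Ck] := geometric_unbounded C q1.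
move: Ck; apply/negP; rewrite -leNgt -exprM mulnC expr_div_n.
rewrite ler_pdivrMr ?exprn_gt0// (le_trans _ (uC _ _ Kx))//.
by rewrite mulnC exprM tb mulnC ubk.
Qed.

Lemma growth_rate_gt0 : 0 < growth_rate.
Proof.
by apply: lt_le_trans pmin_gt0 _; rewrite -[growth_rate]expr1;
  apply: growth_rate_upper => x Kx; exact: transfer1_ge.
Qed.

End GrowthRate.

Lemma summable_tail (R : realType) (e : nat -> R) (A eps : R) :
  (forall i, 0 <= e i) -> (forall n, \sum_(i < n) e i <= A) -> 0 < eps ->
  exists L, forall n, \sum_(i < n | (L <= i)%N) e i <= eps.
Proof.
move=> e0 eA eps0; pose S := [set \sum_(i < n) e i | n in [set: nat]].
have supS : has_sup S.
  split; first by exists 0, 0%N => //; rewrite big_ord0.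
  by exists A => _ [n _ <-].
have [_ [L _ <-] SL] := sup_adherent eps0 supS.
exists L => n; rewrite -(lerD2l (\sum_(i < L) e i)).
apply: (@le_trans _ _ (\sum_(i < maxn L n) e i)); last first.
  apply: (@le_trans _ _ (sup S)); last by lra.
  by apply: ub_le_sup; [case: supS|exists (maxn L n)].
rewrite [leRHS](bigID (fun i : 'I_(maxn L n) => (i < L)%N)) /= lerD//.
  by rewrite [leLHS](big_ord_widen_cond _ predT e (leq_maxl L n)).
rewrite (big_ord_widen_cond _ (fun i => (L <= i)%N) e (leq_maxr L n)).
rewrite [leRHS](bigID (fun i : 'I_(maxn L n) => (i < n)%N)) /=.
rewrite -[leLHS]addr0 lerD ?sumr_ge0//.
by under [leRHS]eq_bigl do rewrite -leqNgt.
Qed.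

Lemma geometric_sum_le (R : realType) (q : R) n : 0 <= q -> q < 1 ->
  \sum_(i < n) q ^+ i <= (1 - q)^-1.
Proof.
move=> q0 q1; rewrite -[leRHS]mul1r ler_pdivlMr ?subr_gt0// mulrC.
rewrite -[1 - q]opprB mulNr -subrX1 opprB gerBl; exact: exprn_ge0.
Qed.

(* The index l i is frozen at a large value l0 for the finitely many small i. *)
Lemma summable_split (R : realType) (e : nat -> R) (A C kappa theta eps : R) :
  (forall i, 0 <= e i) -> (forall n, \sum_(i < n) e i <= A) -> 0 <= C ->
  0 <= theta -> theta < kappa -> kappa < 1 -> 0 < eps ->
  exists (delta : R) (l : nat -> nat), 0 < delta /\
    forall n, \sum_(i < n) (e (l i) + C * kappa ^- l i * theta ^+ i * delta) <= eps.
Proof.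
move=> e0 eA C0 t0 tk k1 eps0.
have kap0 : 0 < kappa by exact: le_lt_trans tk.
have [|L tailL] := @summable_tail R e A (eps / 4) e0 eA; first by lra.
(* At most [L] indices are frozen at [l0], so [e l0 <= eps / 4 / L.+1%:R] keeps their total below
   [eps / 4]; the tail from [L] on takes another [eps / 4]. *)
have [|l0 el0] := @summable_tail R e A (eps / 4 / L.+1%:R) e0 eA.
  by rewrite !divr_gt0.
have {}el0 : e l0 <= eps / 4 / L.+1%:R.
  apply: le_trans (el0 l0.+1); rewrite big_mkcond big_ord_recr /= leqnn.
  by rewrite lerDr sumr_ge0// => i _; case: ifP.
pose q := theta / kappa; pose l i := if (i < L)%N then l0 else i.
have q0 : 0 <= q by rewrite divr_ge0// ltW.
have q1 : q < 1 by rewrite ltr_pdivrMr// mul1r.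
have k1' : 1 <= kappa ^- l0 by rewrite -exprVn exprn_ege1// invf_ge1// ltW.
(* A bound, before the factor [delta], of the geometric series of ratio [theta / kappa]; [delta]
   then brings it below [eps / 2]. *)
pose G := C * kappa ^- l0 * (1 - q)^-1.
have G0 : 0 <= G.
  by rewrite !mulr_ge0// ?invr_ge0 ?exprn_ge0 ?subr_ge0 ?(ltW kap0) ?(ltW q1).
pose delta := eps / 2 / (G + 1).
have delta0 : 0 < delta by rewrite !divr_gt0// ltr_wpDl.
exists delta, l; split=> // n; rewrite big_split /=.
have S1 : \sum_(i < n) e (l i) <= eps / 2.
  rewrite (bigID (fun i : 'I_n => (i < L)%N)) /=.
  apply: (@le_trans _ _ (eps / 4 + eps / 4)); last by lra.
  apply: lerD; last first.
    apply: le_trans (tailL n); under [leRHS]eq_bigl do rewrite leqNgt.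
    by apply: ler_sum => i iL; rewrite /l (negbTE iL).
  apply: (@le_trans _ _ (\sum_(i < L) eps / 4 / L.+1%:R)).
    apply: (@le_trans _ _ (\sum_(i < n | (i < L)%N) eps / 4 / L.+1%:R)).
      by apply: ler_sum => i iL; rewrite /l iL.
    rewrite (big_ord_widen_cond (maxn n L) (fun i => (i < L)%N)
      (fun=> eps / 4 / L.+1%:R) (leq_maxl n L)).
    rewrite [leRHS](big_ord_widen (maxn n L) (fun=> eps / 4 / L.+1%:R) (leq_maxr n L)).
    rewrite big_mkcond [leRHS]big_mkcond /=; apply: ler_sum => i _.
    by do 2 case: ifP => //; case: (i < L)%N => //; rewrite ?divr_ge0// ?ltW// !divr_gt0.
  rewrite sumr_const card_ord -[_ *+ L]mulr_natr mulrAC ler_pdivrMr// ler_wpM2l ?ler_nat//.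
  by lra.
suff S2 : \sum_(i < n) C * kappa ^- l i * theta ^+ i * delta <= eps / 2 by lra.
apply: (@le_trans _ _ (\sum_(i < n) C * kappa ^- l0 * delta * q ^+ i)).
  apply: ler_sum => i _; rewrite [leLHS](_ : _ = C * delta * (kappa ^- l i * theta ^+ i)); last by ring.
  rewrite [leRHS](_ : _ = C * delta * (kappa ^- l0 * q ^+ i)); last by ring.
  rewrite ler_wpM2l ?(mulr_ge0 C0 (ltW delta0))//.
  have -> : theta ^+ i = kappa ^+ i * q ^+ i.
    by rewrite -exprMn mulrC divfK// gt_eqF.
  rewrite mulrA ler_wpM2r ?exprn_ge0// /l; case: ifP => _.
    by rewrite ler_piMr ?invr_ge0 ?exprn_ge0 ?exprn_ile1 ?(ltW kap0)// ltW.
  by rewrite mulVf// expf_eq0 gt_eqF ?andbF.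
rewrite -mulr_sumr; apply: (@le_trans _ _ (C * kappa ^- l0 * delta * (1 - q)^-1)).
  rewrite ler_wpM2l ?geometric_sum_le//; apply: mulr_ge0 (ltW delta0).
  by rewrite mulr_ge0// invr_ge0 exprn_ge0// ltW.
rewrite [leLHS](_ : _ = (eps / 2) * (G / (G + 1))); last by rewrite /delta /G; ring.
apply: ler_piMr; first by lra.
by rewrite ler_pdivrMr ?mul1r ?lerDl// ltr_wpDl.
Qed.

(** * Equicontinuity of the iterates by coupling two orbits *)

Section Equicontinuity.
Context (R : realType) (V : Type) (m : nat) (K : set V).
Context (w : 'I_m -> V -> V) (p : 'I_m -> V -> R) (D : V -> V -> R).
Context (pmin r sigma C : R).
Hypothesis K_stable : forall j x, K x -> K (w j x).
Hypothesis pmin_gt0 : 0 < pmin.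
Hypothesis p_ge : forall j x, K x -> pmin <= p j x.
Hypothesis D_ge0 : forall x y, K x -> K y -> 0 <= D x y.
Local Notation T := (transfer w p).

Definition coupled_maps (j : 'I_m) (z : V * V) : V * V := (w j z.1, w j z.2).
(** Both points move with the weight seen from the first one, so [transfer] on pairs acts as [T] on
    functions of the first point. The discrepancy with the weights at the second point is charged to
    [weight_osc]. *)
Definition coupled_weights (j : 'I_m) (z : V * V) : R := p j z.1.
Local Notation S := (transfer coupled_maps coupled_weights).
Local Notation K2 := (K `*` K).

(** One-sided, like the comparison of weights in [pos_diff_transfer]; exchanging the points gives
    the other side. *)
Definition pos_diff (f : V -> R) (z : V * V) : R := Num.max 0 (f z.1 - f z.2).

(** A relative oscillation: with [c] its value, every weight at the second point is at least [1 - c]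
    times the weight at the first. The cut at 1 keeps [1 - c] nonnegative and makes the crude bound
    1 available for distant points. *)
Definition weight_osc (z : V * V) : R :=
  Num.min 1 (\sum_(j < m) `|p j z.1 - p j z.2| / pmin).

Let p_ge0 j x : K x -> 0 <= p j x.
Proof. by move=> /(p_ge j); apply: le_trans; rewrite ltW. Qed.

Let K2_stable j z : K2 z -> K2 (coupled_maps j z).
Proof. by case=> Kx Ky; split; exact: K_stable. Qed.

Let q_ge0 j z : K2 z -> 0 <= coupled_weights j z.
Proof. by case=> Kx Ky; exact: p_ge0. Qed.

Lemma iter_coupled_fst n (g : V -> R) :
  iter n S (fun z => g z.1) = fun z => iter n T g z.1.
Proof. by elim: n => //= n ->. Qed.

Lemma weight_osc_ge0 z : 0 <= weight_osc z.
Proof.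
rewrite /weight_osc le_min ler01 sumr_ge0// => j _.
by rewrite divr_ge0// ltW.
Qed.

(** For one map, with weights a, b and values X, Y of [g], the bound b >= a (1 - c) gives aX - bY <=
    a (1 - c) (X - Y) + c a X. *)
Lemma pos_diff_transfer g z : (forall x, K x -> 0 <= g x) -> K2 z ->
  pos_diff (T g) z <= S (pos_diff g) z + weight_osc z * T g z.1.
Proof.
move=> g0 [Kx Ky]; rewrite /pos_diff ge_max; apply/andP; split.
  rewrite addr_ge0// ?mulr_ge0 ?weight_osc_ge0//.
    apply: sumr_ge0 => j _; rewrite mulr_ge0 ?le_max ?lexx//.
    exact: (q_ge0 _ (conj Kx Ky)).
  by apply: sumr_ge0 => j _; rewrite mulr_ge0 ?p_ge0//; exact/g0/K_stable.
rewrite /transfer mulr_sumr -sumrB -big_split /=; apply: ler_sum => j _.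
rewrite /coupled_weights /=; set c := weight_osc z.
have px := p_ge j Kx; have py := p_ge0 j Ky.
have gx := g0 _ (K_stable j Kx); have gy := g0 _ (K_stable j Ky).
have c0 : 0 <= c := weight_osc_ge0 z.
have c1 : c <= 1 by rewrite /c /weight_osc ge_min lexx.
have pc : p j z.1 * (1 - c) <= p j z.2.
  rewrite /c /weight_osc; have [|cs] := leP 1; first by rewrite subrr mulr0.
  have : `|p j z.1 - p j z.2| / pmin <= \sum_(j0 < m) `|p j0 z.1 - p j0 z.2| / pmin.
    rewrite (bigD1 j)//= lerDl sumr_ge0// => i _; exact: divr_ge0 (ltW _).
  set s := \sum_(j0 < m) _; rewrite ler_pdivrMr// => h.
  have {}h : p j z.1 - p j z.2 <= s * pmin by apply: le_trans h; exact: ler_norm.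
  have s0 : 0 <= s by apply: sumr_ge0 => i _; exact: divr_ge0 (ltW _).
  have : s * pmin <= s * p j z.1 by exact: ler_wpM2l.
  lra.
have M1 : g (w j z.1) - g (w j z.2) <= Num.max 0 (g (w j z.1) - g (w j z.2)).
  by rewrite le_max lexx orbT.
have M0 : 0 <= Num.max 0 (g (w j z.1) - g (w j z.2)) by rewrite le_max lexx.
set M := Num.max _ _ in M1 M0 *.
set a := p j z.1 in px pc *; set b := p j z.2 in py pc *.
set X := g _ in gx M1 *; set Y := g _ in gy M1 *.
have h1 : a * (1 - c) * Y <= b * Y by exact: ler_wpM2r.
have h2 : (a * (1 - c)) * (X - Y) <= (a * (1 - c)) * M.
  by rewrite ler_wpM2l// mulr_ge0// ?subr_ge0//; exact: p_ge0.
have h3 : 0 <= a * c * M by rewrite !mulr_ge0//; exact: p_ge0.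
lra.
Qed.

Lemma transfer_sum n (F : 'I_n -> V * V -> R) :
  S (fun z => \sum_(i < n) F i z) = fun z => \sum_(i < n) S (F i) z.
Proof.
apply/funext => z; rewrite /transfer exchange_big /=.
by apply: eq_bigr => j _; rewrite mulr_sumr.
Qed.

(** A Duhamel expansion: the weight error made on [iter (n - i) T f] is carried along by [i] coupled
    steps. *)
Lemma pos_diff_iter_transfer n f z : (forall x, K x -> 0 <= f x) -> K2 z ->
  pos_diff (iter n T f) z <= iter n S (pos_diff f) z +
    \sum_(i < n) iter i S (fun z => weight_osc z * iter (n - i) T f z.1) z.
Proof.
move=> f0; elim: n z => [|n IH] z Kz; first by rewrite big_ord0 addr0.
rewrite iterS; apply: le_trans (pos_diff_transfer _ Kz) _.
  exact: iter_transfer_ge0.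
rewrite big_ord_recl /= [X in _ <= _ + X]addrC addrA lerD2r.
pose F (i : 'I_n) (z : V * V) :=
  iter i S (fun z => weight_osc z * iter (n - i) T f z.1) z.
apply: le_trans (transfer_le K2_stable q_ge0 IH Kz) _.
have := iter_transfer_lin coupled_maps coupled_weights 1 1 1
  (iter n S (pos_diff f)) (fun z => \sum_(i < n) F i z).
rewrite /= => /(congr1 (@^~ z)); rewrite !mul1r transfer_sum.
under eq_fun do rewrite !mul1r.
by move=> ->.
Qed.

Hypothesis sigma_gt0 : 0 < sigma.
Hypothesis sigma_lt : sigma < r.
Hypothesis C_ge0 : 0 <= C.
Hypothesis coupled_contraction : forall n x y, K x -> K y ->
  iter n S (fun z => D z.1 z.2) (x, y) <= C * sigma ^+ n * D x y.
Hypothesis weights_dini : forall kappa : R, 0 < kappa -> kappa < 1 ->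
  exists2 e : nat -> R,
    (forall i, 0 <= e i) /\ (exists A : R, forall n, \sum_(i < n) e i <= A) &
    forall i j x y, K x -> K y -> D x y <= kappa ^+ i -> `|p j x - p j y| <= e i.

(* Where D is at most kappa^l the weights oscillate by at most e l; elsewhere
   the oscillation, which is at most 1, is dominated by D / kappa^l. Letting l
   grow with the number of steps makes both contributions summable. *)
Lemma equicontinuity (eps : R) : 0 < eps -> exists2 delta : R, 0 < delta &
  forall (f : V -> R) n B, (forall x, K x -> 0 <= f x) ->
    (forall j x, (j <= n)%N -> K x -> iter j T f x * r ^+ (n - j) <= B) ->
  forall x y, K x -> K y -> D x y <= delta ->
    iter n T f x - iter n T f y <= iter n S (pos_diff f) (x, y) + eps * B.
Proof.
move=> eps0; have r0 : 0 < r by exact: lt_trans sigma_lt.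
(* Relative to r^i the mean distance decays like [theta ^+ i]. Any [kappa] strictly between [theta]
   and 1 leaves a convergent series after division by [kappa ^+ i]; the midpoint is taken. *)
pose theta := sigma / r; pose kappa := (theta + 1) / 2.
have th0 : 0 < theta by rewrite divr_gt0.
have th1 : theta < 1 by rewrite ltr_pdivrMr// mul1r.
have [kap0 kap1 thk] : [/\ 0 < kappa, kappa < 1 & theta < kappa].
  by rewrite /kappa; split; lra.
have [e [e0 [A eA]] pe] := weights_dini kap0 kap1.
pose e' i := m%:R * e i / pmin.
have e'0 i : 0 <= e' i by rewrite divr_ge0 ?mulr_ge0 ?(ltW pmin_gt0).
have e'A n : \sum_(i < n) e' i <= m%:R * A / pmin.
  by rewrite -mulr_suml -mulr_sumr ler_pM2r ?invr_gt0// ler_wpM2l.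
have [delta [l [delta0 sumle]]] :=
  summable_split e'0 e'A C_ge0 (ltW th0) thk kap1 eps0.
have osc_le i z : K2 z -> weight_osc z <= e' i + kappa ^- i * D z.1 z.2.
  move=> [Kx Ky]; have [Dk|Dk] := leP (D z.1 z.2) (kappa ^+ i).
    apply: (@le_trans _ _ (e' i)); last first.
      by rewrite lerDl mulr_ge0 ?D_ge0// invr_ge0 exprn_ge0// ltW.
    rewrite /weight_osc ge_min; apply/orP; right.
    rewrite -mulr_suml ler_pM2r ?invr_gt0//.
    apply: (@le_trans _ _ (\sum_(j < m) e i)).
      by apply: ler_sum => j _; exact: pe.
    by rewrite sumr_const card_ord mulr_natl.
  apply: (@le_trans _ _ 1); first by rewrite /weight_osc ge_min lexx.
  rewrite -[1]add0r lerD// mulrC ler_pdivlMr ?exprn_gt0// mul1r; exact: ltW.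
exists delta => // f n B f0 fB x y Kx Ky Dd.
have Kz : K2 (x, y) by split.
have Tf0 k : forall x, K x -> 0 <= iter k T f x by exact: iter_transfer_ge0.
have B0 : 0 <= B.
  by apply: le_trans (Tf0 n x Kx) _; have := fB n x (leqnn n) Kx; rewrite subnn mulr1.
apply: (@le_trans _ _ (pos_diff (iter n T f) (x, y))).
  by rewrite /pos_diff le_max lexx orbT.
apply: le_trans (pos_diff_iter_transfer _ f0 Kz) _; rewrite lerD2l.
apply: (@le_trans _ _ (\sum_(i < n) (e' (l i) + C * kappa ^- l i * theta ^+ i * delta) * B)); last first.
  by rewrite -mulr_suml ler_wpM2r.
apply: ler_sum => i _; set L := l i.
have ilen : (i <= n)%N by rewrite ltnW.
pose b := B / r ^+ i.
have fb t : K t -> iter (n - i) T f t <= b.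
  move=> Kt; rewrite ler_pdivlMr ?exprn_gt0//.
  by have := fB (n - i)%N t (leq_subr _ _) Kt; rewrite subKn.
have b0 : 0 <= b by rewrite divr_ge0// exprn_ge0// ltW.
apply: (@le_trans _ _ (iter i S (fun z => e' L * iter (n - i) T f z.1 +
    (kappa ^- L * b) * D z.1 z.2) (x, y))).
  apply: (iter_transfer_le K2_stable q_ge0) => // z Kz'; have [K1 K2'] := Kz'.
  apply: (@le_trans _ _ ((e' L + kappa ^- L * D z.1 z.2) * iter (n - i) T f z.1)).
    by rewrite ler_wpM2r ?Tf0// osc_le.
  rewrite mulrDl lerD2l mulrAC -mulrA [leRHS](_ : _ = kappa ^- L * (b * D z.1 z.2)).
    by rewrite ler_wpM2l ?ler_wpM2r ?D_ge0 ?fb// invr_ge0 exprn_ge0// ltW.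
  by ring.
(* On functions of the first point the coupled steps are steps of [T], so they recombine with
   [iter (n - i) T f] into [iter n T f], which is at most [B]. *)
rewrite iter_transfer_lin iter_coupled_fst -iterD subnKC//=.
have h1 : e' L * iter n T f x <= e' L * B.
  by rewrite ler_wpM2l//; have := fB n x (leqnn n) Kx; rewrite subnn mulr1.
have h2 : kappa ^- L * b * iter i S (fun z => D z.1 z.2) (x, y) <=
    C * kappa ^- L * theta ^+ i * delta * B.
  apply: (@le_trans _ _ (kappa ^- L * b * (C * sigma ^+ i * delta))).
    rewrite ler_wpM2l//; first by rewrite mulr_ge0// invr_ge0 exprn_ge0// ltW.
    apply: le_trans (coupled_contraction i Kx Ky) _.
    by rewrite ler_wpM2l// mulr_ge0// exprn_ge0// ltW.
  have -> : theta ^+ i = sigma ^+ i / r ^+ i by rewrite expr_div_n.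
  rewrite /b; move: (kappa ^- L) (sigma ^+ i) (r ^- i) => a s t.
  by rewrite [leRHS](_ : _ = a * (B * t) * (C * s * delta)); last by ring.
by rewrite mulrDl lerD.
Qed.

End Equicontinuity.

(** The limit is taken as a lower limit: the supremum of the numbers lying below some tail of
    [L n x]. *)
Lemma uniform_cauchy_limit (R : realType) (V : Type) (K : set V) (L : nat -> V -> R) :
  (forall eps : R, 0 < eps -> exists n0, forall n k x, (n0 <= n)%N -> K x ->
    `|L (n + k)%N x - L n x| <= eps) ->
  exists h, forall eps : R, 0 < eps -> exists n0, forall n x, (n0 <= n)%N -> K x ->
    `|L n x - h x| <= eps.
Proof.
move=> cL; pose E x := [set b : R | exists n, forall k, b <= L (n + k)%N x].
exists (fun x => sup (E x)) => eps eps0; have [n0 n0P] := cL eps eps0.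
exists n0 => n x n0n Kx.
have lowerE : E x (L n x - eps).
  by exists n => k; have := n0P n k x n0n Kx; rewrite ler_norml => /andP[]; lra.
have upperE : ubound (E x) (L n x + eps).
  move=> b [n' /(_ n)]; rewrite addnC => /le_trans; apply.
  by have := n0P n n' x n0n Kx; rewrite ler_norml => /andP[]; lra.
have h1 : L n x - eps <= sup (E x) by apply: ub_le_sup => //; exists (L n x + eps).
have h2 : sup (E x) <= L n x + eps by apply: ge_sup => //; exists (L n x - eps).
by rewrite ler_norml; apply/andP; split; lra.
Qed.

(** For compact [K] and the Euclidean distance this is continuity on [K], see [bounded_uniformP]; in
    this form no topology on [V] is required. *)
Definition bounded_uniform (R : realType) (V : Type) (K : set V)
    (D : V -> V -> R) (f : V -> R) : Prop :=
  (exists A : R, forall x, K x -> `|f x| <= A) /\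
  forall eps : R, 0 < eps -> exists2 delta : R, 0 < delta &
    forall x y, K x -> K y -> D x y <= delta -> `|f x - f y| <= eps.

(** * Convergence of the normalised iterates *)

Section Convergence.
Context (R : realType) (V : Type) (m : nat) (K : set V).
Context (w : 'I_m -> V -> V) (p : 'I_m -> V -> R) (D : V -> V -> R).
Context (pmin pmax : R).
Hypothesis m_gt0 : (0 < m)%N.
Hypothesis K0 : K !=set0.
Hypothesis K_stable : forall j x, K x -> K (w j x).
Hypothesis pmin_gt0 : 0 < pmin.
Hypothesis p_ge : forall j x, K x -> pmin <= p j x.
Hypothesis p_le : forall j x, K x -> p j x <= pmax.
Hypothesis D_sym : forall x y, D x y = D y x.
Hypothesis D_w : forall j x y, K x -> K y -> D (w j x) (w j y) <= D x y.
Local Notation T := (transfer w p).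
Local Notation S := (transfer (coupled_maps w) (coupled_weights p)).
Local Notation u n := (iter n T (fun=> 1)).
Local Notation r := (growth_rate K w p).
Hypothesis equicont : forall eps : R, 0 < eps -> exists2 delta : R, 0 < delta &
  forall (f : V -> R) n B, (forall x, K x -> 0 <= f x) ->
    (forall j x, (j <= n)%N -> K x -> iter j T f x * r ^+ (n - j) <= B) ->
  forall x y, K x -> K y -> D x y <= delta ->
    iter n T f x - iter n T f y <= iter n S (pos_diff f) (x, y) + eps * B.
Hypothesis irreducible : forall delta : R, 0 < delta -> exists (N : nat) (c : R), 0 < c /\
  forall (f : V -> R) b z, (forall x, K x -> 0 <= f x) -> 0 <= b -> K z ->
    (forall x, K x -> D z x <= delta -> b <= f x) ->
  forall x, K x -> c * b <= iter N T f x.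

Let p_ge0 j x : K x -> 0 <= p j x.
Proof. by move=> /(p_ge j); apply: le_trans; rewrite ltW. Qed.

Let r_gt0 : 0 < r.
Proof. exact: (growth_rate_gt0 m_gt0 K0 K_stable pmin_gt0 p_ge p_le). Qed.

Let rn_gt0 n : 0 < r ^+ n. Proof. exact: exprn_gt0. Qed.

Let r_lower n b : (forall x, K x -> u n x <= b) -> r ^+ n <= b.
Proof. exact: (growth_rate_lower m_gt0 K0 K_stable pmin_gt0 p_ge p_le). Qed.

Let r_upper n b : (forall x, K x -> b <= u n x) -> b <= r ^+ n.
Proof. exact: (growth_rate_upper m_gt0 K0 K_stable pmin_gt0 p_ge p_le). Qed.

Let u_gt0 n x : K x -> 0 < u n x.
Proof. exact: (iter_transfer1_gt0 m_gt0 K_stable pmin_gt0 p_ge). Qed.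

Let iterD_Z n k a f : iter n T (fun x => a * iter k T f x) =
  fun x => a * iter (n + k) T f x.
Proof. by rewrite iter_transferZ; apply/funext => x; rewrite iterD. Qed.

(** By positivity of [T], bounds of the quotients [iter n T f / u n] persist, so their range over
    [K] shrinks as [n] grows. *)
Lemma ratio_lower a f n n' : (n <= n')%N ->
  (forall x, K x -> a * u n x <= iter n T f x) ->
  forall x, K x -> a * u n' x <= iter n' T f x.
Proof.
move=> /subnK <- af x Kx; have := iter_transfer_le K_stable p_ge0 (n' - n) af Kx.
by rewrite iterD_Z -iterD.
Qed.

Lemma ratio_upper a f n n' : (n <= n')%N ->
  (forall x, K x -> iter n T f x <= a * u n x) ->
  forall x, K x -> iter n' T f x <= a * u n' x.
Proof.
move=> /subnK <- af x Kx; have := iter_transfer_le K_stable p_ge0 (n' - n) af Kx.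
by rewrite iterD_Z -iterD.
Qed.

(** Strong induction on the supremum [B n] of [u n]. If some earlier [j] has
    [B j * r ^+ (n - j) > B n], the bound at [j] suffices. Otherwise equicontinuity applies with
    [B n] itself as bound: a value above [B n / 2] at [z] stays above [B n / 4] on a ball,
    irreducibility spreads it over [K] in [N] steps, and a lower bound of [u (N + n)] on all of [K]
    cannot exceed [r ^+ (N + n)]. *)
Lemma iter_transfer1_upper :
  exists2 C : R, 0 < C & forall n x, K x -> u n x <= C * r ^+ n.
Proof.
have [|delta delta0 ec] := equicont (eps := 1 / 4); first by lra.
have [N [c [c0 irr]]] := irreducible delta0.
pose B n := sup [set u n x | x in K].
have hasB n : has_sup [set u n x | x in K].
  have [x0 Kx0] := K0; split; first by exists (u n x0), x0.
  exists ((m%:R * pmax) ^+ n) => _ [x Kx <-].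
  elim: n x Kx => [|n IH] x Kx; first by rewrite expr0.
  rewrite iterSr exprSr; apply: (@le_trans _ _ (m%:R * pmax * u n x)).
    have /(congr1 (@^~ x)) /= <- := iter_transferZ w p n (m%:R * pmax) (fun=> 1).
    apply: (iter_transfer_le K_stable p_ge0) => // y Ky.
    rewrite [leRHS]mulr1; apply: transfer1_le Ky => //.
  rewrite mulrC ler_wpM2r ?IH//.
  by apply: le_trans (transfer1_le w p_le Kx); rewrite ltW//; exact: (u_gt0 1).
have uB n x : K x -> u n x <= B n.
  by move=> Kx; apply: ub_le_sup; [case: (hasB n)|exists x].
have B0 n : 0 < B n by have [x Kx] := K0; exact: lt_le_trans (u_gt0 n Kx) (uB n x Kx).
exists (4 * r ^+ N / c); first by rewrite divr_gt0// mulr_gt0.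
suff Br n : B n <= 4 * r ^+ N / c * r ^+ n by move=> n x Kx; exact: le_trans (uB n x Kx) _.
elim/ltn_ind: n => n IH.
have [rec|] := pselect (forall j, (j <= n)%N -> B j * r ^+ (n - j) <= B n); last first.
  move=> /existsNP[j /not_implyP[jn /negP]]; rewrite -ltNge => jB.
  have {}jn : (j < n)%N.
    by rewrite ltn_neqAle jn andbT; apply: contraTneq jB => ->; rewrite subnn mulr1 ltxx.
  apply/ltW/(lt_le_trans jB); rewrite -(subnK (ltnW jn)) [in leRHS]addnC exprD mulrA.
  by rewrite addnK ler_pM2r// IH.
have [_ [z Kz <-] zB] := sup_adherent (divr2_gt0 (B0 n)) (hasB n).
rewrite -/(B n) in zB.
have low x : K x -> D z x <= delta -> B n / 4 <= u n x.
  move=> Kx Dzx; have := ec (fun=> 1) n (B n) _ _ z x Kz Kx Dzx.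
  (* A constant has no initial oscillation; writing it as [0 * 1] lets [iter_transferZ] compute the
     iterates. *)
  have -> : pos_diff (fun _ : V => 1 : R) = fun=> 0 * 1.
    by apply/funext => t; rewrite /pos_diff subrr mul0r maxxx.
  rewrite iter_transferZ mul0r => h.
  suff : u n z - u n x <= 0 + 1 / 4 * B n by lra.
  apply: h => // j y jn Ky; apply: le_trans (rec j jn).
  by rewrite ler_wpM2r ?uB// ltW.
have := irr _ _ z _ _ Kz low.
rewrite -iterD => /(_ _ _)/r_upper h.
have {}h : c * (B n / 4) <= r ^+ (N + n).
  by apply: h => [x Kx|]; [exact/ltW/u_gt0|rewrite divr_ge0// ltW].
rewrite mulrAC ler_pdivlMr// -mulrA -exprD; lra.
Qed.

(** With the upper bound on [u n] at hand, [B] can be [A * C * r ^+ n] for every [n]. The coupled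
    term is small because coupled orbits never move apart and [f] is uniformly continuous. *)
Lemma uniform_equicontinuous (f : V -> R) : (forall x, K x -> 0 <= f x) ->
  bounded_uniform K D f -> forall eps : R, 0 < eps -> exists2 delta : R, 0 < delta &
  forall n x y, K x -> K y -> D x y <= delta ->
    `|iter n T f x - iter n T f y| <= eps * r ^+ n.
Proof.
move=> f0 [[A fA] fuc] eps eps0; have [C C0 uC] := iter_transfer1_upper.
have A0 : 0 <= A by have [x Kx] := K0; exact: le_trans (normr_ge0 _) (fA x Kx).
have [|d1 d10 ec] := equicont (eps := eps / 2 / (A * C + 1)).
  by rewrite !divr_gt0// ltr_wpDl// mulr_ge0// ltW.
have [|d2 d20 uc] := fuc (eps / 2 / C); first by rewrite !divr_gt0.
exists (Num.min d1 d2); first by rewrite lt_min d10.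
suff one n x y : K x -> K y -> D x y <= Num.min d1 d2 ->
    iter n T f x - iter n T f y <= eps * r ^+ n.
  move=> n x y Kx Ky Dxy; rewrite ler_norml one// andbT.
  by rewrite lerNl opprB one// D_sym.
move=> Kx Ky; rewrite le_min => /andP[Dd1 Dd2].
have ufA j t : K t -> iter j T f t <= A * u j t.
  move=> Kt; have /(congr1 (@^~ t)) /= <- := iter_transferZ w p j A (fun=> 1).
  apply: (iter_transfer_le K_stable p_ge0) => // s Ks.
  by rewrite mulr1; exact: le_trans (ler_norm _) (fA s Ks).
apply: le_trans (ec f n (A * C * r ^+ n) f0 _ x y Kx Ky Dd1) _.
  move=> j t jn Kt; rewrite -(subnKC jn) exprD mulrA addKn ler_pM2r// -mulrA.
  by apply: le_trans (ufA j t Kt) _; rewrite ler_wpM2l// uC.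
have h1 : eps / 2 / (A * C + 1) * (A * C * r ^+ n) <= eps / 2 * r ^+ n.
  rewrite mulrA ler_pM2r// -mulrA ler_piMr//; first by lra.
  by rewrite mulrC ler_pdivrMr ?mul1r ?lerDl// ltr_wpDl// mulr_ge0// ltW.
suff h2 : iter n S (pos_diff f) (x, y) <= eps / 2 * r ^+ n by lra.
(* The coupled operator is compared on close pairs only: they form a set stable under the coupled
   maps, on which [pos_diff f] is small. *)
pose K2 := [set z : V * V | [/\ K z.1, K z.2 & D z.1 z.2 <= d2]].
have K2w j z : K2 z -> K2 (coupled_maps w j z).
  case=> K1 K2' D12; split; [exact: K_stable|exact: K_stable|].
  by apply: le_trans D12; exact: D_w.
have K2p j z : K2 z -> 0 <= coupled_weights p j z by case=> K1 _ _; exact: p_ge0.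
apply: (@le_trans _ _ (iter n S (fun z => eps / 2 / C * 1) (x, y))).
  apply: (iter_transfer_le K2w K2p) => // z [K1 K2' D12].
  rewrite mulr1 /pos_diff ge_max !divr_ge0 ?(ltW C0) ?(ltW eps0)//=.
  by apply: le_trans (uc _ _ K1 K2' D12); exact: ler_norm.
rewrite iter_transferZ (iter_coupled_fst w p n (fun=> 1)) /=.
by rewrite -mulrA ler_pM2l ?divr_gt0// ler_pdivrMl// uC.
Qed.

Let one_bounded_uniform : bounded_uniform K D (fun=> 1).
Proof.
split; first by exists 1 => x _; rewrite normr1.
by move=> eps eps0; exists 1 => // x y _ _ _; rewrite subrr normr0 ltW.
Qed.

(** Some point has [u n] above [r ^+ n / 2], by [r_lower]. Equicontinuity keeps a quarter of
    [r ^+ n] on a ball and irreducibility spreads it over [K] in [N] steps; these steps are paid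
    back through [u N <= C * r ^+ N]. *)
Lemma iter_transfer1_lower :
  exists2 c : R, 0 < c & forall n x, K x -> c * r ^+ n <= u n x.
Proof.
have [C C0 uC] := iter_transfer1_upper.
have [||delta delta0 ue] :=
  @uniform_equicontinuous (fun=> 1) _ one_bounded_uniform (1 / 4); [by []|lra|].
have [N [c [c0 irr]]] := irreducible delta0.
exists (c / 4 / (C * r ^+ N)); first by rewrite !divr_gt0// mulr_gt0.
move=> n x Kx.
have [z [Kz zr]] : exists z, K z /\ r ^+ n / 2 < u n z.
  apply: contrapT => /forallNP h; have : r ^+ n <= r ^+ n / 2.
    apply: r_lower => z Kz; rewrite leNgt; apply/negP => zr.
    by apply: (h z).
  by have := rn_gt0 n; lra.
have low y : K y -> D z y <= delta -> r ^+ n / 4 <= u n y.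
  move=> Ky Dzy; have := ue n z y Kz Ky Dzy; rewrite ler_norml => /andP[_]; lra.
have {}irr : c * (r ^+ n / 4) <= iter N T (u n) x.
  apply: irr Kz low _ Kx => [y Ky|]; first exact/ltW/u_gt0.
  by rewrite divr_ge0// ltW.
rewrite mulrAC ler_pdivrMr ?mulr_gt0//.
rewrite [leLHS](_ : _ = c * (r ^+ n / 4)); last by ring.
apply: le_trans irr _; rewrite -iterD addnC iterD.
rewrite mulrC; have /(congr1 (@^~ x)) /= <- := iter_transferZ w p n (C * r ^+ N) (fun=> 1).
by apply: (iter_transfer_le K_stable p_ge0) => // y Ky; rewrite mulr1 uC.
Qed.

(** After each block of [N] steps, either the quotients already lie in an interval of length [eta],
    or their lower bound rises by a fixed [s]; as it never exceeds [A], the second case stops. The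
    index [n0] is uniform over the family [F], which the Cauchy estimate of [ex_eigenfunction]
    exploits. *)
Lemma ratio_contraction (F : set (V -> R)) A :
  (forall f x, F f -> K x -> 0 <= f x <= A) ->
  (forall eps : R, 0 < eps -> exists2 delta : R, 0 < delta &
    forall f n x y, F f -> K x -> K y -> D x y <= delta ->
      `|iter n T f x - iter n T f y| <= eps * r ^+ n) ->
  forall eta : R, 0 < eta -> exists n0, forall f, F f -> exists a, forall n x,
    (n0 <= n)%N -> K x -> a * u n x <= iter n T f x <= (a + eta) * u n x.
Proof.
move=> F0 Fe eta eta0.
have [C C0 uC] := iter_transfer1_upper; have [c c0 uc] := iter_transfer1_lower.
have [x0 Kx0] := K0.
have [[f0 Ff0]|noF] := pselect (exists f, F f); last first.
  by exists 0%N => f Ff; case: noF; exists f.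
have A0 : 0 <= A by have /andP[] := F0 f0 x0 Ff0 Kx0; exact: le_trans.
have [||d1 d10 ue] := @uniform_equicontinuous (fun=> 1) _ one_bounded_uniform
  (eta * c / 4 / (A + 1)); [by []|by rewrite !divr_gt0 ?mulr_gt0// ltr_wpDl|].
have [|d2 d20 fe] := Fe (eta * c / 4); first by rewrite divr_gt0// mulr_gt0.
have [|N [c' [c'0 irr]]] := @irreducible (Num.min d1 d2); first by rewrite lt_min d10.
(* A surplus [eta * c / 2 * r ^+ n] on a ball becomes [c'] times as much everywhere after [N] steps;
   division by the bound [C * r ^+ (N + n)] of [u (N + n)] gives the gain in the quotient. *)
pose s := c' * (eta * c / 2) / (C * r ^+ N).
have s0 : 0 < s by rewrite divr_gt0 ?mulr_gt0// divr_gt0// mulr_gt0.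
have aA f a n : F f -> (forall x, K x -> a * u n x <= iter n T f x) -> a <= A.
  move=> Ff au; rewrite -(ler_pM2r (u_gt0 n Kx0)); apply: le_trans (au _ Kx0) _.
  apply: (@ratio_upper A f 0 n) => // x Kx.
  by rewrite mulr1; have /andP[] := F0 f x Ff Kx.
have key l f : F f -> exists a, (forall x, K x -> a * u (l * N)%N x <= iter (l * N)%N T f x) /\
    ((forall x, K x -> iter (l * N)%N T f x <= (a + eta) * u (l * N)%N x) \/ l%:R * s <= a).
  move=> Ff; elim: l => [|l [a [au alt]]].
    exists 0; split; last by right; rewrite mul0r.
    by move=> x Kx; rewrite mul0r; have /andP[] := F0 f x Ff Kx.
  have lN : (l * N <= l.+1 * N)%N by rewrite leq_mul2r leqnSn orbT.
  case: alt => [au'|las].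
    by exists a; split; [exact: ratio_lower lN au|left; exact: ratio_upper lN au'].
  set n := (l * N)%N in au lN *.
  have [au'|/existsNP[z /not_implyP[Kz /negP]]] :=
    pselect (forall x, K x -> iter n T f x <= (a + eta) * u n x).
    by exists a; split; [exact: ratio_lower lN au|left; exact: ratio_upper lN au'].
  rewrite -ltNge => zu.
  have a0 : 0 <= a by apply: le_trans las; rewrite mulr_ge0// ltW.
  have aleA := aA f a n Ff au.
  exists (a + s); split; last by right; rewrite -natr1 mulrDl mul1r lerD2r.
  (* The excess over the current lower bound. At [z] it exceeds [eta * u n z >= eta * c * r ^+ n];
     on the ball, the oscillations of [iter n T f] and of [a * u n] each remove at most a quarter of
     this. *)
  pose g x := 1 * iter n T f x + (- a) * u n x.
  have g0 x : K x -> 0 <= g x.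
    by move=> /au; rewrite /g mul1r mulNr subr_ge0.
  have low y : K y -> D z y <= Num.min d1 d2 -> eta * c / 2 * r ^+ n <= g y.
    move=> Ky; rewrite le_min => /andP[Dd1 Dd2].
    have := fe f n z y Ff Kz Ky Dd2; rewrite ler_norml => /andP[_ h2].
    have := ue n z y Kz Ky Dd1; rewrite ler_norml => /andP[h1 _].
    have h3 : a * (u n y - u n z) <= eta * c / 4 * r ^+ n.
      apply: (@le_trans _ _ ((A + 1) * (eta * c / 4 / (A + 1) * r ^+ n))).
        apply: (@le_trans _ _ (a * (eta * c / 4 / (A + 1) * r ^+ n))).
          by rewrite ler_wpM2l//; lra.
        rewrite ler_wpM2r; [by []| |by lra].
        by rewrite mulr_ge0 ?divr_ge0 ?mulr_ge0// ?addr_ge0// ltW.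
      by rewrite mulrA mulrC [(A + 1) * _]mulrC divfK ?gt_eqF ?ltr_wpDl// mulrC.
    have h4 : eta * (c * r ^+ n) <= eta * u n z by rewrite ler_pM2l// uc.
    by rewrite /g; lra.
  have := irr g _ z g0 _ Kz low.
  move=> h x Kx; have {}h : c' * (eta * c / 2 * r ^+ n) <= iter N T g x.
    by apply: h Kx; rewrite mulr_ge0 ?divr_ge0 ?mulr_ge0// ltW.
  rewrite /g iter_transfer_lin -!iterD mul1r mulNr in h.
  rewrite mulSn mulrDl.
  suff : s * u (N + n)%N x <= c' * (eta * c / 2 * r ^+ n) by lra.
  apply: (@le_trans _ _ (s * (C * r ^+ (N + n)))).
    by rewrite ler_wpM2l ?uC// ltW.
  rewrite /s exprD (mulrA C) (mulrA _ (C * _)) divfK ?mulrA//.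
  by rewrite gt_eqF// mulr_gt0.
pose L := (Num.truncn (A / s)).+1.
exists (L * N)%N => f Ff; have [a [au [au'|las]]] := key L f Ff.
  by exists a => n x Ln Kx; rewrite (ratio_lower Ln au)// (ratio_upper Ln au').
have := aA f a _ Ff au; rewrite leNgt => /negP[]; apply: lt_le_trans las.
by rewrite -ltr_pdivrMr// truncnS_gt.
Qed.

(** The uniform limit on [K] of the quotients [iter n T f / u n], with the denominators cleared. *)
Definition asymptotic_ratio (f : V -> R) (b : R) : Prop :=
  forall eta : R, 0 < eta -> exists n0, forall n x, (n0 <= n)%N -> K x ->
    `|iter n T f x - b * u n x| <= eta * u n x.

Lemma asymptotic_ratio_le f g a b : (forall x, K x -> f x <= g x) ->
  asymptotic_ratio f a -> asymptotic_ratio g b -> a <= b.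
Proof.
move=> fg fa gb; apply/ler_addgt0Pl => e e0; have [x Kx] := K0.
have [n1 h1] := fa _ (divr2_gt0 e0); have [n2 h2] := gb _ (divr2_gt0 e0).
have := h1 _ x (leq_maxl n1 n2) Kx; have := h2 _ x (leq_maxr n1 n2) Kx.
set n := maxn n1 n2; rewrite !ler_norml => /andP[_ h3] /andP[h4 _].
have h5 := iter_transfer_le K_stable p_ge0 n fg Kx.
by rewrite -(ler_pM2r (u_gt0 n Kx)); lra.
Qed.

Lemma asymptotic_ratio_unique f a b :
  asymptotic_ratio f a -> asymptotic_ratio f b -> a = b.
Proof.
by move=> fa fb; apply/eqP; rewrite eq_le !(@asymptotic_ratio_le f f).
Qed.

Lemma asymptotic_ratio_lin f g a b s t :
  asymptotic_ratio f a -> asymptotic_ratio g b ->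
  asymptotic_ratio (fun x => s * f x + t * g x) (s * a + t * b).
Proof.
move=> fa gb eta eta0.
have [|n1 h1] := fa (eta / (2 * (`|s| + 1))); first by rewrite divr_gt0// mulr_gt0// ltr_wpDl.
have [|n2 h2] := gb (eta / (2 * (`|t| + 1))); first by rewrite divr_gt0// mulr_gt0// ltr_wpDl.
exists (maxn n1 n2) => n x; rewrite geq_max => /andP[nn1 nn2] Kx.
rewrite iter_transfer_lin.
have un0 := u_gt0 n Kx.
rewrite [X in `|X|](_ : _ = s * (iter n T f x - a * u n x) + t * (iter n T g x - b * u n x)); last by ring.
apply: le_trans (ler_normD _ _) _; rewrite !normrM.
have part (v k z : R) : `|z| <= eta / (2 * (`|v| + 1)) * k -> 0 <= k ->
    `|v| * `|z| <= eta / 2 * k.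
  move=> zk k0; apply: (@le_trans _ _ ((`|v| + 1) * (eta / (2 * (`|v| + 1)) * k))).
    by apply: ler_pM => //; rewrite lerDl.
  rewrite le_eqVlt; apply/orP; left; apply/eqP; field.
  by rewrite gt_eqF// ltr_wpDl.
have := part s _ _ (h1 n x nn1 Kx) (ltW un0).
have := part t _ _ (h2 n x nn2 Kx) (ltW un0).
lra.
Qed.

Lemma asymptotic_ratio1 : asymptotic_ratio (fun=> 1) 1.
Proof.
by move=> eta eta0; exists 0%N => n x _ Kx; rewrite mul1r subrr normr0 mulr_ge0// ltW// u_gt0.
Qed.

(** The limit is the supremum of all lower bounds of the quotients at all times; [ratio_contraction]
    encloses it in intervals of arbitrary length [eta]. *)
Lemma ex_asymptotic_ratio_ge0 f : (forall x, K x -> 0 <= f x) ->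
  bounded_uniform K D f -> exists b, asymptotic_ratio f b.
Proof.
move=> f0 fbu; have [[A fA] _] := fbu.
have contr := @ratio_contraction [set f] A _ _.
have {contr} contr : forall eta : R, 0 < eta -> exists n0 a, forall n x,
    (n0 <= n)%N -> K x -> a * u n x <= iter n T f x <= (a + eta) * u n x.
  move=> eta eta0; have [||n0 h] := contr _ _ eta eta0.
  - by move=> _ x -> Kx; rewrite f0//= (le_trans (ler_norm _) (fA x Kx)).
  - move=> e e0; have [d d0 fd] := uniform_equicontinuous f0 fbu e0.
    by exists d => // _ n x y -> Kx Ky Dd; exact: fd.
  - by have [a ha] := h f erefl; exists n0, a.
pose E := [set a | exists n, forall x, K x -> a * u n x <= iter n T f x].
have [x0 Kx0] := K0.
have Eub a n0 eta : (forall n x, (n0 <= n)%N -> K x ->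
    a * u n x <= iter n T f x <= (a + eta) * u n x) -> ubound E (a + eta).
  move=> ha b [n hb]; rewrite -(ler_pM2r (u_gt0 (maxn n n0) Kx0)).
  apply: le_trans (ratio_lower (leq_maxl n n0) hb Kx0) _.
  by have /andP[] := ha _ x0 (leq_maxr n n0) Kx0.
exists (sup E) => eta eta0; have [n0 [a ha]] := contr eta eta0.
have Ea : E a by exists n0 => x Kx; have /andP[] := ha n0 x (leqnn _) Kx.
have aE : a <= sup E by apply: ub_le_sup => //; exists (a + eta); exact: Eub ha.
have Ea' : sup E <= a + eta by apply: ge_sup; [exists a|exact: Eub ha].
exists n0 => n x nn Kx; have /andP[h1 h2] := ha n x nn Kx.
have un0 := u_gt0 n Kx.
have h3 : a * u n x <= sup E * u n x by rewrite ler_wpM2r// ltW.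
have h4 : sup E * u n x <= (a + eta) * u n x by rewrite ler_wpM2r// ltW.
by rewrite ler_norml; apply/andP; split; lra.
Qed.

Lemma bounded_uniform_lin f g s t : bounded_uniform K D f -> bounded_uniform K D g ->
  bounded_uniform K D (fun x => s * f x + t * g x).
Proof.
move=> [[A fA] fu] [[B gB] gu]; split.
  exists (`|s| * A + `|t| * B) => x Kx; apply: le_trans (ler_normD _ _) _.
  by rewrite !normrM lerD// ler_wpM2l// ?fA ?gB.
move=> e e0.
have [|d1 d10 h1] := fu (e / (2 * (`|s| + 1))); first by rewrite divr_gt0// mulr_gt0// ltr_wpDl.
have [|d2 d20 h2] := gu (e / (2 * (`|t| + 1))); first by rewrite divr_gt0// mulr_gt0// ltr_wpDl.
exists (Num.min d1 d2) => [|x y Kx Ky]; first by rewrite lt_min d10.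
rewrite le_min => /andP[Dd1 Dd2].
rewrite [X in `|X|](_ : _ = s * (f x - f y) + t * (g x - g y)); last by ring.
apply: le_trans (ler_normD _ _) _; rewrite !normrM.
have part (v z : R) : `|z| <= e / (2 * (`|v| + 1)) -> `|v| * `|z| <= e / 2.
  move=> ze; apply: (@le_trans _ _ ((`|v| + 1) * (e / (2 * (`|v| + 1))))).
    by apply: ler_pM => //; rewrite lerDl.
  rewrite le_eqVlt; apply/orP; left; apply/eqP; field.
  by rewrite gt_eqF// ltr_wpDl.
have := part s _ (h1 x y Kx Ky Dd1); have := part t _ (h2 x y Kx Ky Dd2); lra.
Qed.

Lemma ex_asymptotic_ratio f : bounded_uniform K D f -> exists b, asymptotic_ratio f b.
Proof.
move=> fbu; have [[A fA] _] := fbu.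
have [||b hb] := @ex_asymptotic_ratio_ge0 (fun x => 1 * f x + A * 1).
- by move=> x Kx; have := fA x Kx; rewrite ler_norml => /andP[]; lra.
- exact: bounded_uniform_lin.
exists (1 * b + (- A) * 1).
have := asymptotic_ratio_lin 1 (- A) hb asymptotic_ratio1.
by under eq_fun do rewrite mul1r mul1r mulr1 mulr1 addrK.
Qed.

Lemma iter_transfer1_bounded_uniform n : bounded_uniform K D (u n).
Proof.
have [C C0 uC] := iter_transfer1_upper; split.
  by exists (C * r ^+ n) => x Kx; rewrite gtr0_norm ?u_gt0// uC.
move=> e e0; have [||d d0 ud] := @uniform_equicontinuous (fun=> 1) _
  one_bounded_uniform (e / r ^+ n); [by []|by rewrite divr_gt0|].
by exists d => // x y Kx Ky Dd; have := ud n x y Kx Ky Dd; rewrite divfK ?gt_eqF.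
Qed.

(** Let [lam] be the ratio of [u 1]. One more step of [T] multiplies ratios by [lam], since [u n.+1]
    is close to [lam * u n]. Hence [u k] has ratio [lam ^+ k], and the bounds of [u k] by multiples
    of [r ^+ k] on both sides force [lam = r]. *)
Lemma asymptotic_ratio_transfer f b : asymptotic_ratio f b -> asymptotic_ratio (T f) (r * b).
Proof.
have [lam hlam] := ex_asymptotic_ratio (iter_transfer1_bounded_uniform 1).
have step g a : asymptotic_ratio g a -> asymptotic_ratio (T g) (lam * a).
  (* [M] collects the two errors: [|lam| + 1] bounds [u n.+1 / u n] in the first, and [|a|] is the
     factor of the second. *)
  move=> ga eta eta0; pose M := `|lam| + 1 + `|a|.
  have M0 : 0 < M by rewrite /M ltr_wpDr// ltr_wpDl.
  have e0 : 0 < Num.min 1 (eta / M) by rewrite lt_min ltr01 divr_gt0.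
  have [n1 h1] := ga _ e0; have [n2 h2] := hlam _ e0.
  exists (maxn n1 n2) => n x; rewrite geq_max => /andP[nn1 nn2] Kx.
  have := h1 n.+1 x (leqW nn1) Kx; have := h2 n x nn2 Kx.
  rewrite -iterSr -iterD addn1 => k2 k1; have un0 := u_gt0 n Kx.
  set e := Num.min _ _ in e0 k1 k2.
  have e1 : e <= 1 by rewrite /e ge_min lexx.
  have eM : e * M <= eta by rewrite -ler_pdivlMr// /e ge_min lexx orbT.
  have k3 : u n.+1 x <= (`|lam| + 1) * u n x.
    have : lam * u n x <= `|lam| * u n x by rewrite ler_wpM2r ?ler_norm// ltW.
    have : e * u n x <= 1 * u n x by rewrite ler_wpM2r// ltW.
    by move: k2; rewrite ler_norml => /andP[_]; lra.
  rewrite [X in `|X|](_ : _ = (iter n.+1 T g x - a * u n.+1 x) +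
    a * (u n.+1 x - lam * u n x)); last by ring.
  apply: le_trans (ler_normD _ _) _; rewrite normrM.
  have k4 : `|a| * `|u n.+1 x - lam * u n x| <= `|a| * (e * u n x) by exact: ler_wpM2l.
  have k5 : e * u n.+1 x <= e * ((`|lam| + 1) * u n x) by rewrite ler_pM2l.
  have k6 : e * M * u n x <= eta * u n x by rewrite ler_pM2r.
  by rewrite /M in k6; lra.
suff -> : r = lam by exact: step.
have lamk k : asymptotic_ratio (u k) (lam ^+ k).
  elim: k => [|k IH]; first exact: asymptotic_ratio1.
  by rewrite exprS; exact: step.
have [C C0 uC] := iter_transfer1_upper; have [c c0 uc] := iter_transfer1_lower.
have const s : asymptotic_ratio (fun=> s) s.
  have := asymptotic_ratio_lin s 0 asymptotic_ratio1 asymptotic_ratio1.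
  by under eq_fun do rewrite mulr1 mul0r addr0; rewrite mulr1 mul0r addr0.
have lam_le k : lam ^+ k <= C * r ^+ k by exact: asymptotic_ratio_le (uC k) (lamk k) (const _).
have lam_ge k : c * r ^+ k <= lam ^+ k by exact: asymptotic_ratio_le (uc k) (const _) (lamk k).
have lam0 : 0 < lam by apply: lt_le_trans (lam_ge 1%N); rewrite mulr_gt0.
apply/eqP; case: ltgtP => // lamr.
- have [|k] := @geometric_unbounded R (lam / r) C; first by rewrite ltr_pdivlMr ?mul1r.
  by rewrite expr_div_n ltr_pdivlMr// ltNge lam_le.
- have [|k] := @geometric_unbounded R (r / lam) c^-1; first by rewrite ltr_pdivlMr ?mul1r.
  rewrite expr_div_n ltr_pdivlMr ?exprn_gt0// ltr_pdivrMl// => h.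
  by have := lam_ge k; rewrite leNgt h.
Qed.

(** All [L k] have ratio 1, and [ratio_contraction] treats them with one common index. So
    [r ^- k * u (n + k)] is within a small multiple of [u n] for every [k] at once, and division by
    [r ^+ n] makes [L n] a uniform Cauchy sequence. *)
Lemma ex_eigenfunction : exists2 h : V -> R,
  [/\ bounded_uniform K D h, exists2 c : R, 0 < c & forall x, K x -> c <= h x,
      forall x, K x -> T h x = r * h x & asymptotic_ratio h 1] &
  forall eps : R, 0 < eps -> exists n0, forall n x, (n0 <= n)%N -> K x ->
    `|r ^- n * u n x - h x| <= eps.
Proof.
have [C C0 uC] := iter_transfer1_upper; have [c c0 uc] := iter_transfer1_lower.
have [x0 Kx0] := K0.
pose L k x := r ^- k * u k x.
have iterL n k x : iter n T (L k) x = r ^- k * u (n + k)%N x by rewrite iterD_Z.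
have LC k x : K x -> L k x <= C.
  by move=> Kx; rewrite /L mulrC ler_pdivrMr// uC.
have Lc k x : K x -> c <= L k x.
  by move=> Kx; rewrite /L mulrC ler_pdivlMr// uc.
have L1 k : asymptotic_ratio (L k) 1.
  have : asymptotic_ratio (u k) (r ^+ k).
    elim: k => [|k IH]; first exact: asymptotic_ratio1.
    by rewrite exprS; exact: asymptotic_ratio_transfer.
  move=> /(asymptotic_ratio_lin (r ^- k) 0)/(_ asymptotic_ratio1).
  rewrite mul0r addr0 mulVf ?gt_eqF//.
  by under eq_fun do rewrite addr0.
have cauchyL eps : 0 < eps -> exists n0, forall n k x, (n0 <= n)%N -> K x ->
    `|L (n + k)%N x - L n x| <= eps.
  move=> eps0; have [|||n0 h] := @ratio_contraction (range L) C _ _ (eps / C).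
  - by move=> _ x [k _ <-] Kx; rewrite LC// (le_trans (ltW c0)) ?Lc.
  - move=> e e0; have [||d d0 ud] := @uniform_equicontinuous (fun=> 1) _
      one_bounded_uniform e; [by []|by []|].
    exists d => // _ n x y [k _ <-] Kx Ky Dd; rewrite !iterL -mulrBr normrM.
    rewrite ger0_norm ?invr_ge0 ?(ltW (rn_gt0 _))// mulrC ler_pdivrMr// -mulrA -exprD.
    exact: ud.
  - by rewrite divr_gt0.
  exists n0 => n k x nn Kx; have [|a ha] := h (L k); first by exists k.
  have a1 : a <= 1.
    apply/ler_addgt0Pl => e e0; have [n1 h1] := L1 k _ e0.
    have := h1 _ x0 (leq_maxl n1 n0) Kx0; have /andP[+ _] := ha _ x0 (leq_maxr n1 n0) Kx0.
    rewrite ler_norml => h2 /andP[_ h3].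
    by rewrite -(ler_pM2r (u_gt0 (maxn n1 n0) Kx0)); lra.
  have a2 : 1 <= a + eps / C.
    apply/ler_addgt0Pl => e e0; have [n1 h1] := L1 k _ e0.
    have := h1 _ x0 (leq_maxl n1 n0) Kx0; have /andP[_ +] := ha _ x0 (leq_maxr n1 n0) Kx0.
    rewrite ler_norml => h2 /andP[h3 _].
    by rewrite -(ler_pM2r (u_gt0 (maxn n1 n0) Kx0)); lra.
  have /andP[] := ha n x nn Kx; rewrite iterL => h2 h3.
  have un0 := u_gt0 n Kx.
  have h4 : `|r ^- k * u (n + k)%N x - u n x| <= eps / C * u n x.
    have : a * u n x <= 1 * u n x by rewrite ler_pM2r.
    have : 1 * u n x <= (a + eps / C) * u n x by rewrite ler_pM2r.
    by rewrite ler_norml; move=> *; apply/andP; split; lra.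
  rewrite /L exprD invfM -mulrA -mulrBr normrM ger0_norm ?invr_ge0 ?(ltW (rn_gt0 _))//.
  rewrite mulrC ler_pdivrMr//; apply: le_trans h4 _.
  by rewrite -mulrA ler_pM2l// ler_pdivrMl// uC.
have [h hL] := uniform_cauchy_limit cauchyL.
exists h; last exact: hL.
have hC x : K x -> h x <= C.
  move=> Kx; apply/ler_addgt0Pl => e e0; have [n0 hn] := hL _ e0.
  have := hn n0 x (leqnn _) Kx; have := LC n0 x Kx; rewrite ler_norml => ? /andP[]; lra.
have hc x : K x -> c <= h x.
  move=> Kx; apply/ler_addgt0Pl => e e0; have [n0 hn] := hL _ e0.
  have := hn n0 x (leqnn _) Kx; have := Lc n0 x Kx; rewrite ler_norml => ? /andP[]; lra.
split.
- split.
    exists C => x Kx; rewrite ger0_norm ?hC// (le_trans (ltW c0))// hc//.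
  move=> e e0; have [|n0 hn] := hL (e / 3); first by rewrite divr_gt0.
  have [||d d0 ud] := @uniform_equicontinuous (fun=> 1) _
      one_bounded_uniform (e / 3); [by []|by rewrite divr_gt0|].
  exists d => // x y Kx Ky Dd; have := ud n0 x y Kx Ky Dd.
  have -> : iter n0 T (fun=> 1) x - iter n0 T (fun=> 1) y = (L n0 x - L n0 y) * r ^+ n0.
    by rewrite /L -mulrBr mulrAC mulVf ?mul1r// gt_eqF.
  rewrite normrM (gtr0_norm (rn_gt0 _)) ler_pM2r//.
  have := hn n0 x (leqnn _) Kx; have := hn n0 y (leqnn _) Ky.
  rewrite !ler_norml => /andP[? ?] /andP[? ?] /andP[? ?].
  by apply/andP; split; lra.
- by exists c.
- move=> x Kx; apply/eqP; rewrite -subr_eq0 -normr_le0; apply/ler_addgt0Pl => e e0.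
  have M0 : 0 < u 1 x + r by rewrite addr_gt0// (u_gt0 1 Kx).
  have [|n0 hn] := hL (e / (u 1 x + r)); first by rewrite divr_gt0.
  have TL : T (L n0) x = r * L n0.+1 x.
    rewrite -[LHS]/(iter 1 T (L n0) x) iterL /L exprS invfM !mulrA divff ?mul1r//.
    by rewrite gt_eqF.
  have h1 : `|T h x - T (L n0) x| <= e / (u 1 x + r) * u 1 x.
    have /(congr1 (@^~ x)) /= := iter_transfer_lin w p 1 1 (-1) h (L n0).
    rewrite !mul1r mulN1r => <-; apply: (iter_transfer_norm K_stable p_ge0 1) => // y Ky.
    by rewrite mul1r mulN1r distrC hn.
  have h2 : `|r * L n0.+1 x - r * h x| <= e / (u 1 x + r) * r.
    by rewrite -mulrBr normrM (gtr0_norm r_gt0) mulrC ler_pM2r// hn.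
  have h3 : e / (u 1 x + r) * u 1 x + e / (u 1 x + r) * r = e.
    by rewrite -mulrDr divfK// gt_eqF.
  rewrite addr0 -h3 -[T h x](subrK (T (L n0) x)) -addrA {2}TL.
  by apply: le_trans (ler_normD _ _) _; exact: lerD.
- move=> eta eta0; have [n0 hn] := hL _ (divr2_gt0 eta0).
  have [n1 h1] := L1 n0 _ (divr2_gt0 eta0).
  exists n1 => n x nn Kx; have := h1 n x nn Kx.
  have h2 : `|iter n T h x - iter n T (L n0) x| <= eta / 2 * u n x.
    have /(congr1 (@^~ x)) /= := iter_transfer_lin w p n 1 (-1) h (L n0).
    rewrite !mul1r mulN1r => <-; apply: (iter_transfer_norm K_stable p_ge0) => // y Ky.
    by rewrite mul1r mulN1r distrC hn.
  move: h2; rewrite !ler_norml => /andP[? ?] /andP[? ?].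
  by apply/andP; split; lra.
Qed.

Theorem transfer_convergence : exists (nu : (V -> R) -> R) (h : V -> R),
  [/\ bounded_uniform K D h, exists2 c : R, 0 < c & forall x, K x -> c <= h x,
      forall x, K x -> T h x = r * h x & nu h = 1] /\
  [/\ forall f g s t, bounded_uniform K D f -> bounded_uniform K D g ->
        nu (fun x => s * f x + t * g x) = s * nu f + t * nu g,
      forall f g, bounded_uniform K D f -> bounded_uniform K D g ->
        (forall x, K x -> f x <= g x) -> nu f <= nu g,
      nu (fun=> 1) = 1,
      forall f, bounded_uniform K D f -> nu (T f) = r * nu f
    & forall f, bounded_uniform K D f -> forall eps : R, 0 < eps ->
        exists n0, forall n x, (n0 <= n)%N -> K x ->
          `|r ^- n * iter n T f x - nu f * h x| <= eps].
Proof.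
have [h [hbu hc Th h1] hL] := ex_eigenfunction.
(* The value is 0 by default when [f] has no asymptotic ratio. *)
pose nu f := xget 0 [set b | asymptotic_ratio f b].
have nuE f b : asymptotic_ratio f b -> nu f = b.
  by move=> fb; apply: asymptotic_ratio_unique (fb); exact: (xgetPex 0 (ex_intro _ b fb)).
have nuP f : bounded_uniform K D f -> asymptotic_ratio f (nu f).
  by move=> /ex_asymptotic_ratio[b fb]; rewrite (nuE _ _ fb).
exists nu, h; split; first by split=> //; exact: nuE.
split.
- by move=> f g s t /nuP fb /nuP gb; apply: nuE; exact: asymptotic_ratio_lin.
- by move=> f g /nuP fb /nuP gb fg; exact: asymptotic_ratio_le fg fb gb.
- exact/nuE/asymptotic_ratio1.
- by move=> f /nuP fb; apply/nuE/asymptotic_ratio_transfer.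
- move=> f fbu e e0; have [C C0 uC] := iter_transfer1_upper.
  have [|n1 k1] := nuP f fbu (e / 2 / C); first by rewrite !divr_gt0.
  have [|n2 k2] := hL (e / 2 / (`|nu f| + 1)); first by rewrite !divr_gt0// ltr_wpDl.
  exists (maxn n1 n2) => n x; rewrite geq_max => /andP[nn1 nn2] Kx.
  rewrite [X in `|X|](_ : _ = r ^- n * (iter n T f x - nu f * u n x) +
    nu f * (r ^- n * u n x - h x)); last by ring.
  apply: le_trans (ler_normD _ _) _; rewrite !normrM.
  have k3 : `|r ^- n| * `|iter n T f x - nu f * u n x| <= e / 2.
    rewrite ger0_norm ?invr_ge0 ?(ltW (rn_gt0 _))// mulrC ler_pdivrMr//.
    apply: le_trans (k1 n x nn1 Kx) _.
    by rewrite -mulrA ler_pM2l ?divr_gt0// ler_pdivrMl// uC.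
  have k4 : `|nu f| * `|r ^- n * u n x - h x| <= e / 2.
    apply: (@le_trans _ _ ((`|nu f| + 1) * (e / 2 / (`|nu f| + 1)))).
      by apply: ler_pM => //; [rewrite lerDl|exact: k2].
    by rewrite mulrC divfK// gt_eqF// ltr_wpDl.
  lra.
Qed.

End Convergence.

(** * Euclidean distance, its topology, and compactness *)

Section EuclideanDistance.
Context (R : realType) (d : nat).
Local Notation V := 'rV[R]_d.
Implicit Types x y z : V.

Lemma edist_ge0 x y : 0 <= edist x y.
Proof. exact: sqrtr_ge0. Qed.

Lemma edist_sym x y : edist x y = edist y x.
Proof. by congr Num.sqrt; apply: eq_bigr => i _; rewrite -sqrrN opprB. Qed.

Lemma edistxx x : edist x x = 0.
Proof.
by rewrite /edist big1 ?sqrtr0// => i _; rewrite subrr expr0n.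
Qed.

Lemma coord_le_edist x y i : `|x ord0 i - y ord0 i| <= edist x y.
Proof.
rewrite -sqrtr_sqr; apply: ler_wsqrtr; rewrite (bigD1 i)//= lerDl.
by apply: sumr_ge0 => j _; exact: sqr_ge0.
Qed.

(** The factor is a crude substitute for the square root of [d]. The absolute value of [e] covers
    [d = 0], where the hypothesis does not fix the sign of [e]. *)
Lemma edist_le_coord x y (e : R) : (forall i, `|x ord0 i - y ord0 i| <= e) ->
  edist x y <= d.+1%:R * `|e|.
Proof.
move=> xye; rewrite -[leRHS]ger0_norm ?mulr_ge0// -sqrtr_sqr; apply: ler_wsqrtr.
apply: (@le_trans _ _ (\sum_(i < d) `|e| ^+ 2)).
  apply: ler_sum => i _; rewrite -[leLHS]real_normK ?num_real//.
  by rewrite lerXn2r ?nnegrE// (le_trans (xye i)) ?ler_norm.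
rewrite sumr_const card_ord -[_ *+ d]mulr_natl exprMn ler_wpM2r ?sqr_ge0//.
by rewrite -natrX ler_nat (leq_trans (leqnSn d))// leq_pmulr.
Qed.

Lemma edist_eq0 x y : edist x y <= 0 -> x = y.
Proof.
move=> xy0; apply/matrixP => i j; rewrite ord1; apply/eqP.
by rewrite -subr_eq0 -normr_le0 (le_trans (coord_le_edist x y j)).
Qed.

Lemma edist_triangle y x z : edist x z <= edist x y + edist y z.
Proof.
pose a i := x ord0 i - y ord0 i; pose b i := y ord0 i - z ord0 i.
pose A := edist x y; pose B := edist y z.
have A0 : 0 <= A := edist_ge0 x y; have B0 : 0 <= B := edist_ge0 y z.
have A2 : \sum_(i < d) a i ^+ 2 = A ^+ 2.
  by rewrite sqr_sqrtr// sumr_ge0// => i _; exact: sqr_ge0.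
have B2 : \sum_(i < d) b i ^+ 2 = B ^+ 2.
  by rewrite sqr_sqrtr// sumr_ge0// => i _; exact: sqr_ge0.
(* The Cauchy-Schwarz inequality, from the squares of [B * a i - A * b i]; if [A] or [B] vanishes,
   so do the corresponding coordinates. *)
have ab : \sum_(i < d) a i * b i <= A * B.
  have [A00|An0] := eqVneq A 0.
    rewrite A00 mul0r big1// => i _; suff -> : a i = 0 by rewrite mul0r.
    by apply/eqP; rewrite -normr_le0 -A00 coord_le_edist.
  have [B00|Bn0] := eqVneq B 0.
    rewrite B00 mulr0 big1// => i _; suff -> : b i = 0 by rewrite mulr0.
    by apply/eqP; rewrite -normr_le0 -B00 coord_le_edist.
  have AB0 : 0 < A * B by rewrite mulr_gt0 ?lt_neqAle ?A0 ?B0 ?andbT// eq_sym.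
  rewrite -(ler_pM2l AB0) mulr_sumr.
  apply: (@le_trans _ _ (\sum_(i < d) 2^-1 * (B ^+ 2 * a i ^+ 2 + A ^+ 2 * b i ^+ 2))).
    by apply: ler_sum => i _; have := sqr_ge0 (B * a i - A * b i); rewrite !expr2; lra.
  by rewrite -mulr_sumr big_split /= -!mulr_sumr A2 B2; lra.
rewrite -/A -/B -[leRHS]ger0_norm ?addr_ge0// -sqrtr_sqr; apply: ler_wsqrtr.
have -> : \sum_(i < d) (x ord0 i - z ord0 i) ^+ 2 =
    A ^+ 2 + B ^+ 2 + 2 * \sum_(i < d) a i * b i.
  by rewrite -A2 -B2 mulr_sumr -!big_split; apply: eq_bigr => i _ /=; rewrite /a /b; ring.
by rewrite !expr2; lra.
Qed.

Lemma nbhs_edistP x (P : set V) :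
  nbhs x P <-> exists2 e : R, 0 < e & forall y, edist x y < e -> P y.
Proof.
split.
  move=> /nbhs_ballP[e /= e0 eP]; exists e => // y xy; apply: eP.
  split=> // i j; rewrite ord1 /ball/=.
  exact: le_lt_trans (coord_le_edist x y j) xy.
move=> [e e0 eP]; apply/nbhs_ballP.
have d0 : 0 < d.+2%:R :> R by [].
(* One more than the factor of [edist_le_coord], to end with a strict inequality. *)
exists (e / d.+2%:R) => /=; first by rewrite divr_gt0.
move=> y [_ xy]; apply: eP; apply: (@le_lt_trans _ _ (d.+1%:R * `|e / d.+2%:R|)).
  by apply: edist_le_coord => i; apply: ltW; exact: xy.
rewrite ger0_norm ?divr_ge0 ?ltW// mulrCA gtr_pMr// ltr_pdivrMr// mul1r.
by rewrite ltr_nat.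
Qed.

(** Finite subcovers in the form used below: an index valid near each point becomes an index valid
    on all of [K]. Boundedness, uniform continuity and Dini's theorem are obtained from it. *)
Lemma compact_eventually (K : set V) (P : nat -> V -> Prop) : compact K ->
  (forall x, K x -> exists2 e : R, 0 < e & exists N, forall n y,
     (N <= n)%N -> edist x y < e -> P n y) ->
  exists N, forall n y, (N <= n)%N -> K y -> P n y.
Proof.
move=> /compact_near_coveringP cK KP.
have [|N _ NP] := cK nat \oo P _.
  move=> x /KP[e e0 [N NP]].
  exists ([set y | edist x y < e], [set n | (N <= n)%N]) => /=.
    by split; [apply/nbhs_edistP; exists e|exists N].
  by move=> [y n] /= [xy Nn]; exact: NP.
by exists N => n y Nn Ky; exact: NP.
Qed.

Lemma compact_eventually2 (K : set V) (P : nat -> V -> V -> Prop) : compact K ->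
  (forall x y, K x -> K y -> exists2 e : R, 0 < e & exists N, forall n x' y',
     (N <= n)%N -> edist x x' < e -> edist y y' < e -> P n x' y') ->
  exists N, forall n x y, (N <= n)%N -> K x -> K y -> P n x y.
Proof.
move=> cK KP; have /compact_near_coveringP cKK := compact_setX cK cK.
have [|N _ NP] := cKK nat \oo (fun n (z : V * V) => P n z.1 z.2) _.
  move=> [x y] [/= Kx Ky]; have [e e0 [N NP]] := KP x y Kx Ky.
  exists ([set z | edist x z.1 < e /\ edist y z.2 < e], [set n | (N <= n)%N]) => /=.
    split; last by exists N.
    exists ([set x' | edist x x' < e], [set y' | edist y y' < e]) => //.
    by split; apply/nbhs_edistP; exists e.
  by move=> [[x' y'] n] /= [[xx' yy'] Nn]; exact: NP.
by exists N => n x y Nn Kx Ky; exact: (NP n Nn (x, y)).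
Qed.

Lemma invS_le (e : R) : 0 < e -> exists N, forall n, (N <= n)%N -> n.+1%:R^-1 <= e.
Proof.
move=> e0; exists (Num.truncn e^-1) => n Nn; rewrite invf_ple ?posrE//.
by apply: le_trans (ltW (truncnS_gt _)) _; rewrite ler_nat.
Qed.

Lemma compact_edist_bounded (K : set V) : compact K ->
  exists M : R, forall x y, K x -> K y -> edist x y <= M.
Proof.
move=> cK; have [x y Kx Ky|N NP] := @compact_eventually2 K
    (fun n x y => edist x y <= n%:R) cK; last first.
  by exists N%:R => x y Kx Ky; exact: NP.
exists 1 => //; exists (Num.truncn (edist x y + 2)).+1 => n x' y' Nn xx' yy'.
apply: (@le_trans _ _ (edist x y + 2)); last first.
  by apply/ltW/(lt_le_trans (truncnS_gt _)); rewrite ler_nat.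
have := edist_triangle x x' y'; have := edist_triangle y x y'.
by rewrite edist_sym in xx'; lra.
Qed.

Lemma inC_edistP (K : set V) (f : V -> R) : inC K f <->
  forall x, K x -> forall e : R, 0 < e -> exists2 delta : R, 0 < delta &
    forall y, K y -> edist x y < delta -> `|f x - f y| < e.
Proof.
split=> [/subspace_continuousP fK x Kx e e0|fK].
  have := fK x Kx; move=> /cvgrPdist_lt/(_ e e0)/nbhs_edistP[delta delta0 h].
  by exists delta => // y Ky xy; exact: h.
apply/subspace_continuousP => x Kx; apply/cvgrPdist_lt => e e0.
have [delta delta0 h] := fK x Kx e e0.
by apply/nbhs_edistP; exists delta => // y xy Ky; exact: h.
Qed.

Lemma bounded_uniformP (K : set V) (f : V -> R) : compact K ->
  bounded_uniform K (@edist R d) f <-> inC K f.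
Proof.
move=> cK; split=> [[_ fu]|/inC_edistP fK].
  apply/inC_edistP => x Kx e e0; have [delta delta0 h] := fu _ (divr2_gt0 e0).
  exists delta => // y Ky xy; apply: (@le_lt_trans _ _ (e / 2)); last by lra.
  by apply: h => //; exact: ltW.
split.
  have [x Kx|N NP] := @compact_eventually K (fun n x => K x -> `|f x| <= n%:R) cK; last first.
    by exists N%:R => x Kx; exact: NP.
  have [delta delta0 h] := fK x Kx 1 ltr01; exists delta => //.
  exists (Num.truncn (`|f x| + 1)).+1 => n y Nn xy Ky.
  apply: (@le_trans _ _ (`|f x| + 1)); last first.
    by apply/ltW/(lt_le_trans (truncnS_gt _)); rewrite ler_nat.
  rewrite -lerBlDl; apply: le_trans (ltW (h y Ky xy)).
  by rewrite distrC; exact: lerB_dist.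
move=> e e0; have [x Kx|N NP] := @compact_eventually K (fun n x => forall y, K x -> K y ->
    edist x y <= n.+1%:R^-1 -> `|f x - f y| <= e) cK; last first.
  by exists N.+1%:R^-1 => [|x y Kx Ky]; [rewrite invr_gt0|exact: NP].
have [delta delta0 h] := fK x Kx _ (divr2_gt0 e0).
exists (delta / 2); first by rewrite divr_gt0.
have [|N NP] := @invS_le (delta / 4); first by rewrite divr_gt0.
exists N => n x' Nn xx' y Kx' Ky x'y; have ndelta := le_trans x'y (NP n Nn).
have h1 := h x' Kx' _; have h2 := h y Ky _.
have {}h1 : `|f x - f x'| < e / 2 by apply: h1; lra.
have {}h2 : `|f x - f y| < e / 2.
  by apply: h2; have := edist_triangle x' x y; lra.
rewrite distrC in h1.
have -> : f x' - f y = (f x' - f x) + (f x - f y) by ring.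
by apply: le_trans (ler_normD _ _) _; lra.
Qed.

End EuclideanDistance.

(** * Summability of a Dini modulus along geometric scales *)

Section DiniSummability.
Context (R : realType) (d : nat).
Local Notation V := 'rV[R]_d.
Local Open Scope ereal_scope.

(* Unlike ge0_le_integral of the library, no measurability is required. *)
Lemma ge0_integral_le disp (T : measurableType disp) (mu : {measure set T -> \bar R})
    (D : set T) (f g : T -> \bar R) :
  (forall x, D x -> 0 <= f x) -> (forall x, D x -> f x <= g x) ->
  \int[mu]_(x in D) f x <= \int[mu]_(x in D) g x.
Proof.
move=> f0 fg; rewrite !ge0_integralE//; last first.
  by move=> x Dx; exact: le_trans (f0 x Dx) (fg x Dx).
apply: le_ereal_sup => _ [h hf <-]; exists h => // x; apply: le_trans (hf x) _.
by rewrite /patch; case: ifPn => // /set_mem /fg.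
Qed.

Lemma modulus_le (X : set V) (D : V -> V -> R) (s t : R) : (s <= t)%R ->
  modulus X D s <= modulus X D t.
Proof.
move=> st; apply: le_ereal_sup => _ [z [? ? zs] <-]; exists z => //.
by split=> //; exact: le_trans zs st.
Qed.

Lemma modulus_ge (X : set V) (D : V -> V -> R) (t : R) x y : X x -> X y ->
  (edist x y <= t)%R -> (D x y)%:E <= modulus X D t.
Proof. by move=> Xx Xy xyt; apply: ereal_sup_ubound; exists (x, y). Qed.

(** On the interval from [kappa ^+ i.+1] to [kappa ^+ i] the integrand is at least
    [b i * kappa ^- i], and the length is [kappa ^+ i * (1 - kappa)]. Real minorants [b i] stand for
    the moduli because these are not yet known to be finite. *)
Lemma modulus_integral_ge (X : set V) (p : V -> R) (kappa : R) n (b : nat -> R) :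
  X !=set0 -> (0 < kappa)%R -> (kappa < 1)%R -> (forall i, 0 <= b i)%R ->
  (forall i, (b i)%:E <= modulus X (fun x y => `|p x - p y|%R) (kappa ^+ i.+1)) ->
  ((1 - kappa) * \sum_(i < n) b i)%:E <=
  \int[lebesgue_measure]_(t in `]0%R, 1%R])
     (modulus X (fun x y => `|p x - p y|%R) t * (t^-1)%:E).
Proof.
move=> X0 k0 k1 b0 bm; set alpha := modulus X _.
pose I i : set R := [set` `]kappa ^+ i.+1, kappa ^+ i]%R].
have mI i : measurable (I i) by exact: measurable_itv.
have -> : ((1 - kappa) * \sum_(i < n) b i)%:E =
    \int[lebesgue_measure]_(t in `]0%R, 1%R])
      (\sum_(i < n) (b i * kappa ^- i)%:E * (\1_(I i) t)%:E).
  rewrite ge0_integral_sum//; last 2 first.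
  - move=> i; apply: measurable_funeM.
    by apply/measurable_EFinP; apply: measurable_indic; exact: mI.
  - move=> i x _; rewrite mule_ge0 ?lee_fin//.
    by rewrite mulr_ge0// invr_ge0 exprn_ge0// ltW.
  rewrite mulr_sumr -sumEFin; apply: eq_bigr => i _.
  rewrite ge0_integralZl_EFin//; last 2 first.
  - by apply/measurable_EFinP; apply: measurable_indic; exact: mI.
  - by rewrite mulr_ge0// invr_ge0 exprn_ge0// ltW.
  rewrite integral_indic//; last exact: mI.
  rewrite setIidl; last first.
    move=> t; rewrite /I /= !in_itv /= => /andP[t1 t2]; apply/andP; split.
      by apply: lt_trans t1; exact: exprn_gt0.
    by apply: le_trans t2 _; rewrite exprn_ile1// ltW.
  have muI : lebesgue_measure (I i) = (kappa ^+ i * (1 - kappa))%:E.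
    rewrite (lebesgue_measure_itv `]kappa ^+ i.+1, kappa ^+ i]%R) /= lte_fin.
    have -> : (kappa ^+ i.+1 < kappa ^+ i)%R by rewrite exprS gtr_pMl ?exprn_gt0.
    by rewrite -EFinB exprSr mulrBr mulr1.
  rewrite [X in _ * X](_ : _ = (kappa ^+ i * (1 - kappa))%:E); last exact: muI.
  by rewrite -EFinM mulrA divfK ?gt_eqF ?exprn_gt0// mulrC.
apply: ge0_integral_le => t; rewrite /= in_itv /= => /andP[t0 t1].
  apply: sume_ge0 => i _; rewrite mule_ge0 ?lee_fin//.
  by rewrite mulr_ge0// invr_ge0 exprn_ge0// ltW.
have ti0 : 0 <= (t^-1)%:E by rewrite lee_fin invr_ge0 ltW.
have [[i Iit]|noI] := pselect (exists i : 'I_n, I i t); last first.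
  rewrite big1; last first.
    move=> i _; rewrite indicE memNset ?mule0// => Iit; apply: noI; by exists i.
  rewrite mule_ge0//; have [x0 Xx0] := X0.
  have := @modulus_ge X (fun x y => `|p x - p y|%R) t x0 x0 Xx0 Xx0.
  by rewrite subrr normr0 edistxx; apply; exact: ltW.
rewrite (bigD1 i)//= big1 ?adde0; last first.
  move=> j ji; rewrite indicE memNset ?mule0//.
  move: Iit; rewrite /I /= !in_itv /= => /andP[i1 i2] /andP[j1 j2].
  have kle a b' : (a < b')%N -> (kappa ^+ b' <= kappa ^+ a.+1)%R.
    by move=> ab; rewrite ler_wiXn2l// ltW.
  case: (ltngtP j i) => [jlti|iltj|/ord_inj jei]; last by rewrite jei eqxx in ji.
    by have := lt_le_trans j1 (le_trans i2 (kle _ _ jlti)); rewrite ltxx.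
  by have := lt_le_trans i1 (le_trans j2 (kle _ _ iltj)); rewrite ltxx.
rewrite indicE mem_set// mule1 EFinM.
move: Iit; rewrite /I /= in_itv /= => /andP[t1' t2].
apply: lee_pmul; rewrite ?lee_fin// ?invr_ge0 ?exprn_ge0 ?(ltW k0)//.
  by apply: le_trans (bm i) (modulus_le _ _ _); exact: ltW.
by rewrite lef_pV2 ?posrE ?exprn_gt0.
Qed.

(** The exponent is [i.+1] because the modulus is bounded below on the [i]-th interval by its value
    at the left end. *)
Lemma dini_summable (X : set V) (p : V -> R) (kappa : R) : dini_continuous X p ->
  (0 < kappa)%R -> (kappa < 1)%R -> exists2 e : nat -> R,
    (forall i, 0 <= e i)%R /\ (exists A : R, forall n, \sum_(i < n) e i <= A)%R &
    forall i x y, X x -> X y -> (edist x y <= kappa ^+ i.+1)%R -> (`|p x - p y| <= e i)%R.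
Proof.
rewrite /dini_continuous => Ioo k0 k1.
have [[x0 Xx0]|noX] := pselect (X !=set0); last first.
  exists (fun=> 0%R); last by move=> i x y Xx; case: noX; exists x.
  by split=> //; exists 0%R => n; rewrite big1.
pose alpha i := modulus X (fun x y => `|p x - p y|%R) (kappa ^+ i.+1).
have alpha0 i : 0 <= alpha i.
  have := @modulus_ge X (fun x y => `|p x - p y|%R) (kappa ^+ i.+1) x0 x0 Xx0 Xx0.
  by rewrite subrr normr0 edistxx; apply; exact: exprn_ge0 (ltW k0).
set I := integral _ _ _ in Ioo.
have key n (b : nat -> R) : (forall i, 0 <= b i)%R -> (forall i, (b i)%:E <= alpha i) ->
    ((1 - kappa) * \sum_(i < n) b i)%:E <= I.
  by move=> b0 bm; apply: modulus_integral_ge => //; exists x0.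
have I0 : 0 <= I.
  by have := key 0%N (fun=> 0%R); rewrite big_ord0 mulr0; apply.
have Ifin : I = (fine I)%:E by rewrite fineK// ge0_fin_numE.
have afin i : alpha i \is a fin_num.
  (* An infinite modulus at scale [i] would admit the minorant [s] at that index alone, chosen so
     that the integral would exceed itself by 1. *)
  rewrite ge0_fin_numE// ltey; apply/eqP => aoo.
  pose s := ((fine I + 1) / (1 - kappa))%R.
  have fI0 : (0 <= fine I)%R by rewrite fine_ge0.
  have s0 : (0 <= s)%R by rewrite mulr_ge0 ?invr_ge0 ?subr_ge0 ?(ltW k1)// addr_ge0.
  have := key i.+1 (fun j => if j == i then s else 0%R).
  rewrite big_ord_recr /= eqxx big1 ?add0r; last first.
    by move=> j _; rewrite ltn_eqF.
  have -> : ((1 - kappa) * s = fine I + 1)%R by rewrite /s mulrC divfK// gt_eqF// subr_gt0.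
  rewrite Ifin lee_fin => h.
  suff : (fine I + 1 <= fine I)%R by lra.
  apply: h => j; case: eqP => // ->; by rewrite aoo leey.
exists (fun i => fine (alpha i)).
  split=> [i|]; first by rewrite fine_ge0.
  exists (fine I / (1 - kappa))%R => n; rewrite ler_pdivlMr ?subr_gt0// mulrC -lee_fin -Ifin.
  by apply: (key n (fun i => fine (alpha i))) => i; rewrite ?fine_ge0// fineK.
move=> i x y Xx Xy xy; rewrite -lee_fin fineK//.
exact: (@modulus_ge X (fun x y => `|p x - p y|%R)).
Qed.

End DiniSummability.

(** * Weakly contractive maps on a compact set *)

Section WeakContraction.
Context (R : realType) (d : nat) (X K : set 'rV[R]_d) (w : 'rV[R]_d -> 'rV[R]_d).
Hypothesis K_compact : compact K.
Hypothesis K_X : K `<=` X.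
Hypothesis K_stable : forall x, K x -> K (w x).
Hypothesis w_nonexp : nonexpansive X w.
Hypothesis w_contr : weakly_contractive X w.

Let iter_K n x : K x -> K (iter n w x).
Proof. by move=> Kx; elim: n => //= n; exact: K_stable. Qed.

Lemma weakly_contractive_lt x y : K x -> K y -> 0 < edist x y ->
  edist (w x) (w y) < edist x y.
Proof.
move=> Kx Ky xy0; rewrite -lte_fin; apply: le_lt_trans (w_contr xy0).
exact: (@modulus_ge _ _ X (fun x y => edist (w x) (w y)) _ x y (K_X Kx) (K_X Ky) (lexx _)).
Qed.

(** The loss of distance is positive and continuous in the pair, and pairs at distance at least [e]
    form a compact set. *)
Lemma weakly_contractive_gap (e : R) : 0 < e -> exists2 g : R, 0 < g &
  forall x y, K x -> K y -> e <= edist x y -> edist (w x) (w y) + g <= edist x y.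
Proof.
move=> e0; have [x y Kx Ky|N NP] := @compact_eventually2 R d K
    (fun n x y => K x -> K y -> e <= edist x y ->
      edist (w x) (w y) + n.+1%:R^-1 <= edist x y) K_compact; last first.
  by exists N.+1%:R^-1 => [|x y Kx Ky]; [rewrite invr_gt0|exact: NP].
have tri x' y' : edist x y <= edist x x' + edist x' y' + edist y y'.
  have := edist_triangle x' x y; have := edist_triangle y' x' y.
  by rewrite (edist_sym y' y); lra.
have [xye|exy] := ltP (edist x y) e.
  exists ((e - edist x y) / 2); first by rewrite divr2_gt0// subr_gt0.
  exists 0%N => n x' y' _ xx' yy' _ _ ex'y'.
  have := edist_triangle x x' y'; have := edist_triangle y x y'.
  by rewrite (edist_sym x' x); lra.
have gap : 0 < edist x y - edist (w x) (w y).
  by rewrite subr_gt0 weakly_contractive_lt// (lt_le_trans e0).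
set g := _ - _ in gap; have [|N NP] := @invS_le R (g / 4); first by rewrite divr_gt0.
exists (g / 8); first by rewrite divr_gt0.
exists N => n x' y' Nn xx' yy' Kx' Ky' ex'y'.
have h1 := NP n Nn; have h2 := tri x' y'.
have h3 := edist_triangle (w x) (w x') (w y'); have h4 := edist_triangle (w y) (w x) (w y').
have h5 := w_nonexp (K_X Kx') (K_X Kx); have h6 := w_nonexp (K_X Ky) (K_X Ky').
rewrite (edist_sym x' x) in h5; rewrite /g in gap h1 xx' yy' *.
by move: h1; set s := n.+1%:R^-1 => h1; lra.
Qed.

(** While the distance exceeds [e], each step loses at least [g]; starting from at most [M], this
    happens no more than [M / g] times. *)
Lemma weakly_contractive_iter (e : R) : 0 < e -> exists N, forall n x y, (N <= n)%N ->
  K x -> K y -> edist (iter n w x) (iter n w y) <= e.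
Proof.
move=> e0; have [g g0 gap] := weakly_contractive_gap e0.
have [M KM] := compact_edist_bounded K_compact.
have alt n x y : K x -> K y -> edist (iter n w x) (iter n w y) <= e \/
    edist (iter n w x) (iter n w y) + n%:R * g <= M.
  move=> Kx Ky; elim: n => [|n [IH|IH]].
  - by right; rewrite mul0r addr0 KM.
  - left; apply: le_trans IH; apply: w_nonexp; exact/K_X/iter_K.
  - have [le_e|/ltW ge_e] := leP (edist (iter n w x) (iter n w y)) e.
      left; apply: le_trans le_e; apply: w_nonexp; exact/K_X/iter_K.
    right; have := gap _ _ (iter_K n Kx) (iter_K n Ky) ge_e.
    by rewrite -natr1 mulrDl mul1r /=; lra.
exists (Num.truncn (M / g)).+1 => n x y Nn Kx Ky; have [//|h] := alt n x y Kx Ky.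
have : M < n%:R * g.
  by rewrite -ltr_pdivrMr//; apply: lt_le_trans (truncnS_gt _) _; rewrite ler_nat.
by have := edist_ge0 (iter n w x) (iter n w y); lra.
Qed.

(** Comparing the orbits of [x0] and [w x0] shows that successive points of one orbit come together,
    so a cluster point of the orbit is fixed. *)
Lemma weakly_contractive_fixpoint : K !=set0 -> exists2 x, K x & w x = x.
Proof.
move=> [x0 Kx0].
have [|x [Kx clx]] := K_compact (F := (fun n => iter n w x0) @ \oo) _.
  by exists 0%N => // n _; exact: iter_K.
exists x => //; apply/esym/edist_eq0/ler_addgt0Pl => e e0; rewrite addr0.
have e3 : 0 < e / 3 by rewrite divr_gt0.
have [N NP] := weakly_contractive_iter e3.
have tail : (iter n w x0 @[n --> \oo]) [set iter n w x0 | n in [set n | (N <= n)%N]].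
  by exists N => // n Nn; exists n.
have near_x : nbhs x [set y | edist x y < e / 3] by apply/nbhs_edistP; exists (e / 3).
have [_ [[n Nn <-] nx]] := clx _ _ tail near_x.
have h1 : edist (iter n w x0) (w (iter n w x0)) <= e / 3.
  by rewrite -iterS iterSr; apply: NP => //; exact: K_stable.
have h2 : edist (w (iter n w x0)) (w x) <= edist x (iter n w x0).
  by rewrite (edist_sym x); apply: w_nonexp; apply: K_X => //; exact: iter_K.
have := edist_triangle (iter n w x0) x (w x).
have := edist_triangle (w (iter n w x0)) (iter n w x0) (w x).
by move: nx => /=; lra.
Qed.

End WeakContraction.

(** * Words, density of orbits, and irreducibility *)

Section IteratedFunctionSystem.
Context (R : realType) (d m : nat) (X K : set 'rV[R]_d).
Context (w : 'I_m -> 'rV[R]_d -> 'rV[R]_d) (p : 'I_m -> 'rV[R]_d -> R).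
Local Notation V := 'rV[R]_d.
Local Notation T := (transfer w p).
Local Notation S := (transfer (coupled_maps w) (coupled_weights p)).

Lemma wJ_cat J1 J2 x : wJ w (J1 ++ J2) x = wJ w J1 (wJ w J2 x).
Proof. by elim: J1 => //= j J ->. Qed.

Lemma wJ_nseq n j x : wJ w (nseq n j) x = iter n (w j) x.
Proof. by elim: n => //= n ->. Qed.

Lemma wJ_stable (A : set V) : (forall j x, A x -> A (w j x)) ->
  forall J x, A x -> A (wJ w J x).
Proof. by move=> Aw; elim=> //= j J IH x Ax; apply/Aw/IH. Qed.

Lemma wJ_nonexpansive : (forall j x, X x -> X (w j x)) ->
  (forall j, nonexpansive X (w j)) -> forall J, nonexpansive X (wJ w J).
Proof.
move=> Xw wn; elim=> //= j J IH x y Xx Xy; apply: le_trans (IH x y Xx Xy).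
by apply: wn; exact: wJ_stable.
Qed.

(** Unfolding the innermost step adds a letter at the head of the word, that is, the outermost map,
    in agreement with the recursion of [wJ] and [pwJ]. *)
Lemma iter_transfer_words n (F : V * V -> R) x y :
  iter n S F (x, y) = \sum_(J : n.-tuple 'I_m) pwJ w p J x * F (wJ w J x, wJ w J y).
Proof.
elim: n F => [|n IH] F.
  rewrite (big_pred1 [tuple]) /= ?mul1r// => J.
  by apply/esym/eqP; exact: tuple0.
rewrite iterSr IH.
have bij : bijective (fun z : 'I_m * n.-tuple 'I_m => cons_tuple z.1 z.2).
  exists (fun J : n.+1.-tuple 'I_m => (thead J, behead_tuple J)).
    by move=> [j J] /=; congr pair; apply: val_inj.
  by move=> J; apply: val_inj => /=; case/tupleP: J.
rewrite [RHS](reindex (fun z : 'I_m * n.-tuple 'I_m => cons_tuple z.1 z.2)) /=; last first.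
  exact: onW_bij.
rewrite -(pair_big xpredT xpredT (fun j (J : n.-tuple 'I_m) =>
  p j (wJ w J x) * pwJ w p J x * F (w j (wJ w J x), w j (wJ w J y)))) /= exchange_big /=.
apply: eq_bigr => J _; rewrite /transfer mulr_sumr; apply: eq_bigr => j _.
by rewrite /coupled_weights /coupled_maps /=; ring.
Qed.

(** A single word is kept out of the sum of nonnegative terms, with each of its weights replaced by
    [pmin]. *)
Lemma iter_transfer_ge_word (pmin : R) J f x : (forall j y, K y -> K (w j y)) ->
  0 < pmin -> (forall j y, K y -> pmin <= p j y) -> (forall y, K y -> 0 <= f y) ->
  K x -> pmin ^+ size J * f (wJ w J x) <= iter (size J) T f x.
Proof.
move=> Kw pm0 pp f0 Kx; elim: J f f0 => [|j J IH] f f0; first by rewrite mul1r.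
have p0 i y : K y -> 0 <= p i y by move=> /(pp i); apply: le_trans; exact: ltW.
rewrite [size _]/= iterSr; apply: le_trans (IH _ _); last first.
  by move=> y Ky; apply: sumr_ge0 => i _; rewrite mulr_ge0 ?p0// f0//; exact: Kw.
rewrite exprSr -mulrA ler_wpM2l ?exprn_ge0 ?(ltW pm0)//=.
have KJ := wJ_stable Kw J Kx.
rewrite /transfer (bigD1 j)//= -[leLHS]addr0 lerD//.
  by rewrite ler_wpM2r ?pp// f0//; exact: Kw.
by apply: sumr_ge0 => i _; rewrite mulr_ge0 ?p0// f0//; exact: Kw.
Qed.

Hypothesis K_inv : invariant_set X w K.
Hypothesis Xw : forall j x, X x -> X (w j x).
Hypothesis w_nonexp : forall j, nonexpansive X (w j).

Let K_X : K `<=` X. Proof. by case: K_inv.1. Qed.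
Let K_compact : compact K. Proof. by case: K_inv.1. Qed.
Let K_nonempty : K !=set0. Proof. by case: K_inv.1. Qed.

Lemma invariant_set_stable j x : K x -> K (w j x).
Proof.
by case: K_inv.1 => _ _ _ ->; move=> [i _ [y Ky <-]]; exists j => //; exists (w i y) => //;
  case: K_inv.1 => _ _ _ ->; exists i => //; exists y.
Qed.

Let K_closed : closed K.
Proof. exact: compact_closed (@norm_hausdorff _ _) K_compact. Qed.

(* The orbit closure of a point of K fixed by some w_j is a compact invariant
   set, so it contains the minimal one. *)
Lemma fixpoint_orbit_dense j0 x0 z (e : R) : K x0 -> w j0 x0 = x0 -> K z -> 0 < e ->
  exists J, edist z (wJ w J x0) < e.
Proof.
move=> Kx0 fx0 Kz e0; pose O := [set wJ w J x0 | J in [set: seq 'I_m]].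
have OK : O `<=` K by move=> _ [J _ <-]; exact: wJ_stable invariant_set_stable _ _ _.
have cOK : closure O `<=` K by rewrite (closure_id K).1//; exact: closure_subset.
have cO_compact : compact (closure O).
  exact: subclosed_compact (@closed_closure _ _) K_compact cOK.
have w_cont j : {within closure O, continuous (w j)}.
  apply/subspace_continuousP => x Ox P /nbhs_edistP[r r0 rP].
  apply/nbhs_edistP; exists r => // y xy Oy; apply: rP; apply: le_lt_trans xy.
  by apply: w_nonexp; apply: K_X; exact: cOK.
suff inv : compact_invariant X w (closure O).
  have := K_inv.2 _ inv _ Kz [set y | edist z y < e].
  by move=> [|y [[J _ <-]]]; [apply/nbhs_edistP; exists e|exists J].
split.
- by apply: subset_trans cOK K_X.
- by exists x0; apply: subset_closure; exists [::].
- exact: cO_compact.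
apply/seteqP; split.
  have : closed (\bigcup_(j in [set: 'I_m]) (w j @` closure O)).
    apply: closed_bigcup => [|j _]; first exact: finite_finset.
    apply: compact_closed (@norm_hausdorff _ _) _.
    exact: continuous_compact (w_cont j) cO_compact.
  move=> /closure_id ->; apply: closure_subset => _ [[|j J] _ <-].
    (* The empty word is where the fixed point serves: [x0 = w j0 x0] puts [x0] itself into an
       image. *)
    by exists j0 => //; exists x0 => //; apply: subset_closure; exists [::].
  by exists j => //; exists (wJ w J x0) => //; apply: subset_closure; exists J.
move=> _ [j _ [x Ox <-]] P /nbhs_edistP[r r0 rP].
have [|_ [[J _ <-] xJ]] := Ox [set y | edist x y < r].
  by apply/nbhs_edistP; exists r.
exists (wJ w (j :: J) x0); split; first by exists (j :: J).
apply: rP; apply: le_lt_trans xJ; apply: w_nonexp; apply: K_X; first exact: cOK.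
by apply: OK; exists J.
Qed.

Context (pmin pmax : R).
Hypothesis pmin_gt0 : 0 < pmin.
Hypothesis p_ge : forall j x, K x -> pmin <= p j x.
Hypothesis p_le : forall j x, K x -> p j x <= pmax.

Let p_ge0 j x : K x -> 0 <= p j x.
Proof. by move=> /(p_ge j); apply: le_trans; exact: ltW. Qed.

(** Many applications of [w j0] bring every [x] near the fixed point [x0], and then a word [J] with
    [wJ w J x0] near [z] brings it near [z]. Padding with [j0] on the inner side gives words of
    every sufficiently large length, so by compactness one length [N] works for all targets, with
    [c = pmin ^+ N]. *)
Lemma transfer_irreducible j0 : weakly_contractive X (w j0) ->
  forall delta : R, 0 < delta -> exists (N : nat) (c : R), 0 < c /\
  forall (f : V -> R) b z, (forall x, K x -> 0 <= f x) -> 0 <= b -> K z ->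
    (forall x, K x -> edist z x <= delta -> b <= f x) ->
  forall x, K x -> c * b <= iter N T f x.
Proof.
move=> wc delta delta0; have stab := invariant_set_stable.
have [x0 Kx0 fx0] := weakly_contractive_fixpoint K_compact K_X (stab j0) (w_nonexp j0) wc K_nonempty.
have fx0n n : iter n (w j0) x0 = x0 by elim: n => //= n ->.
have [z Kz|N NP] := @compact_eventually R d K (fun n z => forall (f : V -> R) b,
  (forall x, K x -> 0 <= f x) -> 0 <= b ->
  (forall x, K x -> edist z x <= delta -> b <= f x) ->
  forall x, K x -> pmin ^+ n * b <= iter n T f x) K_compact; last first.
  exists N, (pmin ^+ N); split; first exact: exprn_gt0.
  by move=> f b z f0 b0 Kz; exact: NP.
have d4 : 0 < delta / 4 by rewrite divr_gt0.
have [J zJ] := fixpoint_orbit_dense Kx0 fx0 Kz d4.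
have [N0 N0P] := weakly_contractive_iter K_compact K_X (stab j0) (w_nonexp j0) wc d4.
exists (delta / 4) => //; exists (size J + N0)%N => n z' Nn zz' f b f0 b0 fb x Kx.
pose J' := J ++ nseq (n - size J) j0.
have sJ' : size J' = n.
  by rewrite size_cat size_nseq subnKC// (leq_trans _ Nn)// leq_addr.
have := iter_transfer_ge_word J' stab pmin_gt0 p_ge f0 Kx; rewrite sJ'.
apply: le_trans; rewrite ler_wpM2l ?exprn_ge0 ?(ltW pmin_gt0)//.
apply: fb; first exact: wJ_stable.
rewrite wJ_cat wJ_nseq.
set y := iter _ _ x; have Ky : K y by rewrite /y -wJ_nseq; exact: wJ_stable.
have h1 : edist x0 y <= delta / 4.
  by rewrite -[x0](fx0n (n - size J)%N); apply: N0P => //; rewrite leq_subRL// (leq_trans _ Nn)// leq_addr.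
have h2 : edist (wJ w J x0) (wJ w J y) <= edist x0 y.
  by apply: (wJ_nonexpansive Xw w_nonexp); exact: K_X.
have := edist_triangle z z' (wJ w J y); have := edist_triangle (wJ w J x0) z (wJ w J y).
by rewrite (edist_sym z' z); lra.
Qed.

(** Nonexpansiveness bounds the quotients by 1, so [gammaJ] is a genuine supremum. If [K] has no
    second point, it is the default 0 and [y = x]. *)
Lemma gammaJ_le J x y : K x -> K y ->
  edist (wJ w J x) (wJ w J y) <= gammaJ K w J x * edist x y /\ 0 <= gammaJ K w J x <= 1.
Proof.
move=> Kx Ky; have nonexp := wJ_nonexpansive Xw w_nonexp J.
pose Q := [set edist (wJ w J x) (wJ w J y) / edist x y | y in [set y | K y /\ y <> x]].
have Q1 : ubound Q 1.
  move=> _ [t [Kt tx] <-]; rewrite ler_pdivrMr ?mul1r; first by apply: nonexp; exact: K_X.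
  by rewrite ltNge; apply/negP => /edist_eq0/esym.
have Q0 q : Q q -> 0 <= q by move=> [t _ <-]; rewrite divr_ge0 ?edist_ge0.
have gQ : gammaJ K w J x = sup Q by [].
have [[q Qq]|noQ] := pselect (Q !=set0); last first.
  have -> : gammaJ K w J x = 0.
    rewrite gQ (_ : Q = set0) ?sup0//; apply/seteqP; split=> // q Qq; apply: noQ; by exists q.
  rewrite mul0r lexx ler01; split=> //.
  have [->|/eqP xy] := eqVneq y x; first by rewrite edistxx.
  by case: noQ; exists (edist (wJ w J x) (wJ w J y) / edist x y), y.
split; last first.
  rewrite gQ (le_trans (Q0 q Qq)) ?ub_le_sup//; first by apply: ge_sup => //; exists q.
  by exists 1.
have [->|/eqP xy] := eqVneq y x; first by rewrite !edistxx mulr0.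
have xy0 : 0 < edist x y by rewrite ltNge; apply/negP => /edist_eq0/esym.
rewrite -ler_pdivrMr// gQ; apply: ub_le_sup; first by exists 1.
by exists y.
Qed.

Lemma pwJ_ge0_le J x : K x -> 0 <= pwJ w p J x <= pmax ^+ size J.
Proof.
move=> Kx; elim: J => [|j J /andP[IH0 IH]] /=; first by rewrite expr0 ler01 lexx.
have KJ := wJ_stable invariant_set_stable J Kx.
by rewrite mulr_ge0 ?p_ge0//= exprS ler_pM ?p_ge0 ?p_le.
Qed.

(** The coupling carries the weights of the first point, which are exactly those multiplying
    [gammaJ K w J x] in the hypothesis. The outer [sup] is genuine since [gammaJ] is at most 1 and
    the weights at most [pmax]. *)
Lemma coupled_average_contraction k x y : K x -> K y ->
  iter k S (fun z => edist z.1 z.2) (x, y) <=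
  sup [set \sum_(J : k.-tuple 'I_m) pwJ w p J x * gammaJ K w J x | x in K] * edist x y.
Proof.
move=> Kx Ky; rewrite iter_transfer_words /=.
apply: (@le_trans _ _ ((\sum_(J : k.-tuple 'I_m) pwJ w p J x * gammaJ K w J x) * edist x y)).
  rewrite mulr_suml; apply: ler_sum => J _; rewrite -mulrA.
  have /andP[p0 _] := pwJ_ge0_le J Kx; have [h _] := gammaJ_le J Kx Ky.
  exact: ler_wpM2l.
rewrite ler_wpM2r ?edist_ge0//; apply: ub_le_sup; last by exists x.
exists (\sum_(J : k.-tuple 'I_m) pmax ^+ k) => _ [t Kt <-]; apply: ler_sum => J _.
have /andP[p0 pM] := pwJ_ge0_le J Kt; have [_ /andP[g0 g1]] := gammaJ_le J Kt Kt.
rewrite size_tuple in pM; apply: le_trans pM; exact: ler_piMr.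
Qed.

End IteratedFunctionSystem.

(** * The modulus of complex numbers *)

Section ComplexModulus.
Context (R : realType).
Implicit Types x y : R[i].

Lemma cmodE x : cmod x = ComplexField.Normc.normc x.
Proof. by case: x. Qed.

Lemma cmod_ge0 x : 0 <= cmod x.
Proof. exact: sqrtr_ge0. Qed.

Lemma cmodM x y : cmod (x * y) = cmod x * cmod y.
Proof. by rewrite !cmodE ComplexField.Normc.normcM. Qed.

Lemma cmodD x y : cmod (x + y) <= cmod x + cmod y.
Proof. by rewrite !cmodE; exact: le_normcD. Qed.

Lemma cmodN x : cmod (- x) = cmod x.
Proof. by rewrite !cmodE normcN. Qed.

Lemma cmodB x y : cmod (x - y) <= cmod x + cmod y.
Proof. by rewrite -(cmodN y); exact: cmodD. Qed.

Lemma cmod_real (a : R) : cmod (a%:C)%C = `|a|.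
Proof. by rewrite /cmod /= expr0n addr0 sqrtr_sqr. Qed.

Lemma cmod0 : cmod (0 : R[i]) = 0.
Proof. by rewrite -(rmorph0 (real_complex R)) cmod_real normr0. Qed.

Lemma cmod_le0 x : cmod x <= 0 -> x = 0.
Proof.
move=> x0; apply: ComplexField.Normc.eq0_normc; rewrite -cmodE.
by apply/eqP; rewrite eq_le x0 cmod_ge0.
Qed.

Lemma cmodV x : cmod x^-1 = (cmod x)^-1.
Proof. by rewrite !cmodE ComplexField.Normc.normcV. Qed.

Lemma cmod_sum (I : Type) (s : seq I) (F : I -> R[i]) :
  cmod (\sum_(i <- s) F i) <= \sum_(i <- s) cmod (F i).
Proof.
elim/big_rec2: _ => [|i a b _ h]; first by rewrite cmod0.
by apply: le_trans (cmodD _ _) _; rewrite lerD2l.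
Qed.

Lemma normr_Re_le x : `|complex.Re x| <= cmod x.
Proof. by rewrite -sqrtr_sqr; apply: ler_wsqrtr; rewrite lerDl sqr_ge0. Qed.

Lemma normr_Im_le x : `|complex.Im x| <= cmod x.
Proof. by rewrite -sqrtr_sqr; apply: ler_wsqrtr; rewrite lerDr sqr_ge0. Qed.

Lemma cmod_le x : cmod x <= `|complex.Re x| + `|complex.Im x|.
Proof.
rewrite -[leRHS]ger0_norm ?addr_ge0// -sqrtr_sqr; apply: ler_wsqrtr.
rewrite -[complex.Re x ^+ 2]real_normK ?num_real// -[complex.Im x ^+ 2]real_normK ?num_real//.
have : 0 <= `|complex.Re x| * `|complex.Im x| by rewrite mulr_ge0.
by rewrite !expr2; lra.
Qed.

Lemma ReM x y : complex.Re (x * y) =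
  complex.Re x * complex.Re y - complex.Im x * complex.Im y.
Proof. by case: x; case: y. Qed.

Lemma ImM x y : complex.Im (x * y) =
  complex.Re x * complex.Im y + complex.Im x * complex.Re y.
Proof. by case: x; case: y. Qed.

Lemma ReD x y : complex.Re (x + y) = complex.Re x + complex.Re y.
Proof. by case: x; case: y. Qed.

Lemma ImD x y : complex.Im (x + y) = complex.Im x + complex.Im y.
Proof. by case: x; case: y. Qed.

Lemma complex_eqP x y : complex.Re x = complex.Re y -> complex.Im x = complex.Im y -> x = y.
Proof. by case: x; case: y => a b c d /= -> ->. Qed.

End ComplexModulus.

(** * Continuous real and complex functions on a compact set *)

Section ContinuousFunctions.
Context (R : realType) (d : nat) (K : set 'rV[R]_d).
Hypothesis K_compact : compact K.
Local Notation V := 'rV[R]_d.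

Lemma inC_lin (s t : R) (f g : V -> R) : inC K f -> inC K g ->
  inC K (fun x => s * f x + t * g x).
Proof.
move=> /(bounded_uniformP _ K_compact) fK /(bounded_uniformP _ K_compact) gK.
by apply/(bounded_uniformP _ K_compact)/bounded_uniform_lin.
Qed.

Lemma inC_cst (c : R) : inC K (fun=> c).
Proof. by apply/inC_edistP => x _ e e0; exists 1 => // y _ _; rewrite subrr normr0. Qed.

Lemma inC_sum (I : Type) (s : seq I) (F : I -> V -> R) : (forall i, inC K (F i)) ->
  inC K (fun x => \sum_(i <- s) F i x).
Proof.
move=> FK; elim: s => [|i s IH].
  by under eq_fun do rewrite big_nil; exact: inC_cst.
under eq_fun do rewrite big_cons.
by have := @inC_lin 1 1 _ _ (FK i) IH; under eq_fun do rewrite !mul1r.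
Qed.

Lemma inC_uniform_limit (L : nat -> V -> R) (h : V -> R) : (forall n, inC K (L n)) ->
  (forall eps : R, 0 < eps -> exists n, forall x, K x -> `|L n x - h x| <= eps) ->
  inC K h.
Proof.
move=> LK Lh; apply/inC_edistP => x Kx e e0.
have [|n hn] := Lh (e / 4); first by rewrite divr_gt0.
have /inC_edistP/(_ x Kx _ (divr2_gt0 e0)) [delta delta0 hd] := LK n.
exists delta => // y Ky xy; have := hd y Ky xy; have := hn x Kx; have := hn y Ky.
by rewrite !ltr_norml !ler_norml => /andP[? ?] /andP[? ?] /andP[? ?]; apply/andP; split; lra.
Qed.

Lemma inC_bounded (f : V -> R) : inC K f -> exists M, forall x, K x -> `|f x| <= M.
Proof. by move=> /(bounded_uniformP _ K_compact)[]. Qed.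

Lemma inCC_bounded (f : V -> R[i]) : inCC K f ->
  exists M, forall x, K x -> cmod (f x) <= M.
Proof.
move=> [/inC_bounded[M1 h1] /inC_bounded[M2 h2]]; exists (M1 + M2) => x Kx.
by apply: le_trans (cmod_le _) _; rewrite lerD ?h1 ?h2.
Qed.

Lemma inCC_lin (a : R[i]) (f g : V -> R[i]) : inCC K f -> inCC K g ->
  inCC K (fun x => a * f x + g x).
Proof.
move=> [fr fi] [gr gi]; split.
  have -> : (fun x => complex.Re (a * f x + g x)) = fun x => 1 * (complex.Re a *
      complex.Re (f x) + (- complex.Im a) * complex.Im (f x)) + 1 * complex.Re (g x).
    by apply/funext => x; rewrite ReD ReM; ring.
  by apply: inC_lin => //; exact: inC_lin.
have -> : (fun x => complex.Im (a * f x + g x)) = fun x => 1 * (complex.Re a *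
    complex.Im (f x) + complex.Im a * complex.Re (f x)) + 1 * complex.Im (g x).
  by apply/funext => x; rewrite ImD ImM; ring.
by apply: inC_lin => //; exact: inC_lin.
Qed.

Lemma inCC_cst (c : R[i]) : inCC K (fun=> c).
Proof. by split; exact: inC_cst. Qed.

Lemma supnorm_ge (f : V -> R) : (exists M, forall x, K x -> `|f x| <= M) ->
  forall x, K x -> `|f x| <= supnorm K f.
Proof.
move=> [M fM] x Kx; apply: ub_le_sup; last by exists x.
by exists M => _ [y Ky <-]; exact: fM.
Qed.

Lemma supnorm_le (f : V -> R) (M : R) : K !=set0 -> (forall x, K x -> `|f x| <= M) ->
  supnorm K f <= M.
Proof.
move=> [x Kx] fM; apply: ge_sup; first by exists `|f x|, x.
by move=> _ [y Ky <-]; exact: fM.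
Qed.

End ContinuousFunctions.

(** * Growth rate and spectral radius *)

Section SpectralRadius.
Context (R : realType) (d m : nat) (K : set 'rV[R]_d).
Context (w : 'I_m -> 'rV[R]_d -> 'rV[R]_d) (p : 'I_m -> 'rV[R]_d -> R).
Context (pmin pmax : R).
Local Notation V := 'rV[R]_d.
Hypothesis m_gt0 : (0 < m)%N.
Hypothesis K_nonempty : K !=set0.
Hypothesis K_compact : compact K.
Hypothesis K_stable : forall j x, K x -> K (w j x).
Hypothesis pmin_gt0 : 0 < pmin.
Hypothesis p_ge : forall j x, K x -> pmin <= p j x.
Hypothesis p_le : forall j x, K x -> p j x <= pmax.
Hypothesis w_nonexp : forall j x y, K x -> K y -> edist (w j x) (w j y) <= edist x y.
Hypothesis p_cont : forall j, inC K (p j).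
Local Notation T := (transfer w p).
Local Notation A := (complexification T).
Local Notation r := (growth_rate K w p).
Local Notation u n := (iter n T (fun=> 1)).

Let p_ge0 j x : K x -> 0 <= p j x.
Proof. by move=> /(p_ge j); apply: le_trans; exact: ltW. Qed.

Lemma transfer_inC f : inC K f -> inC K (T f).
Proof.
move=> /inC_edistP fK; rewrite /transfer; apply: inC_sum => // j.
apply/subspace_continuousP => x Kx; apply: cvgM.
  by have /subspace_continuousP/(_ x Kx) := @p_cont j.
apply/cvgrPdist_lt => e e0; have [delta delta0 h] := fK _ (K_stable j Kx) e e0.
apply/nbhs_edistP; exists delta => // y xy Ky; apply: h; first exact: K_stable.
by apply: le_lt_trans xy; exact: w_nonexp.
Qed.

Lemma complexificationE (f : V -> R[i]) x :
  A f x = \sum_(j < m) (p j x)%:C%C * f (w j x).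
Proof.
apply: complex_eqP; rewrite /complexification /transfer /=.
  rewrite (big_morph _ (@ReD R) (erefl _)); apply: eq_bigr => j _.
  by rewrite ReM /= mul0r subr0.
rewrite (big_morph _ (@ImD R) (erefl _)); apply: eq_bigr => j _.
by rewrite ImM /= mul0r addr0.
Qed.

Lemma complexification_lin a f g x : A (fun y => a * f y + g y) x = a * A f x + A g x.
Proof.
rewrite !complexificationE mulr_sumr -big_split; apply: eq_bigr => j _ /=; ring.
Qed.

Lemma cmod_complexification f x : K x -> cmod (A f x) <= T (fun y => cmod (f y)) x.
Proof.
move=> Kx; rewrite complexificationE; apply: le_trans (cmod_sum _ _) _.
by apply: ler_sum => j _; rewrite cmodM cmod_real ger0_norm// p_ge0.
Qed.

Lemma complexification_inCC f : inCC K f -> inCC K (A f).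
Proof. by move=> [fr fi]; split; exact: transfer_inC. Qed.

Section Resolvent.
Context (lam : R[i]) (lam_gt : r < cmod lam).

Let L := cmod lam.

Let L_gt0 : 0 < L.
Proof.
apply: lt_trans lam_gt.
exact: (growth_rate_gt0 m_gt0 K_nonempty K_stable pmin_gt0 p_ge p_le).
Qed.

Let lamN0 : lam != 0.
Proof. by apply: contraTneq L_gt0 => lam0; rewrite /L lam0 cmod0 ltxx. Qed.

Let geometric : exists C q : R, [/\ 0 <= C, 0 <= q, q < 1 &
  forall n x, K x -> L ^- n * u n x <= C * q ^+ n].
Proof.
have [s [C [s0 sL C0 uC]]] := growth_rate_geometric m_gt0 K_nonempty K_stable
  pmin_gt0 p_ge p_le lam_gt.
exists C, (s / L); split=> //; first by rewrite divr_ge0// ltW.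
  by rewrite ltr_pdivrMr// mul1r.
move=> n x Kx; rewrite expr_div_n mulrC ler_pdivrMr ?exprn_gt0// -mulrA divfK ?uC//.
by rewrite gt_eqF// exprn_gt0.
Qed.

Let geometric_lim0 (B z : R) (C q : R) : 0 <= C -> 0 <= q -> q < 1 ->
  (forall n, z <= B * (C * q ^+ n)) -> z <= 0.
Proof.
move=> C0 q0 q1 zn; apply/ler_addgt0Pl => e e0; rewrite addr0.
have [|n qn] := @geometric_small R q (e / (`|B| * C + 1)) q0 q1.
  by rewrite divr_gt0// ltr_wpDl// mulr_ge0.
apply: le_trans (zn n) _; rewrite mulrA.
apply: (@le_trans _ _ ((`|B| * C + 1) * (e / (`|B| * C + 1)))); last first.
  by rewrite mulrC divfK// gt_eqF// ltr_wpDl// mulr_ge0.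
have := ler_wpM2r C0 (ler_norm B) => h.
apply: (@le_trans _ _ ((`|B| * C + 1) * q ^+ n)).
  by rewrite ler_wpM2r ?exprn_ge0//; lra.
by rewrite ler_wpM2l// addr_ge0// mulr_ge0.
Qed.

(** Iterating [phi = lam^-1 * A phi] bounds the modulus of [phi] by [B * (L ^- n * u n)], which
    tends to 0 because [L] exceeds the growth rate. *)
Lemma resolvent_unique phi : inCC K phi ->
  (forall x, K x -> lam * phi x = A phi x) -> forall x, K x -> phi x = 0.
Proof.
move=> phiK phiA; have [B phiB] := inCC_bounded K_compact phiK.
have [C [q [C0 q0 q1 uC]]] := geometric.
have [x0 Kx0] := K_nonempty; have B0 : 0 <= B by exact: le_trans (cmod_ge0 _) (phiB x0 Kx0).
have key n x : K x -> cmod (phi x) <= B * (L ^- n * u n x).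
  elim: n x => [|n IH] x Kx; first by rewrite expr0 invr1 mul1r mulr1 phiB.
  have -> : phi x = lam^-1 * A phi x by rewrite -phiA// mulKf.
  rewrite cmodM cmodV -/L exprS invfM -mulrA mulrCA ler_pM2l ?invr_gt0//.
  apply: le_trans (cmod_complexification _ Kx) _.
  apply: (@le_trans _ _ (T (fun y => B * L ^- n * u n y) x)).
    by apply: (transfer_le K_stable p_ge0) => // y Ky; rewrite -mulrA; exact: IH.
  have /(congr1 (@^~ x)) /= -> := iter_transferZ w p 1 (B * L ^- n) (u n).
  by rewrite mulrA.
move=> x Kx; apply/cmod_le0/(geometric_lim0 (B := B) C0 q0 q1) => n.
by apply: le_trans (key n x Kx) _; rewrite ler_wpM2l// uC.
Qed.

Lemma resolvent_exists : exists M : R, forall f B, inCC K f ->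
  (forall x, K x -> cmod (f x) <= B) -> exists g, [/\ inCC K g,
    forall x, K x -> lam * g x - A g x = f x & forall x, K x -> cmod (g x) <= M * B].
Proof.
have [C [q [C0 q0 q1 uC]]] := geometric; have q1' : 0 < 1 - q by rewrite subr_gt0.
exists (C / (L * (1 - q))) => f B fK fB.
have [x0 Kx0] := K_nonempty; have B0 : 0 <= B by exact: le_trans (cmod_ge0 _) (fB x0 Kx0).
(* These are the partial sums of the Neumann series, the sum of [lam] to the power -(i+1) times the
   [i]-th iterate of [A] on [f]. Their increments are at most [B / L * C * q ^+ n], whence the
   constant [C / (L * (1 - q))]. *)
pose g n := iter n (fun (g : V -> R[i]) x => lam^-1 * (f x + A g x)) (fun=> 0).
have gK n : inCC K (g n).
  elim: n => [|n IH]; first exact: inCC_cst.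
  have := inCC_lin K_compact lam^-1 (inCC_lin K_compact 1 fK (complexification_inCC IH)) (inCC_cst K 0).
  by congr inCC; apply/funext => x; rewrite addr0 mul1r.
have step n x : K x -> cmod (g n.+1 x - g n x) <= B / L * (L ^- n * u n x).
  elim: n x => [|n IH] x Kx.
    rewrite /= expr0 invr1 !mulr1 subr0 (_ : A _ x = 0) ?addr0; last first.
      by rewrite complexificationE big1// => j _; rewrite mulr0.
    by rewrite cmodM cmodV mulrC ler_pM2r ?invr_gt0// fB.
  have -> : g n.+2 x - g n.+1 x = lam^-1 * A (fun y => (-1) * g n y + g n.+1 y) x.
    by rewrite complexification_lin /=; ring.
  rewrite cmodM cmodV -/L exprS invfM -mulrA.
  rewrite [leRHS](_ : _ = L^-1 * (B / L * (L ^- n * u n.+1 x))); last by ring.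
  rewrite ler_pM2l ?invr_gt0//; apply: le_trans (cmod_complexification _ Kx) _.
  apply: (@le_trans _ _ (T (fun y => B / L * L ^- n * u n y) x)).
    by apply: (transfer_le K_stable p_ge0) => // y Ky; rewrite mulN1r addrC -mulrA; exact: IH.
  have /(congr1 (@^~ x)) /= -> := iter_transferZ w p 1 (B / L * L ^- n) (u n).
  by rewrite mulrA.
pose M := C / (L * (1 - q)).
have M0 : 0 <= M by rewrite divr_ge0// mulr_ge0// ltW.
have Mq : M * (1 - q) = C / L.
  by rewrite /M invfM mulrA divfK// gt_eqF.
have tele n k x : K x -> cmod (g (n + k)%N x - g n x) <= M * B * (q ^+ n - q ^+ (n + k)).
  move=> Kx; elim: k => [|k IH]; first by rewrite addn0 !subrr cmod0 mulr0.
  rewrite addnS -(subrK (g (n + k)%N x) (g (n + k).+1 x)) -addrA.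
  apply: le_trans (cmodD _ _) _.
  have h : cmod (g (n + k).+1 x - g (n + k)%N x) <= M * (1 - q) * B * q ^+ (n + k).
    apply: le_trans (step _ _ Kx) _; rewrite Mq.
    rewrite [leRHS](_ : _ = B / L * (C * q ^+ (n + k))); last by ring.
    by rewrite ler_wpM2l ?uC// divr_ge0// ltW.
  by rewrite exprS; lra.
have cauchy n k x : K x -> cmod (g (n + k)%N x - g n x) <= M * B * (1 * q ^+ n).
  move=> Kx; apply: le_trans (tele n k x Kx) _; rewrite mul1r ler_wpM2l ?(mulr_ge0 M0 B0)//.
  by rewrite gerBl exprn_ge0.
have small eps : 0 < eps -> exists n0, forall n k x, (n0 <= n)%N -> K x ->
    cmod (g (n + k)%N x - g n x) <= eps.
  move=> eps0; have MB1 : 0 < M * B + 1 by rewrite ltr_wpDl//; exact: mulr_ge0 M0 B0.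
  have [|n0 qn0] := @geometric_small R q (eps / (M * B + 1)) q0 q1.
    by rewrite divr_gt0.
  exists n0 => n k x n0n Kx; apply: le_trans (cauchy n k x Kx) _; rewrite mul1r.
  apply: (@le_trans _ _ ((M * B + 1) * (eps / (M * B + 1)))).
    apply: ler_pM; rewrite ?(mulr_ge0 M0 B0) ?exprn_ge0 ?lerDl//.
    by apply: le_trans qn0; rewrite ler_wiXn2l// ltW.
  by rewrite mulrC divfK ?gt_eqF.
have [|gr grP] := @uniform_cauchy_limit R V K (fun n x => complex.Re (g n x)).
  move=> eps /small[n0 h]; exists n0 => n k x n0n Kx.
  apply: le_trans (h n k x n0n Kx); apply: le_trans (normr_Re_le _).
  by rewrite ReD; case: (g n x).
have [|gi giP] := @uniform_cauchy_limit R V K (fun n x => complex.Im (g n x)).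
  move=> eps /small[n0 h]; exists n0 => n k x n0n Kx.
  apply: le_trans (h n k x n0n Kx); apply: le_trans (normr_Im_le _).
  by rewrite ImD; case: (g n x).
pose G x : R[i] := Complex (gr x) (gi x).
have GP (eps : R) : 0 < eps -> exists n0, forall n x, (n0 <= n)%N -> K x -> cmod (G x - g n x) <= eps.
  move=> eps0; have [n1 h1] := grP _ (divr2_gt0 eps0); have [n2 h2] := giP _ (divr2_gt0 eps0).
  exists (maxn n1 n2) => n x; rewrite geq_max => /andP[nn1 nn2] Kx.
  rewrite -cmodN opprB; apply: le_trans (cmod_le _) _.
  have := h1 n x nn1 Kx; have := h2 n x nn2 Kx; rewrite ReD ImD.
  by case: (g n x) => a b /=; lra.
exists G; split.
- split.
    apply: (inC_uniform_limit (L := fun n x => complex.Re (g n x))) => [n|eps /grP[n0 h]].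
      by case: (gK n).
    by exists n0 => x Kx; exact: h.
  apply: (inC_uniform_limit (L := fun n x => complex.Im (g n x))) => [n|eps /giP[n0 h]].
    by case: (gK n).
  by exists n0 => x Kx; exact: h.
- move=> x Kx; apply/subr0_eq/cmod_le0/ler_addgt0Pl => e e0; rewrite addr0.
  have M1 : 0 < L + u 1 x.
    by rewrite addr_gt0//; exact: (iter_transfer1_gt0 m_gt0 K_stable pmin_gt0 p_ge 1).
  have [|n0 h] := GP (e / (L + u 1 x)); first by rewrite divr_gt0.
  have eqn : lam * g n0.+1 x = f x + A (g n0) x by rewrite /= mulrA mulfV// mul1r.
  have -> : lam * G x - A G x - f x =
      lam * (G x - g n0.+1 x) - A (fun y => (-1) * g n0 y + G y) x.
    by rewrite complexification_lin mulrBr eqn; ring.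
  apply: le_trans (cmodB _ _) _; rewrite cmodM -/L.
  have h1 : L * cmod (G x - g n0.+1 x) <= L * (e / (L + u 1 x)).
    by rewrite ler_pM2l// h.
  have h2 : cmod (A (fun y => (-1) * g n0 y + G y) x) <= e / (L + u 1 x) * u 1 x.
    apply: le_trans (cmod_complexification _ Kx) _.
    have /(congr1 (@^~ x)) /= <- := iter_transferZ w p 1 (e / (L + u 1 x)) (fun=> 1).
    by apply: (transfer_le K_stable p_ge0) => // y Ky; rewrite mulN1r addrC mulr1 h.
  have h3 : L * (e / (L + u 1 x)) + e / (L + u 1 x) * u 1 x = e.
    by rewrite (mulrC L) -mulrDr divfK ?gt_eqF.
  by apply: le_trans (lerD h1 h2) _; rewrite h3.
- move=> x Kx; apply/ler_addgt0Pl => e e0; have [n0 h] := GP e e0.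
  have := h n0 x (leqnn _) Kx; have := cauchy 0%N n0 x Kx.
  rewrite add0n /= subr0 expr0 !mulr1 => h1 h2.
  rewrite -[G x](subrK (g n0 x)); apply: le_trans (cmodD _ _) _.
  exact: lerD.
Qed.

(** The inverse is picked function by function with the axiom of choice, so its linearity and the
    left inverse identity both have to come from [resolvent_unique]. *)
Lemma mem_resolvent_set : resolvent_set K A lam.
Proof.
have [M exM] := resolvent_exists.
have /choice[S SP] : forall f, exists g, inCC K f -> [/\ inCC K g,
    forall x, K x -> lam * g x - A g x = f x &
    forall x, K x -> cmod (g x) <= M * supnorm K (fun x => cmod (f x))].
  move=> f; have [fK|fK] := pselect (inCC K f); last by exists (fun=> 0).
  have [B fB] := inCC_bounded K_compact fK.
  have fS x : K x -> cmod (f x) <= supnorm K (fun x => cmod (f x)).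
    move=> Kx; rewrite -[leLHS]ger0_norm ?cmod_ge0//.
    apply: (supnorm_ge (f := fun x => cmod (f x))) => //.
    by exists B => y Ky; rewrite ger0_norm ?cmod_ge0// fB.
  by have [g gP] := exM f _ fK fS; exists g.
have SK f : inCC K f -> inCC K (S f) by move=> /SP[].
have SE f x : inCC K f -> K x -> lam * S f x - A (S f) x = f x.
  by move=> /SP[_ h _]; exact: h.
exists S; split.
  split=> //.
  - move=> a f g fK gK x Kx.
    have fgK := inCC_lin K_compact a fK gK.
    pose phi y := (-1) * S (fun y => a * f y + g y) y + (a * S f y + S g y).
    have phiK : inCC K phi.
      by apply: inCC_lin => //; [exact: SK|apply: inCC_lin => //; exact: SK].
    have phi0 : phi x = 0.
      apply: resolvent_unique => // y Ky; rewrite complexification_lin complexification_lin.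
      apply/eqP; rewrite -subr_eq0; apply/eqP.
      rewrite [LHS](_ : _ = (-1) * (lam * S (fun y => a * f y + g y) y - A (S (fun y => a * f y + g y)) y)
        + a * (lam * S f y - A (S f) y) + (lam * S g y - A (S g) y)); last by rewrite /phi; ring.
      by rewrite !SE//; ring.
    by apply/eqP; rewrite eq_sym -subr_eq0 addrC -mulN1r; apply/eqP.
  - exists M => f fK; apply: supnorm_le => // x Kx.
    by rewrite ger0_norm ?cmod_ge0//; have [_ _ h] := SP f fK; exact: h.
move=> f fK x Kx; split; last exact: SE.
pose f' y := lam * f y - A f y.
have f'K : inCC K f'.
  have := inCC_lin K_compact (-1) (complexification_inCC fK) (inCC_lin K_compact lam fK (inCC_cst K 0)).
  by congr inCC; apply/funext => y; rewrite /f' mulN1r addr0 addrC.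
have phi0 : (-1) * f x + S f' x = 0.
  apply: (@resolvent_unique (fun y => (-1) * f y + S f' y)) => //.
    by apply: inCC_lin => //; exact: SK.
  move=> y Ky; rewrite complexification_lin; apply/eqP; rewrite -subr_eq0; apply/eqP.
  rewrite [LHS](_ : _ = (lam * S f' y - A (S f') y) - (lam * f y - A f y)); last by ring.
  by rewrite SE// subrr.
by apply/eqP; rewrite -subr_eq0 addrC -mulN1r; apply/eqP.
Qed.

End Resolvent.

Lemma spectrum_le lam : spectrum K A lam -> cmod lam <= r.
Proof. by move=> slam; rewrite leNgt; apply/negP => /mem_resolvent_set. Qed.

(** Nothing here shows that the spectrum is nonempty; were it empty, the real [sup] would be 0,
    which is below [r] as well. *)
Lemma spectral_radius_le : spectral_radius K T <= r.
Proof.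
have [[z sz]|nos] := pselect ([set cmod lam | lam in spectrum K A] !=set0).
  apply: ge_sup; first by exists z.
  by move=> _ [lam /spectrum_le ? <-].
rewrite /spectral_radius (_ : [set cmod lam | lam in _] = set0) ?sup0; last first.
  by apply/seteqP; split=> // z sz; apply: nos; exists z.
exact: ltW (growth_rate_gt0 m_gt0 K_nonempty K_stable pmin_gt0 p_ge p_le).
Qed.

Lemma spectral_radius_ge0 : 0 <= spectral_radius K T.
Proof.
have [[_ [lam slam _]]|nos] := pselect ([set cmod lam | lam in spectrum K A] !=set0).
  apply: le_trans (cmod_ge0 lam) _; apply: ub_le_sup; last by exists lam.
  by exists r => _ [z /spectrum_le ? <-].
rewrite /spectral_radius (_ : [set cmod lam | lam in _] = set0) ?sup0//.
by apply/seteqP; split=> // z sz; apply: nos; exists z.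
Qed.

(** If [r] were in the resolvent set, the inverse [S] would send [Z], the image of [h] under r - A,
    back to [h]. But [Z] vanishes on [K], so the norm bound on [S] makes [S Z] vanish there, against
    [h x0 != 0]. *)
Lemma spectral_radius_eigenfunction h x0 : inC K h -> K x0 -> h x0 != 0 ->
  (forall x, K x -> T h x = r * h x) -> spectral_radius K T = r.
Proof.
move=> hK Kx0 hx0 Th; apply/eqP; rewrite eq_le spectral_radius_le /=.
have r0 : 0 <= r by exact: ltW (growth_rate_gt0 m_gt0 K_nonempty K_stable pmin_gt0 p_ge p_le).
apply: ub_le_sup; first by exists r => _ [lam /spectrum_le ? <-].
exists (r%:C)%C; last by rewrite cmod_real ger0_norm.
move=> [S [[SK Slin [M SM]] Sinv]].
pose H x : R[i] := (h x)%:C%C.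
have HK : inCC K H by split; [exact: hK|exact: inC_cst].
have AH x : K x -> r%:C%C * H x - A H x = 0.
  move=> Kx; rewrite complexificationE /H -rmorphM -Th// /transfer rmorph_sum.
  by apply/eqP; rewrite subr_eq0; apply/eqP/eq_bigr => j _; rewrite rmorphM.
pose Z y := r%:C%C * H y - A H y.
have ZK : inCC K Z.
  have := inCC_lin K_compact (-1) (complexification_inCC HK) (inCC_lin K_compact r%:C%C HK (inCC_cst K 0)).
  by congr inCC; apply/funext => y; rewrite /Z mulN1r addr0 addrC.
have [SZ _] := Sinv H HK x0 Kx0.
have : cmod (S Z x0) <= 0.
  have Z0 : supnorm K (fun x => cmod (Z x)) = 0.
    apply/eqP; rewrite eq_le; apply/andP; split.
      by apply: supnorm_le => // x Kx; rewrite /Z AH// cmod0 normr0.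
    apply: le_trans (normr_ge0 _) (supnorm_ge _ Kx0).
    by exists 0 => x Kx; rewrite /Z AH// cmod0 normr0.
  have := SM Z ZK; rewrite Z0 mulr0; apply: le_trans.
  rewrite -[leLHS]ger0_norm ?cmod_ge0//.
  apply: (supnorm_ge (f := fun x => cmod (S Z x))) => //.
  have [B hB] := inCC_bounded K_compact (SK Z ZK).
  by exists B => x Kx; rewrite ger0_norm ?cmod_ge0// hB.
by rewrite SZ => /cmod_le0 /(congr1 (@complex.Re R)) /= /eqP; rewrite (negbTE hx0).
Qed.

End SpectralRadius.

(** * Approximation of closed sets by continuous functions *)

Section Separation.
Context (R : realType) (d : nat).
Local Notation V := 'rV[R]_d.

Lemma closed_edist (F : set V) x : closed F -> ~ F x ->
  exists2 e : R, 0 < e & forall y, F y -> e <= edist x y.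
Proof.
rewrite -openC openE => oF /oF /nbhs_edistP[e e0 eF]; exists e => // y Fy.
by rewrite leNgt; apply/negP => /eF.
Qed.

(** The functions are max(0, 1 - k dist(x, F)): they decrease to the indicator of [F] and reach 0
    exactly at each point outside. *)
Lemma closed_separation (F : set V) : closed F -> exists phi : nat -> V -> R,
  [/\ forall k x, 0 <= phi k x <= 1,
      forall k x, F x -> phi k x = 1,
      forall k x, phi k.+1 x <= phi k x,
      forall x, ~ F x -> exists k, phi k x = 0
    & forall k K, inC K (phi k)].
Proof.
(* For empty [F] the real [inf] defining the distance would be 0 everywhere, so the zero functions
   are taken instead. *)
move=> cF; have [[y0 Fy0]|noF] := pselect (F !=set0); last first.
  exists (fun _ _ => 0); split=> //.
  - by move=> k x; rewrite lexx ler01.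
  - by move=> k x Fx; case: noF; exists x.
  - by move=> k K; exact: inC_cst.
pose dist x := inf [set edist x y | y in F].
have has_infF x : has_inf [set edist x y | y in F].
  split; first by exists (edist x y0), y0.
  by exists 0 => _ [y _ <-]; exact: edist_ge0.
have dist_ge0 x : 0 <= dist x.
  apply: lb_le_inf; first by case: (has_infF x).
  by move=> _ [y _ <-]; exact: edist_ge0.
have dist_le x y : F y -> dist x <= edist x y.
  by move=> Fy; apply: ge_inf; [case: (has_infF x)|exists y].
have dist_lip x y : dist x <= edist x y + dist y.
  rewrite -lerBlDl; apply: lb_le_inf; first by case: (has_infF y).
  move=> _ [z Fz <-]; rewrite lerBlDl; apply: le_trans (dist_le x z Fz) _.
  exact: edist_triangle.
have dist_pos x : ~ F x -> 0 < dist x.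
  move=> /(closed_edist cF)[e e0 eF]; apply: lt_le_trans e0 _.
  by apply: lb_le_inf; [case: (has_infF x)|move=> _ [y /eF ? <-]].
exists (fun k x => Num.max 0 (1 - k%:R * dist x)); split.
- by move=> k x; rewrite le_max lexx ge_max ler01 lerBlDr lerDl mulr_ge0.
- move=> k x Fx; have -> : dist x = 0.
    by apply/eqP; rewrite eq_le dist_ge0 andbT -(edistxx x) dist_le.
  by rewrite mulr0 subr0; apply/max_idPr.
- move=> k x; rewrite ge_max le_max lexx/= le_max; apply/orP; right.
  by rewrite lerB// ler_wpM2r// ler_nat.
- move=> x /dist_pos dx; exists (Num.truncn (dist x)^-1).+1; apply/max_idPl.
  rewrite subr_le0 -ler_pdivrMr// div1r; exact/ltW/truncnS_gt.
- move=> k K; apply/inC_edistP => x _ e e0.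
  exists (e / k.+1%:R); first by rewrite divr_gt0.
  move=> y _ xy; have kxy : k%:R * edist x y < e.
    apply: (@le_lt_trans _ _ (k.+1%:R * edist x y)).
      by rewrite ler_wpM2r ?edist_ge0// ler_nat.
    by rewrite mulrC -ltr_pdivlMr.
  have h1 : k%:R * dist x <= k%:R * edist x y + k%:R * dist y.
    by rewrite -mulrDr ler_wpM2l.
  have h2 : k%:R * dist y <= k%:R * edist x y + k%:R * dist x.
    by rewrite -mulrDr ler_wpM2l// (edist_sym x).
  move: h1 h2 kxy; set a := k%:R * dist x; set b := k%:R * dist y.
  set c := k%:R * edist x y => h1 h2 kxy.
  rewrite ltr_norml /Num.max; case: ifPn; case: ifPn; rewrite -?leNgt => ? ?;
  by apply/andP; split; lra.
Qed.

End Separation.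

(** * The representing measure of a positive functional *)

Section RieszMeasure.
Context (R : realType) (d : nat) (K : set 'rV[R]_d).
Local Notation V := 'rV[R]_d.
Hypothesis K_compact : compact K.
Hypothesis K_nonempty : K !=set0.

Let K_closed : closed K.
Proof. exact: compact_closed (@norm_hausdorff _ _) K_compact. Qed.

Lemma inC_mul (f g : V -> R) : inC K f -> inC K g -> inC K (fun x => f x * g x).
Proof.
move=> /subspace_continuousP fK /subspace_continuousP gK.
by apply/subspace_continuousP => x Kx; apply: cvgM; [exact: fK|exact: gK].
Qed.

Lemma inC_clip (f : V -> R) : inC K f -> inC K (fun x => Num.min 1 (Num.max 0 (f x))).
Proof.
move=> /inC_edistP fK; apply/inC_edistP => x Kx e e0.
have [delta delta0 h] := fK x Kx e e0; exists delta => // y Ky xy.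
have := h y Ky xy; rewrite !ltr_norml /Num.max /Num.min => /andP[? ?].
by case: (ltP 0 (f x)) => ?; case: (ltP 0 (f y)) => ?;
  repeat (case: ifPn; rewrite -?leNgt => ?); apply/andP; split; lra.
Qed.

Lemma closed_superlevel (f : V -> R) (a : R) : inC K f -> closed [set x | K x /\ a <= f x].
Proof.
move=> /inC_edistP fK; rewrite -openC openE => x xN; apply/nbhs_edistP.
have [Kx|/(closed_edist K_closed)[e e0 eK]] := pselect (K x); last first.
  by exists e => // y xy [/eK]; rewrite leNgt xy.
have fxa : f x < a by rewrite ltNge; apply/negP => ?; exact: xN.
have [|delta delta0 h] := fK x Kx (a - f x); first by rewrite subr_gt0.
exists delta => // y xy [Ky afy]; have := h y Ky xy; rewrite ltr_norml => /andP[]; lra.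
Qed.

Lemma closed_borel (F : set V) : closed F -> measurable (F : set (borel R d)).
Proof.
by move=> cF; rewrite -[F]setCK; apply: measurableC; apply: sub_sigma_algebra; exact: closed_openC.
Qed.

Lemma inC_measurable (f : V -> R) : inC K f -> measurable_fun (K : set (borel R d)) f.
Proof.
move=> fK; apply: (measurability _ (RGenCInfty.measurableE R)).
move=> _ [_ [a ->] <-]; apply: closed_borel.
rewrite (_ : _ `&` _ = [set x | K x /\ a <= f x]); first exact: closed_superlevel.
by apply/seteqP; split=> x /=; rewrite in_itv/= andbT.
Qed.

Lemma functional_sum (L : (V -> R) -> R) n (f : nat -> V -> R) :
  (forall f g s t, inC K f -> inC K g ->
    L (fun x => s * f x + t * g x) = s * L f + t * L g) ->
  (forall i, inC K (f i)) -> L (fun x => \sum_(i < n) f i x) = \sum_(i < n) L (f i).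
Proof.
move=> L_lin fK; elim: n => [|n IH].
  have := L_lin _ _ 0 0 (@inC_cst R d K 0) (@inC_cst R d K 0).
  rewrite !mul0r !addr0 big_ord0 => L0; rewrite -[RHS]L0; congr L.
  by apply/funext => x; rewrite big_ord0.
rewrite big_ord_recr /= -IH.
have sK : inC K (fun x => \sum_(i < n) f i x).
  exact: (@inC_sum R d K K_compact _ (index_enum 'I_n) (fun i => f i) (fun i => fK i)).
rewrite -[L (fun x => \sum_(i < n) f i x)]mul1r -[L (f n)]mul1r -L_lin//.
by congr L; apply/funext => x; rewrite big_ord_recr /= !mul1r.
Qed.

Section Pairing.
Context (P : probability (borel R d) R).
Hypothesis P_K : concentrated K P.

Let mK : measurable (K : set (borel R d)). Proof. exact: closed_borel. Qed.

Lemma inC_integrable (f : V -> R) : inC K f -> P.-integrable (K : set (borel R d)) (EFin \o f).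
Proof.
move=> fK; apply: measurable_bounded_integrable => //.
- by rewrite (le_lt_trans (probability_le1 _ _)) ?ltry.
- exact: inC_measurable.
- have [M fM] := inC_bounded K_compact fK.
  by exists M; split; [exact: num_real|move=> N MN x Kx; exact: le_trans (fM x Kx) (ltW MN)].
Qed.

Lemma pairing_lin f g s t : inC K f -> inC K g ->
  pairing K P (fun x => s * f x + t * g x) = s * pairing K P f + t * pairing K P g.
Proof.
move=> fK gK; have zK : inC K (fun=> 0) by exact: inC_cst.
have scale v (h : V -> R) : inC K h -> inC K (fun x => v * h x).
  move=> hK; have := @inC_lin R d K K_compact v 0 _ _ hK zK.
  by under eq_fun do rewrite mul0r addr0.
rewrite /pairing RintegralD//; last 2 first.
- by apply: inC_integrable; exact: scale.
- by apply: inC_integrable; exact: scale.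
by rewrite !RintegralZl//; exact: inC_integrable.
Qed.

Lemma pairing_le f g : inC K f -> inC K g -> (forall x, K x -> f x <= g x) ->
  pairing K P f <= pairing K P g.
Proof. by move=> fK gK fg; apply: le_Rintegral => //; exact: inC_integrable. Qed.

Lemma concentrated_total : P (K : set (borel R d)) = 1%E.
Proof.
have := probability_setC P mK; rewrite (_ : P (~` K) = 0%E)// => /esym h.
have Pfin : P (K : set (borel R d)) \is a fin_num by rewrite fin_num_measure.
move: h; rewrite -(fineK Pfin) -EFinB => -[h].
by congr EFin; lra.
Qed.

Lemma pairing1 : pairing K P (fun=> 1) = 1.
Proof.
rewrite /pairing Rintegral_cst// mul1r -[RHS]/(fine 1%E); congr fine.
exact: concentrated_total.
Qed.

Lemma pairingE f : inC K f -> (pairing K P f)%:E = (\int[P]_(x in (K : set (borel R d))) (f x)%:E)%E.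
Proof. by move=> fK; rewrite /pairing fineK//; exact/integrable_fin_num/inC_integrable. Qed.

Lemma pairing_le_measure f (B : set (borel R d)) : inC K f -> measurable B ->
  (forall x, K x -> 0 <= f x <= 1) -> (forall x, K x -> 0 < f x -> B x) ->
  ((pairing K P f)%:E <= P B)%E.
Proof.
move=> fK mB f01 fB; rewrite pairingE//.
apply: (@le_trans _ _ (\int[P]_(x in (K : set (borel R d))) (\1_B x)%:E)%E).
  apply: ge0_integral_le => x Kx; rewrite lee_fin; first by case/andP: (f01 x Kx).
  rewrite indicE; have [Bx|nBx] := pselect (B x).
    by rewrite mem_set//; case/andP: (f01 x Kx).
  by rewrite memNset// leNgt; apply/negP => /(fB x Kx).
rewrite integral_indic//; apply: le_measure; last by move=> x [].
  by rewrite inE; exact: measurableI.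
by rewrite inE.
Qed.

Lemma measure_le_pairing f (B : set (borel R d)) : inC K f -> measurable B ->
  (forall x, K x -> 0 <= f x) -> (forall x, B x -> K x /\ 1 <= f x) ->
  (P B <= (pairing K P f)%:E)%E.
Proof.
move=> fK mB f0 fB; rewrite pairingE//.
have -> : P B = (\int[P]_(x in (K : set (borel R d))) (\1_B x)%:E)%E.
  by rewrite integral_indic// setIidl// => x /fB[].
apply: ge0_integral_le => x Kx; rewrite lee_fin//.
rewrite indicE; have [Bx|nBx] := pselect (B x); last by rewrite memNset// f0.
by rewrite mem_set//; case: (fB x Bx).
Qed.

End Pairing.

Context (nu : (V -> R) -> R).
Hypothesis nu_lin : forall f g s t, inC K f -> inC K g ->
  nu (fun x => s * f x + t * g x) = s * nu f + t * nu g.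
Hypothesis nu_le : forall f g, inC K f -> inC K g ->
  (forall x, K x -> f x <= g x) -> nu f <= nu g.
Hypothesis nu1 : nu (fun=> 1) = 1.

Let nu_cst c : nu (fun=> c) = c.
Proof.
have := nu_lin c 0 (@inC_cst R d K 1) (@inC_cst R d K 1).
by rewrite nu1 !mulr1 !addr0.
Qed.

Let nu_sum n (f : nat -> V -> R) : (forall i, inC K (f i)) ->
  nu (fun x => \sum_(i < n) f i x) = \sum_(i < n) nu (f i).
Proof. exact: functional_sum. Qed.

(** The value 1 has to be reached at a finite stage, so that the closed sets where [f n] is at least
    1 exhaust the points of [A] in [K]. Only points of [K] are tested, which makes the resulting
    measure concentrated on [K]. *)
Definition covers (A : set V) (f : nat -> V -> R) : Prop :=
  [/\ forall n, inC K (f n), forall n x, K x -> 0 <= f n x,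
      forall n x, K x -> f n x <= f n.+1 x
    & forall x, A x -> K x -> exists n, 1 <= f n x].

(* The upper integral of the indicator of A, as in Daniell's construction. *)
Definition riesz_content (A : set V) : R :=
  inf [set b | exists2 f, covers A f & forall n, nu (f n) <= b].

Let covers_mono A f n n' x : covers A f -> (n <= n')%N -> K x -> f n x <= f n' x.
Proof.
move=> [_ _ fmono _] /subnK <- Kx; elim: (n' - n)%N => //= k IH.
by apply: le_trans IH _; rewrite addSn fmono.
Qed.

Let covers1 A : covers A (fun _ _ => 1).
Proof. by split=> // n; exact: inC_cst. Qed.

Let content_has_inf A : has_inf [set b | exists2 f, covers A f & forall n, nu (f n) <= b].
Proof.
split; first by exists 1, (fun _ _ => 1); [exact: covers1|move=> n; rewrite nu1].
exists 0 => b [f [fK f0 _ _] /(_ 0%N)]; apply: le_trans; rewrite -[0](nu_cst 0).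
by apply: nu_le => //; [exact: inC_cst|exact: f0].
Qed.

Lemma riesz_content_le A f b : covers A f -> (forall n, nu (f n) <= b) ->
  riesz_content A <= b.
Proof. by move=> Af fb; apply: ge_inf; [case: (content_has_inf A)|exists f]. Qed.

Lemma riesz_content_approx A (e : R) : 0 < e -> exists f b,
  [/\ covers A f, forall n, nu (f n) <= b & b < riesz_content A + e].
Proof.
move=> e0; have [b [f Af fb] bA] := inf_adherent e0 (content_has_inf A).
by exists f, b.
Qed.

Lemma riesz_content_ge0 A : 0 <= riesz_content A.
Proof.
apply: lb_le_inf; first by case: (content_has_inf A).
move=> b [f [fK f0 _ _] /(_ 0%N)]; apply: le_trans; rewrite -[0](nu_cst 0).
by apply: nu_le => //; [exact: inC_cst|exact: f0].
Qed.

Lemma riesz_content_disjoint A : (forall x, A x -> ~ K x) -> riesz_content A = 0.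
Proof.
move=> AK; apply/eqP; rewrite eq_le riesz_content_ge0 andbT.
apply: (@riesz_content_le _ (fun _ _ => 0)); last by move=> n; rewrite nu_cst.
by split=> // [n|x /AK]; [exact: inC_cst|].
Qed.

Lemma riesz_content_le1 A : riesz_content A <= 1.
Proof. by apply: riesz_content_le (covers1 A) _ => n; rewrite nu1. Qed.

(* Dini's theorem: an increasing sequence of continuous functions reaching 1 at
   every point of K exceeds 1 - e on K from some index on. *)
Lemma riesz_contentT : riesz_content setT = 1.
Proof.
apply/eqP; rewrite eq_le riesz_content_le1 /=.
apply: lb_le_inf; first by case: (content_has_inf setT).
move=> b [f cf fb]; have [fK f0 fm fc] := cf; apply/ler_addgt0Pl => e e0.
have [x Kx|N NP] := @compact_eventually R d K (fun n x => K x -> 1 - e <= f n x) K_compact.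
  have [j fj] := fc x I Kx; have /inC_edistP/(_ x Kx e e0)[delta delta0 h] := fK j.
  exists delta => //; exists j => n y jn xy Ky; apply: le_trans (covers_mono cf jn Ky).
  by have := h y Ky xy; rewrite ltr_norml => /andP[]; lra.
rewrite -lerBlDl; apply: le_trans (fb N); rewrite -[leLHS]nu_cst.
by apply: nu_le => //; [exact: inC_cst|move=> x Kx; exact: NP].
Qed.

Definition riesz_outer (A : set V) : \bar R := (riesz_content A)%:E.

Let riesz_outer0 : riesz_outer set0 = 0%E.
Proof. by rewrite /riesz_outer riesz_content_disjoint. Qed.

Let riesz_outer_ge0 A : (0 <= riesz_outer A)%E.
Proof. by rewrite lee_fin riesz_content_ge0. Qed.

Let le_riesz_outer : {homo riesz_outer : A B / A `<=` B >-> (A <= B)%E}.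
Proof.
move=> A B AB; rewrite lee_fin; apply/ler_addgt0Pl => e e0; rewrite addrC.
have [f [b [[fK f0 fm fc] fb bB]]] := riesz_content_approx B e0.
by apply: le_trans (riesz_content_le (f := f) _ fb) (ltW bB); split=> // x /AB; exact: fc.
Qed.

Let riesz_outer_sigma_subadditive : sigma_subadditive riesz_outer.
Proof.
move=> F; set s := (\sum_(i <oo) _)%E.
have s_ge n : ((\sum_(i < n) riesz_content (F i))%:E <= s)%E.
  rewrite -sumEFin -(big_mkord predT (fun i => (riesz_content (F i))%:E)).
  apply: (@nneseries_lim_ge _ (fun i => riesz_outer (F i)) predT 0%N n) => *.
  exact: riesz_outer_ge0.
have [soo|sfin] := eqVneq s +oo%E; first by rewrite soo leey.
have s0 : (0 <= s)%E by have := s_ge 0%N; rewrite big_ord0.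
have {}sfin : s \is a fin_num by rewrite ge0_fin_numE// ltey.
rewrite -(fineK sfin) lee_fin; apply/ler_addgt0Pl => e e0; rewrite addrC.
have s_ge' n : \sum_(i < n) riesz_content (F i) <= fine s.
  by rewrite -lee_fin fineK.
have /choice[f fP] i : exists f : nat -> V -> R, covers (F i) f /\
    forall n, nu (f n) <= riesz_content (F i) + e / 2 ^+ i.+1.
  have [|f [b [Ff fb bF]]] := @riesz_content_approx (F i) (e / 2 ^+ i.+1).
    by rewrite divr_gt0// exprn_gt0.
  by exists f; split=> // n; exact: le_trans (fb n) (ltW bF).
have geo n : \sum_(i < n) e / 2 ^+ i.+1 <= e.
  suff -> : \sum_(i < n) e / 2 ^+ i.+1 = e - e / 2 ^+ n.
    by rewrite gerBl divr_ge0 ?(ltW e0)// exprn_ge0.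
  elim: n => [|n IH]; first by rewrite big_ord0 expr0 divr1 subrr.
  by rewrite big_ord_recr /= IH exprSr invfM; lra.
(* Diagonal sums: with [n], both the number of terms and each term grow. At stage [maxn j k.+1] the
   [k]-th term is present and has reached 1. *)
apply: (@riesz_content_le _ (fun n x => \sum_(k < n) f k n x)).
  split.
  - by move=> n; apply: inC_sum => // k; case: (fP k) => -[].
  - by move=> n x Kx; apply: sumr_ge0 => k _; case: (fP k) => -[_ + _ _] _; exact.
  - move=> n x Kx; rewrite big_ord_recr /= -[leLHS]addr0 lerD//; last first.
      by case: (fP n) => -[_ + _ _] _; exact.
    by apply: ler_sum => k _; case: (fP k) => -[_ _ + _] _; exact.
  - move=> x [k _ Fkx] Kx; have [cf _] := fP k; have [_ _ _ fc] := cf.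
    have [j fj] := fc x Fkx Kx; exists (maxn j k.+1).
    have kn : (k < maxn j k.+1)%N by rewrite leq_maxr.
    rewrite (bigD1 (Ordinal kn))//= -[1]addr0 lerD//.
      by apply: le_trans fj (covers_mono cf (leq_maxl _ _) Kx).
    by apply: sumr_ge0 => i _; case: (fP i) => -[_ + _ _] _; exact.
move=> n; rewrite (nu_sum _ (f := fun k => f k n)); last by move=> k; case: (fP k) => -[].
apply: (@le_trans _ _ (\sum_(k < n) (riesz_content (F k) + e / 2 ^+ k.+1))).
  by apply: ler_sum => k _; case: (fP k).
by rewrite big_split lerD.
Qed.

HB.instance Definition _ := isOuterMeasure.Build R V riesz_outer
  riesz_outer0 riesz_outer_ge0 le_riesz_outer riesz_outer_sigma_subadditive.

(** A cover [f] of [A] is split with the functions [phi] decreasing to [F]. For fixed [n], the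
    products of [f l] with [phi n] cover the part inside [F]; the functions [g n], products of [f n]
    with [1 - phi n], increase and cover the part outside. Together they stay below a later [f], so
    the two values of [nu] add up to at most [b]. *)
Let closed_caratheodory F : closed F -> caratheodory_measurable riesz_outer F.
Proof.
move=> cF; apply: le_caratheodory_measurable => A; rewrite -EFinD lee_fin.
have [phi [phi01 phiF phim phi0 phiC]] := closed_separation cF.
have phi_mono k k' x : (k <= k')%N -> phi k' x <= phi k x.
  move=> /subnK <-; elim: (k' - k)%N => //= i IH; apply: le_trans IH.
  by rewrite addSn phim.
apply/ler_addgt0Pl => e e0; have [f [b [cf fb bA]]] := riesz_content_approx A e0.
have [fK f0 fm fc] := cf.
rewrite [leRHS]addrC; apply: le_trans (ltW bA).
pose g n x := f n x * (1 - phi n x).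
have gK n : inC K (g n).
  apply: inC_mul => //; have := @inC_lin R d K K_compact 1 (-1) _ _ (@inC_cst R d K 1) (phiC n K).
  by under eq_fun do rewrite mulr1 mulN1r.
have gb n : nu (g n) <= b - riesz_content (A `&` F).
  rewrite lerBrDl -lerBrDr; apply: (@riesz_content_le _ (fun l x => f l x * phi n x)).
    split.
    - by move=> l; exact: inC_mul.
    - by move=> l x Kx; rewrite mulr_ge0 ?f0//; case/andP: (phi01 n x).
    - by move=> l x Kx; rewrite ler_wpM2r ?fm//; case/andP: (phi01 n x).
    - by move=> x [Ax Fx] Kx; have [l fl] := fc x Ax Kx; exists l; rewrite phiF// mulr1.
  move=> l; rewrite lerBrDr; apply: le_trans (fb (maxn l n)).
  have := nu_lin 1 1 (inC_mul (fK l) (phiC n K)) (gK n).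
  rewrite !mul1r => <-; apply: nu_le => //.
    by apply: inC_lin => //; exact: inC_mul.
  move=> x Kx; rewrite !mul1r /g; have /andP[p0 p1] := phi01 n x.
  have h1 := covers_mono cf (leq_maxl l n) Kx; have h2 := covers_mono cf (leq_maxr l n) Kx.
  have h3 := ler_wpM2r p0 h1; have p1' : 0 <= 1 - phi n x by rewrite subr_ge0.
  by have := ler_wpM2r p1' h2; lra.
suff : riesz_content (A `&` ~` F) <= b - riesz_content (A `&` F) by lra.
apply: (@riesz_content_le _ g _ _ gb); split.
- exact: gK.
- by move=> n x Kx; rewrite mulr_ge0 ?f0// subr_ge0; case/andP: (phi01 n x).
- move=> n x Kx; apply: ler_pM; rewrite ?f0 ?fm// ?subr_ge0 ?lerB//.
  by case/andP: (phi01 n x).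
- move=> x [Ax nFx] Kx; have [k pk] := phi0 x nFx; have [l fl] := fc x Ax Kx.
  exists (maxn l k); rewrite /g; have -> : phi (maxn l k) x = 0.
    apply/eqP; rewrite eq_le; case/andP: (phi01 (maxn l k) x) => -> _.
    by rewrite andbT -pk phi_mono// leq_maxr.
  by rewrite subr0 mulr1 (le_trans fl)// (covers_mono cf (leq_maxl _ _) Kx).
Qed.

Let borel_caratheodory (A : set (borel R d)) : measurable A ->
  caratheodory_measurable riesz_outer (A : set V).
Proof.
(* Being Borel means belonging to every sigma-algebra that contains the open sets, here that of the
   Caratheodory measurable sets. *)
move=> mA; apply: (mA (caratheodory_measurable riesz_outer)); split.
  split.
  - exact: caratheodory_measurable_set0.
  - by move=> B mB; rewrite setTD; exact: caratheodory_measurable_setC.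
  - by move=> B mB; exact: caratheodory_measurable_bigcup.
move=> U oU; rewrite -[U]setCK; apply: caratheodory_measurable_setC.
by apply: closed_caratheodory; exact: open_closedC.
Qed.

Definition riesz_measure (A : set (borel R d)) : \bar R := riesz_outer A.

Let riesz_measure0 : riesz_measure set0 = 0%E.
Proof. exact: riesz_outer0. Qed.

Let riesz_measure_ge0 A : (0 <= riesz_measure A)%E.
Proof. exact: riesz_outer_ge0. Qed.

Let riesz_measure_sigma_additive : semi_sigma_additive riesz_measure.
Proof.
move=> F mF tF mUF.
apply: (@caratheodory_measure_sigma_additive R V riesz_outer F) => //.
  by move=> i; exact: borel_caratheodory.
exact: borel_caratheodory.
Qed.

HB.instance Definition _ := isMeasure.Build _ _ _ riesz_measure
  riesz_measure0 riesz_measure_ge0 riesz_measure_sigma_additive.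

Let riesz_measureT : riesz_measure setT = 1%E.
Proof. by rewrite /riesz_measure /riesz_outer riesz_contentT. Qed.

HB.instance Definition _ := Measure_isProbability.Build _ _ _ riesz_measure riesz_measureT.

Let riesz_concentrated : concentrated K riesz_measure.
Proof. by congr EFin; apply: riesz_content_disjoint. Qed.

Local Notation I := (pairing K riesz_measure).

Let clip (t : R) : R := Num.min 1 (Num.max 0 t).

Let sum_clip n (t : R) : 0 <= t -> \sum_(i < n) clip (t - i%:R) = Num.min t n%:R.
Proof.
move=> t0; elim: n => [|n IH]; first by rewrite big_ord0; apply/esym/min_idPr.
rewrite big_ord_recr /= IH /clip -natr1 /Num.max /Num.min.
by case: (ltP t n%:R) => ?; case: (ltP t (n%:R + 1)) => ?; case: (ltP 0 (t - n%:R)) => ?;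
  repeat (case: ifPn; rewrite -?leNgt => ?); lra.
Qed.

Let clip01 t : 0 <= clip t <= 1.
Proof. by rewrite /clip le_min ge_min lexx ler01 le_max lexx. Qed.

(* Cut N f into layers c i = clip (N f - i): where c (i + 1) is positive, c i
   reaches 1, so I (c (i + 1)) <= riesz_measure [c i >= 1] <= nu (c i). *)
Let riesz_pairing_le f : inC K f -> (forall x, K x -> 0 <= f x <= 1) -> I f <= nu f.
Proof.
move=> fK f01; suff key N : N.+1%:R * I f <= 1 + N.+1%:R * nu f.
  apply/ler_addgt0Pl => e e0; have [N /(_ N (leqnn N)) Ne] := invS_le e0.
  rewrite -(ler_pM2l (ltr0Sn R N)); apply: le_trans (key N) _.
  rewrite mulrDr lerD2r; have := ler_wpM2l (ler0n R N.+1) Ne.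
  by rewrite mulfV// pnatr_eq0.
pose c i x := clip (N.+1%:R * f x - i%:R).
have cK i : inC K (c i).
  have := @inC_clip _ (@inC_lin R d K K_compact N.+1%:R (- i%:R) _ _ fK (@inC_cst R d K 1)).
  by under eq_fun do rewrite mulr1.
have sumc x : K x -> \sum_(i < N.+1) c i x = N.+1%:R * f x.
  move=> Kx; have /andP[f0 f1] := f01 x Kx; rewrite /c sum_clip ?mulr_ge0//.
  by apply/min_idPl; rewrite -[leRHS]mulr1 ler_wpM2l.
have total (L : (V -> R) -> R) : (forall f g s t, inC K f -> inC K g ->
      L (fun x => s * f x + t * g x) = s * L f + t * L g) ->
    (forall f g, inC K f -> inC K g -> (forall x, K x -> f x <= g x) -> L f <= L g) ->
    N.+1%:R * L f = \sum_(i < N.+1) L (c i).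
  move=> Llin Lle; rewrite -functional_sum//.
  have NfK := @inC_lin R d K K_compact N.+1%:R 0 _ _ fK fK.
  have <- : L (fun x => N.+1%:R * f x + 0 * f x) = N.+1%:R * L f.
    by rewrite Llin// mul0r addr0.
  have sK := @inC_sum R d K K_compact _ (index_enum 'I_N.+1) (fun i => c i) (fun i => cK i).
  apply/eqP; rewrite eq_le; apply/andP; split; apply: Lle => // x Kx;
  by rewrite mul0r addr0 sumc.
rewrite (total I)//; last 2 first.
- by move=> *; exact: pairing_lin.
- by move=> *; exact: pairing_le.
(* The layer [c 0] has no predecessor and is bounded by 1, the extra term of [key]; on the side of
   [nu] the last layer is dropped. *)
rewrite (total nu)// big_ord_recl /= lerD//.
  rewrite -[leRHS](pairing1 riesz_concentrated); apply: pairing_le => //.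
    exact: inC_cst.
  by move=> x _; case/andP: (clip01 (N.+1%:R * f x - 0%:R)).
have nuc0 i : 0 <= nu (c i).
  rewrite -(nu_cst 0); apply: nu_le => //; first exact: inC_cst.
  by move=> x _; case/andP: (clip01 (N.+1%:R * f x - i%:R)).
rewrite big_ord_recr /= -[leLHS]addr0 lerD// ler_sum// => i _; rewrite -lee_fin.
pose B : set (borel R d) := [set x | K x /\ 1 <= c i x].
have mB : measurable B by apply: closed_borel; exact: closed_superlevel.
apply: (@le_trans _ _ (riesz_measure B)).
  apply: pairing_le_measure => // [x Kx|x Kx]; first exact: clip01.
  rewrite /c /clip lt_min ltr01 /= lt_max ltxx /= => h; split=> //.
  rewrite /c /clip le_min lexx /= le_max; apply/orP; right.
  by move: h; rewrite /bump /= add1n -natr1; lra.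
rewrite lee_fin; apply: (@riesz_content_le _ (fun=> c i)) => //; split=> //.
  by move=> _ x _; case/andP: (clip01 (N.+1%:R * f x - i%:R)).
by move=> x [_ h] _; exists 0%N.
Qed.

(** The inequality applied to [1 - g] gives its converse when [g] takes values between 0 and 1; the
    general case follows by an affine change of [f]. *)
Let riesz_pairing f : inC K f -> I f = nu f.
Proof.
move=> fK; have unit_case g : inC K g -> (forall x, K x -> 0 <= g x <= 1) -> I g = nu g.
  move=> gK g01; apply/eqP; rewrite eq_le riesz_pairing_le//=.
  have g'K := @inC_lin R d K K_compact 1 (-1) _ _ (@inC_cst R d K 1) gK.
  have := riesz_pairing_le g'K.
  rewrite nu_lin//; last exact: inC_cst.
  rewrite pairing_lin//; last exact: inC_cst.
  rewrite nu1 pairing1// => h; suff : 1 * 1 + -1 * I g <= 1 * 1 + -1 * nu g by lra.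
  by apply: h => x Kx; have /andP[? ?] := g01 x Kx; apply/andP; split; lra.
have [M fM] := inC_bounded K_compact fK.
have [x0 Kx0] := K_nonempty; have M0 : 0 <= M by exact: le_trans (normr_ge0 _) (fM x0 Kx0).
have N0 : 0 < 2 * M + 1 by lra.
have oneK : inC K (fun=> 1) by exact: inC_cst.
(* This is (f + M) / (2M + 1), with values between 0 and 1; the denominator is positive even for
   [M = 0]. *)
have gK := @inC_lin R d K K_compact (2 * M + 1)^-1 (M / (2 * M + 1)) _ _ fK oneK.
have := unit_case _ gK; rewrite nu_lin// pairing_lin// nu1 pairing1// => h.
apply: (mulfI (invr_neq0 (lt0r_neq0 N0))); apply: (addIr (M / (2 * M + 1) * 1)); apply: h.
move=> x Kx; have := fM x Kx; rewrite ler_norml => /andP[h1 h2].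
rewrite mulr1 mulrC -mulrDl ler_pdivrMr// mul1r divr_ge0 ?(ltW N0)//=; lra.
Qed.

(** For uniqueness, let [f] be a cover of [A]. The sets where [f n] is at least 1 increase to a set
    containing the points of [A] in [K], and [mu'] gives each of them at most [nu (f n)]. So [mu']
    is at most [riesz_measure], and passing to complements gives equality, as both have mass 1. *)
Theorem riesz_representation : exists mu : probability (borel R d) R,
  [/\ concentrated K mu, forall f, inC K f -> pairing K mu f = nu f
    & forall mu' : probability (borel R d) R, concentrated K mu' ->
        (forall f, inC K f -> pairing K mu' f = nu f) ->
        forall A : set (borel R d), measurable A -> mu' A = mu A].
Proof.
exists riesz_measure; split=> // mu' mu'K mu'nu.
have le_riesz (A : set (borel R d)) : measurable A -> (mu' A <= riesz_measure A)%E.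
  move=> mA; have Afin : mu' A \is a fin_num by rewrite fin_num_measure.
  rewrite -(fineK Afin) lee_fin; apply/ler_addgt0Pl => e e0; rewrite addrC.
  have [f [b [cf fb bA]]] := riesz_content_approx A e0; apply: le_trans (ltW bA).
  have [fK f0 fm fc] := cf; rewrite -lee_fin (fineK Afin).
  pose E n : set (borel R d) := [set x | K x /\ 1 <= f n x].
  have mE n : measurable (E n) by apply: closed_borel; exact: closed_superlevel.
  have mUE : measurable (\bigcup_n E n) by exact: bigcupT_measurable.
  have mK : measurable (K : set (borel R d)) by exact: closed_borel.
  have ndE : nondecreasing_seq E.
    move=> n n' nn'; apply/subsetPset => x [Kx h]; split=> //.
    by apply: le_trans h _; exact: covers_mono cf nn' Kx.
  apply: (@le_trans _ _ (mu' (\bigcup_n E n))).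
    apply: (@le_trans _ _ (mu' ((\bigcup_n E n) `|` ~` (K : set (borel R d))))).
      apply: le_measure; rewrite ?inE//; first by apply: measurableU => //; exact: measurableC.
      move=> x Ax; have [Kx|nKx] := pselect (K x); last by right.
      by left; have [n fn] := fc x Ax Kx; exists n.
    apply: le_trans (measureU2 _ _ _) _ => //; first exact: measurableC.
    by rewrite [X in (_ + X)%E](_ : _ = 0%E) ?adde0//; exact: mu'K.
  have cvgE := nondecreasing_cvg_mu (mu := mu') mE mUE ndE.
  rewrite -(cvg_lim _ cvgE)//; apply: lime_le.
    by apply/cvg_ex; exists (mu' (\bigcup_n E n)).
  apply: nearW => n; rewrite -[leRHS]/(b%:E) /=.
  apply: (@le_trans _ _ (nu (f n))%:E); last by rewrite lee_fin.
  by rewrite -mu'nu//; apply: measure_le_pairing => //; exact: f0.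
move=> A mA; apply/eqP; rewrite eq_le le_riesz//=.
have := le_riesz _ (measurableC mA); rewrite !probability_setC//.
have h1 : mu' A \is a fin_num by rewrite fin_num_measure.
have h2 : riesz_measure A \is a fin_num by rewrite fin_num_measure.
by rewrite -(fineK h1) -(fineK h2) -!EFinB !lee_fin; lra.
Qed.

End RieszMeasure.

(** The summable moduli of [dini_summable] have small tails, so a single late one is small. *)
Lemma dini_inC (R : realType) (d : nat) (X K : set 'rV[R]_d) (p : 'rV[R]_d -> R) :
  K `<=` X -> dini_continuous X p -> inC K p.
Proof.
move=> KX /(@dini_summable _ _ _ _ (1 / 2)) [||e [e0 [A eA]] pe]; [lra|lra|].
apply/inC_edistP => x Kx eps eps0; have [L tailL] := summable_tail e0 eA (divr2_gt0 eps0).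
exists ((1 / 2) ^+ L.+1); first by rewrite exprn_gt0// divr_gt0.
move=> y Ky xy; apply: (@le_lt_trans _ _ (e L)).
  by apply: pe; [exact: KX|exact: KX|exact: ltW].
apply: (@le_lt_trans _ _ (eps / 2)); last by lra.
apply: le_trans (tailL L.+1); rewrite big_mkcond big_ord_recr /= leqnn lerDr.
by apply: sumr_ge0 => i _; case: ifP.
Qed.

Lemma weights_bounded (R : realType) (d m : nat) (K : set 'rV[R]_d)
    (p : 'I_m -> 'rV[R]_d -> R) : compact K -> (forall j, inC K (p j)) ->
  (forall j x, K x -> 0 < p j x) -> exists pmin pmax : R,
  [/\ 0 < pmin, forall j x, K x -> pmin <= p j x & forall j x, K x -> p j x <= pmax].
Proof.
move=> cK pK p0.
have /choice[M pM] j : exists M, forall x, K x -> `|p j x| <= M by exact: inC_bounded.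
have /choice[N pN] j : exists N : nat, forall n x, (N <= n)%N -> K x -> n.+1%:R^-1 <= p j x.
  have [x Kx|N NP] := @compact_eventually R d K (fun n x => K x -> n.+1%:R^-1 <= p j x) cK.
    have px2 := divr2_gt0 (p0 j x Kx).
    have /inC_edistP/(_ x Kx _ px2)[delta delta0 h] := @pK j.
    have [N NP] := invS_le px2; exists delta => //; exists N => n y Nn xy Ky.
    apply: le_trans (NP n Nn) _; have := h y Ky xy.
    by rewrite ltr_norml => /andP[_]; lra.
  by exists N => n x Nn Kx; exact: NP.
exists ((\max_(j < m) N j).+1%:R^-1), (\sum_(j < m) `|M j|); split.
- by rewrite invr_gt0.
- by move=> j x Kx; apply: pN => //; exact: leq_bigmax.
- move=> j x Kx; apply: (@le_trans _ _ `|M j|).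
    by apply: le_trans (ler_norm _) _; apply: le_trans (pM j x Kx) (ler_norm _).
  by rewrite (bigD1 j)//= lerDl sumr_ge0.
Qed.

(** * Uniqueness of the eigendata and the main result *)

Section DataConvergence.
Context (R : realType) (d : nat) (K : set 'rV[R]_d).
Context (T : ('rV[R]_d -> R) -> 'rV[R]_d -> R) (rho : R).
Context (h : 'rV[R]_d -> R) (mu : probability (borel R d) R).
Hypothesis K_compact : compact K.
Hypothesis T_inC : forall f, inC K f -> inC K (T f).
Hypothesis data : ruelle_data K T rho h mu.

(** [supnorm] is a real [sup], which dominates the values of bounded functions only; continuity on
    the compact [K] supplies the bound. *)
Lemma ruelle_data_cvg f x (e : R) : inC K f -> K x -> 0 < e -> exists n0, forall n,
  (n0 <= n)%N -> `|rho ^- n * iter n T f x - pairing K mu f * h x| <= e.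
Proof.
move=> fK Kx e0; case: data => -[hK _] _ _ _ /(_ f fK) /cvgrPdist_le /(_ e e0) [n0 _ n0P].
exists n0 => n n0n; have iK : inC K (iter n T f) by elim: n {n0n} => //= n; exact: T_inC.
have bnd := inC_bounded K_compact
  (@inC_lin R d K K_compact (rho ^- n) (- pairing K mu f) _ _ iK hK).
have := n0P n n0n; rewrite sub0r normrN; apply: le_trans.
apply: le_trans (ler_norm _).
apply: (@supnorm_ge R d K (fun x => rho ^- n * iter n T f x - pairing K mu f * h x)) => //.
case: bnd => M hM; exists M => y Ky; have := hM y Ky.
by rewrite mulNr.
Qed.

End DataConvergence.

(** The limit of [rho ^- n * iter n T f] does not involve the data, so the products
    [pairing K mu f * h] agree. With [f = 1] the pairings are 1, which identifies [h]; dividing by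
    [h x0] then identifies the pairings. *)
Lemma ruelle_data_unique (R : realType) (d : nat) (K : set 'rV[R]_d)
    (T : ('rV[R]_d -> R) -> 'rV[R]_d -> R) (rho : R) h mu h' mu' :
  compact K -> K !=set0 -> (forall f, inC K f -> inC K (T f)) ->
  ruelle_data K T rho h mu -> ruelle_data K T rho h' mu' ->
  (forall x, K x -> h' x = h x) /\
  (forall f, inC K f -> pairing K mu' f = pairing K mu f).
Proof.
move=> cK [x0 Kx0] TK D D'; have [[_ h0] muK _ _ _] := D; have [_ mu'K _ _ _] := D'.
have limit f x : inC K f -> K x -> pairing K mu' f * h' x = pairing K mu f * h x.
  move=> fK Kx; apply/eqP; rewrite -subr_eq0 -normr_le0; apply/ler_addgt0Pl => e e0.
  have [n1 k1] := ruelle_data_cvg cK TK D fK Kx (divr2_gt0 e0).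
  have [n2 k2] := ruelle_data_cvg cK TK D' fK Kx (divr2_gt0 e0).
  have := k1 _ (leq_maxl n1 n2); have := k2 _ (leq_maxr n1 n2).
  by rewrite !ler_norml => /andP[? ?] /andP[? ?]; apply/andP; split; lra.
have hE x : K x -> h' x = h x.
  move=> Kx; have := limit (fun=> 1) x (@inC_cst R d K 1) Kx.
  by rewrite !(pairing1 cK)// !mul1r.
split=> // f fK; have := limit f x0 fK Kx0; rewrite hE//.
by apply: mulIf; rewrite gt_eqF// h0.
Qed.

Theorem theorem4p5 (R : realType) (d m : nat) (X : set 'rV[R]_d)
    (w : 'I_m -> 'rV[R]_d -> 'rV[R]_d) (p : 'I_m -> 'rV[R]_d -> R)
    (K : set 'rV[R]_d)
    (X_nonempty : X !=set0) (X_compact : compact X)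
    (system : nonexpansive_system X w p)
    (contractive : exists j : 'I_m, weakly_contractive X (w j))
    (K_invariant : invariant_set X w K)
    (average_contraction : exists k : nat, (1 <= k)%N /\
       sup [set \sum_(J : k.-tuple 'I_m) pwJ w p J x * gammaJ K w J x | x in K]
         < spectral_radius K (ruelle w p) ^+ k) :
  ruelle_operator_theorem K w p.
Proof.
have [j0 wc] := contractive; have [k [k0 avg]] := average_contraction.
have m0 : (0 < m)%N by exact: leq_ltn_trans (leq0n j0) (ltn_ord j0).
have [[KX Kn cK _] _] := K_invariant; have [x0 Kx0] := Kn.
have Xw j x : X x -> X (w j x) by case: (system j) => + _ _ _; exact.
have wX j : nonexpansive X (w j) by case: (system j).
have stab := invariant_set_stable K_invariant.
have wK j x y : K x -> K y -> edist (w j x) (w j y) <= edist x y.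
  by move=> Kx Ky; apply: wX; exact: KX.
have pK j : inC K (p j) by case: (system j) => _ _ _; exact: dini_inC.
have p0 j x : K x -> 0 < p j x by move=> /KX Xx; case: (system j) => _ _ + _; exact.
have [pmin [pmax [pmin0 p_ge p_le]]] := weights_bounded cK pK p0.
have p_ge0 j x : K x -> 0 <= p j x by move=> /p0/ltW.
have pmax0 : 0 <= pmax by exact: le_trans (p_ge0 j0 x0 Kx0) (p_le j0 x0 Kx0).
set r := growth_rate K w p.
have r0 : 0 < r by exact: (growth_rate_gt0 m0 Kn stab pmin0 p_ge p_le).
have rho_le : spectral_radius K (ruelle w p) <= r.
  exact: (spectral_radius_le m0 Kn cK stab pmin0 p_ge p_le wK pK).
set s := sup _ in avg.
have rho0 : 0 <= spectral_radius K (ruelle w p).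
  exact: (spectral_radius_ge0 m0 Kn cK stab pmin0 p_ge p_le wK pK).
(* Here the inequality between the spectral radius and [r] brings the hypothesis to the growth
   rate. *)
have sr : s < r ^+ k by apply: lt_le_trans avg _; rewrite lerXn2r ?nnegrE// ltW.
have rk0 : 0 < r ^+ k by rewrite exprn_gt0.
(* The value [s] may be 0; the maximum ensures a positive [sigma], still below [r]. *)
pose s0 := Num.max s (r ^+ k / 2).
have s00 : 0 < s0 by rewrite /s0 lt_max (divr2_gt0 rk0) orbT.
have s0r : s0 < r ^+ k by rewrite /s0 gt_max sr /=; lra.
have [sigma sigma_ge0 sigmak] := exists_root k0 (ltW s00).
have sigma0 : 0 < sigma.
  rewrite lt_neqAle sigma_ge0 andbT; apply: contraTneq s00 => sigma00.
  by rewrite -sigmak -sigma00 expr0n gtn_eqF// ltxx.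
have sigmar : sigma < r.
  rewrite ltNge; apply: contraTN s0r => rs; rewrite -leNgt -sigmak.
  by rewrite lerXn2r ?nnegrE// ltW.
pose D (z : 'rV[R]_d * 'rV[R]_d) := edist z.1 z.2.
have K2_stable j z : (K `*` K) z -> (K `*` K) (coupled_maps w j z).
  by case=> *; split; exact: stab.
have q_ge0 j z : (K `*` K) z -> 0 <= coupled_weights p j z.
  by case=> Kz _; exact: p_ge0.
have [C C0 SD] : exists2 C : R, 0 <= C & forall n x y, K x -> K y ->
    iter n (transfer (coupled_maps w) (coupled_weights p)) D (x, y) <=
    C * sigma ^+ n * edist x y.
  have [|||z _|z [Kx Ky]|[x y] [Kx Ky]|C C0 h] := iter_transfer_geometric K2_stable q_ge0
    (k := k) (s := s0) (sigma := sigma) (M := m%:R * pmax) (f := D) k0.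
  - by rewrite mulr_ge0.
  - exact: sigma0.
  - by rewrite sigmak.
  - exact: edist_ge0.
  - rewrite /transfer; apply: (@le_trans _ _ (\sum_(j < m) pmax * D z)).
      apply: ler_sum => j _; apply: ler_pM; rewrite ?edist_ge0//.
      + exact: p_ge0.
      + exact: p_le.
      + exact: wK.
    by rewrite sumr_const card_ord -[_ *+ m]mulr_natl mulrA.
  - apply: le_trans (coupled_average_contraction K_invariant Xw wX pmin0 p_ge p_le k Kx Ky) _.
    by rewrite ler_wpM2r ?edist_ge0// /s0 le_max lexx.
  by exists C => // n x y Kx Ky; exact: (h n (x, y)).
have dini kappa : 0 < kappa -> kappa < 1 -> exists2 e : nat -> R,
    (forall i, 0 <= e i) /\ (exists A : R, forall n, \sum_(i < n) e i <= A) &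
    forall i j x y, K x -> K y -> edist x y <= kappa ^+ i -> `|p j x - p j y| <= e i.
  move=> kap0 kap1.
  have /choice[e he] j : exists e : nat -> R, [/\ forall i, 0 <= e i,
      exists A : R, forall n, \sum_(i < n) e i <= A & forall i x y, X x -> X y ->
      edist x y <= kappa ^+ i.+1 -> `|p j x - p j y| <= e i].
    case: (system j) => _ _ _ /(dini_summable)/(_ kap0 kap1)[e [e0 eA] pe].
    by exists e.
  have e_ge0 j i : 0 <= e j i by case: (he j).
  have /choice[A eA] j : exists A : R, forall n, \sum_(i < n) e j i <= A by case: (he j).
  (* [dini_summable] starts at scale [kappa ^+ 1]. At scale [kappa ^+ 0] the oscillation is bounded
     by [pmax], the weights lying between 0 and [pmax]. *)
  exists (fun i => if i is i'.+1 then \sum_(j < m) e j i' else pmax).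
    split=> [[|i]//|]; first by apply: sumr_ge0 => j _.
    exists (pmax + \sum_(j < m) `|A j|) => -[|n].
      by rewrite big_ord0 addr_ge0// sumr_ge0.
    rewrite big_ord_recl /= lerD2l exchange_big /=; apply: ler_sum => j _.
    exact: le_trans (eA j n) (ler_norm _).
  move=> [|i] j x y Kx Ky xy.
    have := p_le j x Kx; have := p_le j y Ky; have := p0 j x Kx; have := p0 j y Ky.
    by rewrite ler_norml; move=> *; apply/andP; split; lra.
  have [_ _ pe] := he j; apply: le_trans (pe i x y (KX _ Kx) (KX _ Ky) xy) _.
  by rewrite (bigD1 j)//= lerDl sumr_ge0.
have ec := equicontinuity stab pmin0 p_ge (fun x y _ _ => edist_ge0 x y) sigma0 sigmar C0 SD dini.
have irr := transfer_irreducible K_invariant Xw wX pmin0 p_ge wc.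
have [nu [h [[hbu [c c0 hc] Th nuh] [nu_lin nu_le nu1 nuT nu_cvg]]]] :=
  transfer_convergence m0 Kn stab pmin0 p_ge p_le (@edist_sym R d) wK ec irr.
have bu f : inC K f -> bounded_uniform K (@edist R d) f by move=> /(bounded_uniformP _ cK).
have hK : inC K h by apply/(bounded_uniformP _ cK).
have hpos x : K x -> 0 < h x by move=> /hc; exact: lt_le_trans.
(* The positive eigenfunction now shows that the growth rate is the spectral radius, so all that was
   proved for [r] concerns rho. *)
have rhoE : spectral_radius K (ruelle w p) = r.
  apply: (spectral_radius_eigenfunction m0 Kn cK stab pmin0 p_ge p_le wK pK hK Kx0 _ Th).
  by rewrite gt_eqF// hpos.
have TK f : inC K f -> inC K (ruelle w p f) by exact: transfer_inC.
have [mu [muK munu muU]] := riesz_representation cK Kn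
  (fun f g s t fK gK => nu_lin f g s t (bu f fK) (bu g gK))
  (fun f g fK gK => nu_le f g (bu f fK) (bu g gK)) nu1.
have data : ruelle_data K (ruelle w p) r h mu.
  split=> //.
  - by split=> [f fK|]; rewrite !munu//; [exact/nuT/bu|exact: TK].
  - move=> f fK; apply/cvgrPdist_le => e e0; have [n0 h0] := nu_cvg f (bu f fK) e e0.
    exists n0 => // n n0n; rewrite sub0r normrN ger0_norm.
      by apply: supnorm_le => // x Kx; rewrite munu//; exact: h0.
    apply: le_trans (normr_ge0 _) (supnorm_ge _ Kx0).
    by exists e => x Kx; rewrite munu//; exact: h0.
exists h, mu; rewrite /= rhoE; split=> // h' mu' data'.
have [hE pE] := ruelle_data_unique cK Kn TK data data'.
split=> //; apply: muU => [|f fK]; first by case: data'.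
by rewrite pE// munu.
Qed.
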